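(* Let $\gamma$ be a Jordan curve in $\mathbb{C}$, let $\Omega$ be the unbounded connected component of $\mathbb{C}\setminus\gamma^*$, and let $\phi:\overline{D}\to\overline{\Omega\cup\{\infty\}}$ (closure in $\hat{\mathbb{C}}$) be a Riemann mapping, i.e. a homeomorphism mapping $D$ conformally onto $\Omega\cup\{\infty\}$. Let $A(\Omega\cup\{\infty\})$ be the space of functions continuous on $\overline{\Omega}\cup\{\infty\}$ and holomorphic on $\Omega\cup\{\infty\}$, with the topology of uniform convergence. Then the set of functions $f\in A(\Omega\cup\{\infty\})$ such that $(f\circ\phi)\restriction_{\mathbb{T}}\in Z$ is a dense $G_\delta$ subset of $A(\Omega\cup\{\infty\})$.
   Context: $D$ is the open unit disc and $\mathbb{T}=\partial D$. A function $g$ on $\mathbb{T}$ is identified with the $2\pi$-periodic function $y\mapsto g(e^{iy})$ on $\mathbb{R}$, written $g(y)$. The class $Z$ consists of all continuous $f:\mathbb{T}\to\mathbb{C}$ such that for every $\theta\in\mathbb{R}$ $$\limsup_{y\to\theta^+}\left|\frac{\operatorname{Re}f(y)-\operatorname{Re}f(\theta)}{y-\theta}\right|=+\infty\quad\text{and}\quad \limsup_{y\to\theta^+}\left|\frac{\operatorname{Im}f(y)-\operatorname{Im}f(\theta)}{y-\theta}\right|=+\infty.$$ *)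

(* Defs.v *)
(* Stdlib reals + Coquelicot complex numbers C = R * R.
   The Riemann sphere  C^ = C ∪ {∞}  is modelled as  option C  (None = ∞). *)
From Stdlib Require Import Reals.
From Coquelicot Require Import Coquelicot.

Open Scope R_scope.

Definition Copen (U : C -> Prop) : Prop :=
  forall z, U z -> exists r, 0 < r /\ forall w, Cmod (w - z)%C < r -> U w.

Definition Cconnected (S : C -> Prop) : Prop :=
  ~ (exists U V : C -> Prop, Copen U /\ Copen V /\
       (forall z, S z -> U z \/ V z) /\
       (exists z, S z /\ U z) /\ (exists z, S z /\ V z) /\
       (forall z, S z -> U z -> V z -> False)).

Definition Cbounded (S : C -> Prop) : Prop :=
  exists M, forall z, S z -> Cmod z <= M.

Definition in_component (X : C -> Prop) (z w : C) : Prop :=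
  exists S, Cconnected S /\ (forall u, S u -> X u) /\ S z /\ S w.

Definition unbounded_component (X K : C -> Prop) : Prop :=
  exists z0, X z0 /\ (forall w, K w <-> in_component X z0 w) /\ ~ Cbounded K.

Definition Cclosure (S : C -> Prop) (z : C) : Prop :=
  forall eps, 0 < eps -> exists w, S w /\ Cmod (w - z)%C < eps.

Definition jordan_curve (g : R -> C) : Prop :=
  (forall t, 0 <= t <= 1 -> forall eps, 0 < eps -> exists delta, 0 < delta /\
      forall s, 0 <= s <= 1 -> Rabs (s - t) < delta -> Cmod (g s - g t)%C < eps) /\
  g 0 = g 1 /\
  (forall s t, 0 <= s < 1 -> 0 <= t < 1 -> g s = g t -> s = t).

Definition curve_image (g : R -> C) (z : C) : Prop :=
  exists t, 0 <= t <= 1 /\ g t = z.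

Definition Cderiv_at (f : C -> C) (z l : C) : Prop :=
  forall eps, 0 < eps -> exists delta, 0 < delta /\
    forall w, 0 < Cmod (w - z)%C < delta ->
      Cmod ((f w - f z) / (w - z) - l)%C < eps.

Definition ext_nbhd (p : option C) (N : option C -> Prop) : Prop :=
  match p with
  | Some z => exists r, 0 < r /\ forall w, Cmod (w - z)%C < r -> N (Some w)
  | None => N None /\ exists M, forall w, M < Cmod w -> N (Some w)
  end.

(* the map phi : D -> C^ is holomorphic at z (using the chart 1/w at ∞) *)
Definition ext_holo_at (phi : C -> option C) (z : C) : Prop :=
  match phi z with
  | Some v => exists l, forall eps, 0 < eps -> exists delta, 0 < delta /\
        forall w, 0 < Cmod (w - z)%C < delta ->
          exists u, phi w = Some u /\ Cmod ((u - v) / (w - z) - l)%C < eps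
  | None => exists l, forall eps, 0 < eps -> exists delta, 0 < delta /\
        forall w, 0 < Cmod (w - z)%C < delta ->
          exists u, phi w = Some u /\ Cmod ((/ u - 0) / (w - z) - l)%C < eps
  end.

(* closure of Ω ∪ {∞} in C^, i.e. cl(Ω) ∪ {∞} *)
Definition closure_ext (Om : C -> Prop) (p : option C) : Prop :=
  match p with None => True | Some z => Cclosure Om z end.

Definition Om_ext (Om : C -> Prop) (p : option C) : Prop :=
  match p with None => True | Some z => Om z end.

Definition riemann_map (Om : C -> Prop) (phi : C -> option C) : Prop :=
  (forall z, Cmod z <= 1 -> closure_ext Om (phi z)) /\
  (forall z w, Cmod z <= 1 -> Cmod w <= 1 -> phi z = phi w -> z = w) /\
  (forall p, closure_ext Om p -> exists z, Cmod z <= 1 /\ phi z = p) /\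
  (forall z, Cmod z <= 1 -> forall N, ext_nbhd (phi z) N ->
     exists delta, 0 < delta /\
       forall w, Cmod w <= 1 -> Cmod (w - z)%C < delta -> N (phi w)) /\
  (forall z, Cmod z <= 1 -> forall eps, 0 < eps ->
     exists N, ext_nbhd (phi z) N /\
       forall w, Cmod w <= 1 -> N (phi w) -> Cmod (w - z)%C < eps) /\
  (forall z, Cmod z < 1 -> Om_ext Om (phi z)) /\
  (forall p, Om_ext Om p -> exists z, Cmod z < 1 /\ phi z = p) /\
  (forall z, Cmod z < 1 -> ext_holo_at phi z).

(* F : C^ -> C (only values on cl(Ω) ∪ {∞} matter) is continuous on
   cl(Ω) ∪ {∞}, holomorphic on Ω and holomorphic at ∞ *)
Definition in_A (Om : C -> Prop) (F : option C -> C) : Prop :=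
  (forall p, closure_ext Om p -> forall eps, 0 < eps ->
     exists N, ext_nbhd p N /\
       forall q, closure_ext Om q -> N q -> Cmod (F q - F p)%C < eps) /\
  (forall z, Om z -> exists l, Cderiv_at (fun w => F (Some w)) z l) /\
  (exists l, forall eps, 0 < eps -> exists delta, 0 < delta /\
     forall w, 0 < Cmod w < delta ->
       Cmod ((F (Some (/ w)%C) - F None) / (w - 0) - l)%C < eps).

Definition A_open (Om : C -> Prop) (U : (option C -> C) -> Prop) : Prop :=
  forall F, in_A Om F -> U F -> exists eps, 0 < eps /\
    forall G, in_A Om G ->
      (forall p, closure_ext Om p -> Cmod (F p - G p)%C < eps) -> U G.

Definition A_dense (Om : C -> Prop) (S : (option C -> C) -> Prop) : Prop :=
  forall F, in_A Om F -> forall eps, 0 < eps ->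
    exists G, in_A Om G /\ S G /\
      forall p, closure_ext Om p -> Cmod (F p - G p)%C < eps.

Definition A_Gdelta (Om : C -> Prop) (S : (option C -> C) -> Prop) : Prop :=
  exists U : nat -> (option C -> C) -> Prop,
    (forall n, A_open Om (U n)) /\
    (forall F, in_A Om F -> (S F <-> forall n, U n F)).

(* g y stands for g(e^{iy}); g : T -> C continuous and, at every θ,
   the right upper Dini-type quotients of Re g and Im g are unbounded *)
Definition in_Z (g : R -> C) : Prop :=
  (forall t eps, 0 < eps -> exists delta, 0 < delta /\
     forall s, Rabs (s - t) < delta -> Cmod (g s - g t)%C < eps) /\
  (forall theta M delta, 0 < delta -> exists y, theta < y < theta + delta /\
     M < Rabs ((Re (g y) - Re (g theta)) / (y - theta))) /\
  (forall theta M delta, 0 < delta -> exists y, theta < y < theta + delta /\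
     M < Rabs ((Im (g y) - Im (g theta)) / (y - theta))).

Definition expi (y : R) : C := (cos y, sin y).

(* Main.v *)
(* For each n, the members of A whose boundary values have, at every point, some right
   difference quotient larger than n over a distance less than 1/(n+1) form an open set, by
   compactness of the circle and uniform continuity; this gives the G-delta part.

   For density no Baire argument is needed.  Given F in A, put f = F o phi and approximate it by
   z |-> f (r z) + c W z, where r < 1 is close to 1, c > 0 is small and
   W z = sum_n 16^-n z^(1024^n).  At each boundary point the dilated term is differentiable, so it
   has bounded difference quotients there, whereas both components of W have unbounded right
   difference quotients everywhere.  Composing with psi = phi^-1 leads back to A, provided psi is
   holomorphic.

   Holomorphy of psi comes from Cauchy's theory: Goursat's theorem in logarithmic polar
   coordinates makes circle means independent of the radius, which gives Cauchy's formula for a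
   function continuous on a disc and differentiable off its centre, hence the removable
   singularity theorem.  Critical points of a nonconstant holomorphic map are then isolated, so
   psi is differentiable off isolated points, and therefore everywhere. *)

Require Import Defs.
From Stdlib Require Import Reals Lra Lia Classical ClassicalEpsilon.
From Coquelicot Require Import Coquelicot.

(** The obstacle is that the data make [phi] holomorphic but its inverse merely continuous, whereas
    membership in A asks for differentiability on [Om] and at ∞. Most of the complex analysis below
    serves to bridge this gap. The curve is used to show that [Om] is open and contains all points
    of large modulus; the latter lets ∞ be treated in the chart 1/w.

    Logarithmic polar coordinates turn an annulus into a strip, so that Goursat's theorem is wanted
    for rectangles only: on a rectangle of height 2π the horizontal sides cancel by periodicity, and
    a difference of two circle integrals is left.

    The dilation is there because boundary values of f that are already rough could cancel those of
    c W.

    The coefficients 16^-n and frequencies 1024^n are tuned so that, over distances of order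
    1024^-n, the n-th term outweighs both the lower terms, whose slopes grow like 64^k with 64 =
    1024/16, and the tail. The quotients then have order 64^n. The estimate is uniform in the phase,
    which settles the cosine and the sine series together, and the integer frequencies make W a
    power series in z. *)

(** * Elementary inequalities for the complex modulus *)

Lemma Cmod_minus_sym (a b : C) : Cmod (a - b) = Cmod (b - a).
Proof. rewrite <- Cmod_opp. f_equal. ring. Qed.

Lemma Cmod_minus_triangle (a b c : C) : Cmod (a - c) <= Cmod (a - b) + Cmod (b - c).
Proof. replace (a - c)%C with ((a - b) + (b - c))%C by ring. apply Cmod_triangle. Qed.

Lemma Cmod_minus_ge (a b : C) : Cmod a - Cmod b <= Cmod (a - b).
Proof.
  assert (H := Cmod_triangle (a - b) b).
  replace (a - b + b)%C with a in H by ring. lra.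
Qed.

Lemma Cmod_minus_pos (a b : C) : a <> b -> 0 < Cmod (a - b).
Proof. intros H. apply Cmod_gt_0. now apply Cminus_eq_contra. Qed.

Lemma Cmod_minus_refl (a : C) : Cmod (a - a) = 0.
Proof. replace (a - a)%C with (RtoC 0) by ring. apply Cmod_0. Qed.

Lemma Cmod_le_abs (z : C) : Cmod z <= Rabs (Re z) + Rabs (Im z).
Proof.
  assert (Hz : z = (RtoC (Re z) + Ci * RtoC (Im z))%C).
  { destruct z as [x y]. unfold Ci, RtoC, Cplus, Cmult, Re, Im. simpl. f_equal; ring. }
  rewrite Hz at 1. eapply Rle_trans; [apply Cmod_triangle|].
  rewrite Cmod_mult, Cmod_Ci, !Cmod_R. lra.
Qed.

Lemma Rabs_Re_le (z : C) : Rabs (Re z) <= Cmod z.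
Proof. assert (H := Rmax_Cmod z). assert (H1 := Rmax_l (Rabs (fst z)) (Rabs (snd z))). unfold Re. lra. Qed.

Lemma Rabs_Im_le (z : C) : Rabs (Im z) <= Cmod z.
Proof. assert (H := Rmax_Cmod z). assert (H1 := Rmax_r (Rabs (fst z)) (Rabs (snd z))). unfold Im. lra. Qed.

(** * Compactness of intervals and discs *)

(** The form in which compactness of an interval is used throughout. The supremum [m] of the right
    ends up to which some [d] works is passed by means of the local [d] at [m], unless [m = b]. One
    number may serve both as radius and as parameter of [Q] because [Q] is inherited by smaller
    parameters. *)
Lemma interval_uniform (a b : R) (Q : R -> R -> Prop) :
  a <= b ->
  (forall d d' t, 0 < d' -> d' <= d -> Q d t -> Q d' t) ->
  (forall t, a <= t <= b -> exists d, 0 < d /\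
     forall t', a <= t' <= b -> Rabs (t' - t) < d -> Q d t') ->
  exists d, 0 < d /\ forall t, a <= t <= b -> Q d t.
Proof.
  intros Hab Hmono Hloc.
  set (E := fun x => a <= x <= b /\ exists d, 0 < d /\ forall t, a <= t <= x -> Q d t).
  destruct (completeness E) as [m [Hub Hlub]].
  - exists b. intros x [Hx _]. lra.
  - exists a. split; [lra|].
    destruct (Hloc a) as [d [Hd H]]; [lra|].
    exists d. split; [exact Hd|]. intros t Ht. apply H; [lra|].
    replace (t - a) with 0 by lra. rewrite Rabs_R0. exact Hd.
  - assert (Ham : a <= m).
    { apply Hub. split; [lra|].
      destruct (Hloc a) as [d [Hd H]]; [lra|].
      exists d. split; [exact Hd|]. intros t Ht. apply H; [lra|].
      replace (t - a) with 0 by lra. rewrite Rabs_R0. exact Hd. }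
    assert (Hmb : m <= b) by (apply Hlub; intros x [Hx _]; lra).
    destruct (Hloc m) as [d [Hd H]]; [lra|].
    assert (HE : exists x, E x /\ m - d < x).
    { apply NNPP. intros Hn.
      assert (m <= m - d); [|lra].
      apply Hlub. intros x Hx. apply Rnot_lt_le. intros Hlt. apply Hn. now exists x. }
    destruct HE as [x [[Hx [d1 [Hd1 Hx1]]] Hmx]].
    assert (Hxm : x <= m) by (apply Hub; split; [exact Hx|now exists d1]).
    set (y := Rmin b (m + d / 2)).
    assert (Hy : E y).
    { split; [unfold y, Rmin; destruct Rle_dec; lra|].
      exists (Rmin d d1). split; [now apply Rmin_glb_lt|].
      intros t Ht.
      assert (Ht' : t <= b /\ t <= m + d / 2)
        by (unfold y, Rmin in Ht; destruct Rle_dec; lra).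
      destruct (Rle_dec t x) as [Htx|Htx].
      - apply Hmono with d1; [now apply Rmin_glb_lt|apply Rmin_r|]. apply Hx1; lra.
      - apply Hmono with d; [now apply Rmin_glb_lt|apply Rmin_l|]. apply H; [lra|].
        apply Rabs_def1; lra. }
    assert (Hym := Hub y Hy).
    assert (Hyb : y = b) by (unfold y, Rmin in *; destruct Rle_dec; lra).
    rewrite Hyb in Hy. destruct Hy as [_ [d2 [Hd2 H2]]]. now exists d2.
Qed.

(** Two nested uses of [interval_uniform], on a square around the disc: the inner one makes [d]
    uniform along a vertical line and a thin strip about it, the outer one over all such lines. *)
Lemma disc_uniform (r : R) (Q : R -> C -> Prop) :
  0 <= r ->
  (forall d d' z, 0 < d' -> d' <= d -> Q d z -> Q d' z) ->
  (forall z, Cmod z <= r -> exists d, 0 < d /\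
     forall z', Cmod z' <= r -> Cmod (z' - z) < d -> Q d z') ->
  exists d, 0 < d /\ forall z, Cmod z <= r -> Q d z.
Proof.
  intros Hr Hmono Hloc.
  destruct (interval_uniform (-r) r
    (fun d x => forall y, -r <= y <= r -> Cmod (x, y) <= r -> Q d (x, y))) as [d [Hd H]].
  - lra.
  - intros d d' x Hd' Hdd H y Hy Hz. apply Hmono with d; auto.
  - intros x Hx.
    destruct (interval_uniform (-r) r
      (fun d y => forall x', Rabs (x' - x) < d -> Cmod (x', y) <= r -> Q d (x', y))) as [d [Hd H]].
    + lra.
    + intros d d' y Hd' Hdd H x' Hx' Hz. apply Hmono with d; auto. apply H; auto. lra.
    + intros y Hy. destruct (Rle_dec (Cmod (x, y)) r) as [Hz|Hz].
      * destruct (Hloc _ Hz) as [d [Hd H]].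
        exists (d / 2). split; [lra|]. intros y' _ Hy' x' Hx' Hz'.
        apply Hmono with d; [lra|lra|]. apply H; [exact Hz'|].
        eapply Rle_lt_trans; [apply Cmod_le_abs|]. simpl. unfold Rminus in *. lra.
      (* The requirement is vacuous here: a point outside the closed disc has a neighbourhood that
         misses the disc. *)
      * apply Rnot_le_lt in Hz.
        exists ((Cmod (x, y) - r) / 2). split; [lra|]. intros y' _ Hy' x' Hx' Hz'.
        exfalso. assert (H := Cmod_minus_ge (x, y) (x', y')).
        rewrite Cmod_minus_sym in H.
        assert (H1 := Cmod_le_abs ((x', y') - (x, y))%C). simpl in H1. unfold Rminus in *. lra.
    + exists d. split; [exact Hd|]. intros x' _ Hx' y Hy Hz. apply H; auto.
  - exists d. split; [exact Hd|]. intros [x y] Hz.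
    assert (H1 := Rabs_Re_le (x, y)). assert (H2 := Rabs_Im_le (x, y)). simpl in *.
    apply H; [|apply Rabs_le_between; lra|exact Hz]. apply Rabs_le_between; lra.
Qed.

Lemma disc_uniformly_continuous (r : R) (f : C -> C) :
  0 <= r ->
  (forall z, Cmod z <= r -> forall eps, 0 < eps -> exists d, 0 < d /\
     forall w, Cmod w <= r -> Cmod (w - z) < d -> Cmod (f w - f z) < eps) ->
  forall eps, 0 < eps -> exists d, 0 < d /\
    forall z w, Cmod z <= r -> Cmod w <= r -> Cmod (w - z) < d -> Cmod (f w - f z) < eps.
Proof.
  intros Hr Hf eps Heps.
  destruct (disc_uniform r
    (fun d z => forall w, Cmod w <= r -> Cmod (w - z) < d -> Cmod (f w - f z) < eps))
    as [d [Hd H]]; [exact Hr| | |].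
  - intros d d' z Hd' Hdd H w Hw Hwz. apply H; auto. lra.
  - intros z Hz. destruct (Hf z Hz (eps / 2)) as [d [Hd H]]; [lra|].
    exists (d / 2). split; [lra|]. intros z' Hz' Hzz w Hw Hwz.
    assert (H1 := H z' Hz'). assert (H2 := H w Hw).
    assert (H3 := Cmod_minus_triangle w z' z).
    assert (H4 := Cmod_minus_triangle (f w) (f z) (f z')).
    rewrite (Cmod_minus_sym (f z) (f z')) in H4.
    assert (Cmod (f z' - f z) < eps / 2) by (apply H1; lra).
    assert (Cmod (f w - f z) < eps / 2) by (apply H2; lra). lra.
  - exists d. split; [exact Hd|]. intros z w Hz Hw. now apply H.
Qed.

(** * Complex continuity and differentiability *)

Definition Ccont (f : C -> C) (z : C) : Prop :=
  forall eps, 0 < eps -> exists d, 0 < d /\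
    forall w, Cmod (w - z) < d -> Cmod (f w - f z) < eps.

(* Division-free form of [Cderiv_at]. *)
Definition Cdiff (f : C -> C) (z l : C) : Prop :=
  forall eps, 0 < eps -> exists d, 0 < d /\
    forall w, Cmod (w - z) < d -> Cmod (f w - f z - l * (w - z)) <= eps * Cmod (w - z).

Definition Cdiffable (f : C -> C) (z : C) : Prop := exists l, Cdiff f z l.

Lemma Cdiff_Cderiv_at (f : C -> C) (z l : C) : Cdiff f z l <-> Cderiv_at f z l.
Proof.
  split; intros H eps Heps.
  - destruct (H (eps / 2)) as [d [Hd Hf]]; [lra|].
    exists d. split; [exact Hd|]. intros w [Hw Hwd].
    assert (Hne : (w - z)%C <> 0) by now apply Cmod_gt_0.
    replace ((f w - f z) / (w - z) - l)%C with ((f w - f z - l * (w - z)) / (w - z))%C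
      by now field.
    rewrite Cmod_div by exact Hne.
    apply Rle_lt_trans with (eps / 2); [|lra].
    apply Rmult_le_reg_r with (Cmod (w - z)); [exact Hw|].
    unfold Rdiv at 1. rewrite Rmult_assoc, Rinv_l, Rmult_1_r by lra. now apply Hf.
  - destruct (H eps Heps) as [d [Hd Hf]].
    exists d. split; [exact Hd|]. intros w Hwd.
    destruct (Req_dec (Cmod (w - z)) 0) as [H0|H0].
    + assert (E := Cmod_eq_0 _ H0). rewrite E.
      assert (Ew : w = z) by (now apply Ceq_minus). subst w.
      replace (f z - f z - l * 0)%C with (RtoC 0) by ring. rewrite Cmod_0. lra.
    + assert (Hpos : 0 < Cmod (w - z)) by (assert (Hg := Cmod_ge_0 (w - z)); lra).
      assert (Hne : (w - z)%C <> 0) by now apply Cmod_gt_0.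
      replace (f w - f z - l * (w - z))%C with (((f w - f z) / (w - z) - l) * (w - z))%C
        by now field.
      rewrite Cmod_mult. apply Rmult_le_compat_r; [lra|]. apply Rlt_le, Hf. lra.
Qed.

Lemma Cdiff_Ccont (f : C -> C) (z l : C) : Cdiff f z l -> Ccont f z.
Proof.
  intros H eps Heps.
  destruct (H 1) as [d [Hd Hf]]; [lra|].
  assert (Hl := Cmod_ge_0 l).
  exists (Rmin d (eps / (2 * (Cmod l + 1)))). split.
  { apply Rmin_glb_lt; [exact Hd|]. apply Rdiv_lt_0_compat; lra. }
  intros w Hw.
  assert (Hw1 := Rlt_le_trans _ _ _ Hw (Rmin_l _ _)).
  assert (Hw2 := Rlt_le_trans _ _ _ Hw (Rmin_r _ _)).
  assert (H1 := Hf w Hw1).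
  replace (f w - f z)%C with ((f w - f z - l * (w - z)) + l * (w - z))%C by ring.
  eapply Rle_lt_trans; [apply Cmod_triangle|]. rewrite Cmod_mult.
  apply Rle_lt_trans with ((Cmod l + 1) * Cmod (w - z)); [lra|].
  apply Rle_lt_trans with ((Cmod l + 1) * (eps / (2 * (Cmod l + 1)))).
  - apply Rmult_le_compat_l; lra.
  - replace ((Cmod l + 1) * (eps / (2 * (Cmod l + 1)))) with (eps / 2) by (field; lra). lra.
Qed.

Lemma Cdiffable_Ccont (f : C -> C) (z : C) : Cdiffable f z -> Ccont f z.
Proof. intros [l H]. now apply Cdiff_Ccont with l. Qed.

Lemma Cdiff_ext_loc (f g : C -> C) (z l : C) (r : R) :
  0 < r -> (forall w, Cmod (w - z) < r -> f w = g w) -> Cdiff f z l -> Cdiff g z l.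
Proof.
  intros Hr Hfg H eps Heps. destruct (H eps Heps) as [d [Hd Hf]].
  exists (Rmin d r). split; [now apply Rmin_glb_lt|]. intros w Hw.
  assert (Hw1 := Rlt_le_trans _ _ _ Hw (Rmin_l _ _)).
  assert (Hw2 := Rlt_le_trans _ _ _ Hw (Rmin_r _ _)).
  rewrite <- !Hfg; [now apply Hf| |exact Hw2]. now rewrite Cmod_minus_refl.
Qed.

Lemma Cdiffable_ext_loc (f g : C -> C) (z : C) (r : R) :
  0 < r -> (forall w, Cmod (w - z) < r -> f w = g w) -> Cdiffable f z -> Cdiffable g z.
Proof. intros Hr Hfg [l H]. exists l. now apply Cdiff_ext_loc with f r. Qed.

Lemma Ccont_ext_loc (f g : C -> C) (z : C) (r : R) :
  0 < r -> (forall w, Cmod (w - z) < r -> f w = g w) -> Ccont f z -> Ccont g z.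
Proof.
  intros Hr Hfg H eps Heps. destruct (H eps Heps) as [d [Hd Hf]].
  exists (Rmin d r). split; [now apply Rmin_glb_lt|]. intros w Hw.
  assert (Hw1 := Rlt_le_trans _ _ _ Hw (Rmin_l _ _)).
  assert (Hw2 := Rlt_le_trans _ _ _ Hw (Rmin_r _ _)).
  rewrite <- !Hfg; [now apply Hf| |exact Hw2]. now rewrite Cmod_minus_refl.
Qed.

Lemma Cdiff_const (c z : C) : Cdiff (fun _ => c) z 0.
Proof.
  intros eps Heps. exists 1. split; [lra|]. intros w _.
  replace (c - c - 0 * (w - z))%C with (RtoC 0) by ring. rewrite Cmod_0.
  apply Rmult_le_pos; [lra|apply Cmod_ge_0].
Qed.

Lemma Cdiff_id (z : C) : Cdiff (fun w => w) z 1.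
Proof.
  intros eps Heps. exists 1. split; [lra|]. intros w _.
  replace (w - z - 1 * (w - z))%C with (RtoC 0) by ring. rewrite Cmod_0.
  apply Rmult_le_pos; [lra|apply Cmod_ge_0].
Qed.

Lemma Cdiff_plus (f g : C -> C) (z l m : C) :
  Cdiff f z l -> Cdiff g z m -> Cdiff (fun w => f w + g w)%C z (l + m).
Proof.
  intros Hf Hg eps Heps.
  destruct (Hf (eps / 2)) as [d1 [Hd1 H1]]; [lra|].
  destruct (Hg (eps / 2)) as [d2 [Hd2 H2]]; [lra|].
  exists (Rmin d1 d2). split; [now apply Rmin_glb_lt|]. intros w Hw.
  assert (Hw1 := Rlt_le_trans _ _ _ Hw (Rmin_l _ _)).
  assert (Hw2 := Rlt_le_trans _ _ _ Hw (Rmin_r _ _)).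
  replace (f w + g w - (f z + g z) - (l + m) * (w - z))%C
    with ((f w - f z - l * (w - z)) + (g w - g z - m * (w - z)))%C by ring.
  eapply Rle_trans; [apply Cmod_triangle|].
  assert (A := H1 w Hw1). assert (B := H2 w Hw2). lra.
Qed.

Lemma Ccont_plus (f g : C -> C) (z : C) :
  Ccont f z -> Ccont g z -> Ccont (fun w => f w + g w)%C z.
Proof.
  intros Hf Hg eps Heps.
  destruct (Hf (eps / 2)) as [d1 [Hd1 H1]]; [lra|].
  destruct (Hg (eps / 2)) as [d2 [Hd2 H2]]; [lra|].
  exists (Rmin d1 d2). split; [now apply Rmin_glb_lt|]. intros w Hw.
  assert (A := H1 w (Rlt_le_trans _ _ _ Hw (Rmin_l _ _))).
  assert (B := H2 w (Rlt_le_trans _ _ _ Hw (Rmin_r _ _))).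
  replace (f w + g w - (f z + g z))%C with ((f w - f z) + (g w - g z))%C by ring.
  eapply Rle_lt_trans; [apply Cmod_triangle|]. lra.
Qed.

Lemma Ccont_bounded (f : C -> C) (z : C) :
  Ccont f z -> exists d, 0 < d /\ forall w, Cmod (w - z) < d -> Cmod (f w) <= Cmod (f z) + 1.
Proof.
  intros Hf. destruct (Hf 1) as [d [Hd H]]; [lra|]. exists d. split; [exact Hd|].
  intros w Hw. assert (A := H w Hw). assert (B := Cmod_minus_ge (f w) (f z)). lra.
Qed.

Lemma Ccont_mult (f g : C -> C) (z : C) :
  Ccont f z -> Ccont g z -> Ccont (fun w => f w * g w)%C z.
Proof.
  intros Hf Hg eps Heps.
  assert (Pf := Cmod_ge_0 (f z)). assert (Pg := Cmod_ge_0 (g z)).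
  destruct (Hf (eps / (2 * (Cmod (g z) + 1)))) as [d1 [Hd1 H1]];
    [apply Rdiv_lt_0_compat; lra|].
  destruct (Hg (eps / (2 * (Cmod (f z) + 1)))) as [d2 [Hd2 H2]];
    [apply Rdiv_lt_0_compat; lra|].
  destruct (Ccont_bounded g z Hg) as [d3 [Hd3 H3]].
  exists (Rmin d1 (Rmin d2 d3)). split; [repeat apply Rmin_glb_lt; assumption|].
  intros w Hw.
  assert (Hwr := Rlt_le_trans _ _ _ Hw (Rmin_r _ _)).
  assert (A := H1 w (Rlt_le_trans _ _ _ Hw (Rmin_l _ _))).
  assert (B := H2 w (Rlt_le_trans _ _ _ Hwr (Rmin_l _ _))).
  assert (D := H3 w (Rlt_le_trans _ _ _ Hwr (Rmin_r _ _))).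
  replace (f w * g w - f z * g z)%C with ((f w - f z) * g w + f z * (g w - g z))%C by ring.
  eapply Rle_lt_trans; [apply Cmod_triangle|]. rewrite !Cmod_mult.
  assert (E1 : Cmod (f w - f z) * Cmod (g w) <= eps / 2).
  { replace (eps / 2) with (eps / (2 * (Cmod (g z) + 1)) * (Cmod (g z) + 1)) by (field; lra).
    apply Rmult_le_compat; try apply Cmod_ge_0; lra. }
  assert (E2 : Cmod (f z) * Cmod (g w - g z) < eps / 2).
  { apply Rle_lt_trans with (Cmod (f z) * (eps / (2 * (Cmod (f z) + 1)))).
    - apply Rmult_le_compat_l; lra.
    - apply Rlt_le_trans with ((Cmod (f z) + 1) * (eps / (2 * (Cmod (f z) + 1)))).
      + apply Rmult_lt_compat_r; [apply Rdiv_lt_0_compat; lra|lra].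
      + right. field. lra. }
  lra.
Qed.

Lemma Cdiff_mult (f g : C -> C) (z l m : C) :
  Cdiff f z l -> Cdiff g z m -> Cdiff (fun w => f w * g w)%C z (l * g z + f z * m).
Proof.
  intros Hf Hg eps Heps.
  assert (Pf := Cmod_ge_0 (f z)). assert (Pg := Cmod_ge_0 (g z)). assert (Pl := Cmod_ge_0 l).
  destruct (Hf (eps / (3 * (Cmod (g z) + 1)))) as [d1 [Hd1 H1]];
    [apply Rdiv_lt_0_compat; lra|].
  destruct (Hg (eps / (3 * (Cmod (f z) + 1)))) as [d2 [Hd2 H2]];
    [apply Rdiv_lt_0_compat; lra|].
  destruct (Ccont_bounded g z (Cdiff_Ccont _ _ _ Hg)) as [d3 [Hd3 H3]].
  destruct (Cdiff_Ccont _ _ _ Hg (eps / (3 * (Cmod l + 1)))) as [d4 [Hd4 H4]];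
    [apply Rdiv_lt_0_compat; lra|].
  exists (Rmin (Rmin d1 d2) (Rmin d3 d4)). split; [repeat apply Rmin_glb_lt; assumption|].
  intros w Hw.
  assert (Hwl := Rlt_le_trans _ _ _ Hw (Rmin_l _ _)).
  assert (Hwr := Rlt_le_trans _ _ _ Hw (Rmin_r _ _)).
  assert (A1 := H1 w (Rlt_le_trans _ _ _ Hwl (Rmin_l _ _))).
  assert (A2 := H2 w (Rlt_le_trans _ _ _ Hwl (Rmin_r _ _))).
  assert (A3 := H3 w (Rlt_le_trans _ _ _ Hwr (Rmin_l _ _))).
  assert (A4 := H4 w (Rlt_le_trans _ _ _ Hwr (Rmin_r _ _))).
  clear Hf Hg H1 H2 H3 H4 Hw Hwl Hwr.
  replace (f w * g w - f z * g z - (l * g z + f z * m) * (w - z))%C with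
    ((f w - f z - l * (w - z)) * g w + l * (g w - g z) * (w - z)
      + f z * (g w - g z - m * (w - z)))%C by ring.
  assert (Pd := Cmod_ge_0 (w - z)).
  eapply Rle_trans; [apply Cmod_triangle|].
  eapply Rle_trans; [apply Rplus_le_compat_r, Cmod_triangle|]. rewrite !Cmod_mult.
  set (D := Cmod (w - z)) in *.
  assert (E1 : Cmod (f w - f z - l * (w - z)) * Cmod (g w) <= eps / 3 * D).
  { replace (eps / 3 * D) with (eps / (3 * (Cmod (g z) + 1)) * D * (Cmod (g z) + 1))
      by (field; lra).
    apply Rmult_le_compat; try apply Cmod_ge_0; lra. }
  assert (E2 : Cmod l * Cmod (g w - g z) * D <= eps / 3 * D).
  { apply Rmult_le_compat_r; [exact Pd|].
    replace (eps / 3) with ((Cmod l + 1) * (eps / (3 * (Cmod l + 1)))) by (field; lra).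
    apply Rmult_le_compat; try apply Cmod_ge_0; lra. }
  assert (E3 : Cmod (f z) * Cmod (g w - g z - m * (w - z)) <= eps / 3 * D).
  { replace (eps / 3 * D) with ((Cmod (f z) + 1) * (eps / (3 * (Cmod (f z) + 1)) * D))
      by (field; lra).
    apply Rmult_le_compat; try apply Cmod_ge_0; lra. }
  lra.
Qed.

Lemma Cdiff_comp (f g : C -> C) (z l m : C) :
  Cdiff f z l -> Cdiff g (f z) m -> Cdiff (fun w => g (f w)) z (m * l).
Proof.
  intros Hf Hg eps Heps.
  assert (Pl := Cmod_ge_0 l). assert (Pm := Cmod_ge_0 m).
  set (e1 := eps / (2 * (Cmod l + 1))).
  assert (He1 : 0 < e1) by (apply Rdiv_lt_0_compat; lra).
  set (e2 := Rmin 1 (eps / (2 * (Cmod m + 1)))).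
  assert (He2 : 0 < e2) by (apply Rmin_glb_lt; [lra|apply Rdiv_lt_0_compat; lra]).
  destruct (Hg e1 He1) as [d1 [Hd1 H1]].
  destruct (Hf e2 He2) as [d2 [Hd2 H2]].
  destruct (Cdiff_Ccont _ _ _ Hf d1 Hd1) as [d3 [Hd3 H3]].
  exists (Rmin d2 d3). split; [repeat apply Rmin_glb_lt; assumption|]. intros w Hw.
  assert (A2 := H2 w (Rlt_le_trans _ _ _ Hw (Rmin_l _ _))).
  assert (A3 := H3 w (Rlt_le_trans _ _ _ Hw (Rmin_r _ _))).
  assert (A1 := H1 (f w) A3).
  replace (g (f w) - g (f z) - m * l * (w - z))%C with
    ((g (f w) - g (f z) - m * (f w - f z)) + m * (f w - f z - l * (w - z)))%C by ring.
  eapply Rle_trans; [apply Cmod_triangle|]. rewrite Cmod_mult.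
  assert (Pd := Cmod_ge_0 (w - z)). set (D := Cmod (w - z)) in *.
  assert (Efw : Cmod (f w - f z) <= (Cmod l + 1) * D).
  { replace (f w - f z)%C with ((f w - f z - l * (w - z)) + l * (w - z))%C by ring.
    eapply Rle_trans; [apply Cmod_triangle|]. rewrite Cmod_mult. fold D.
    assert (e2 * D <= 1 * D) by (apply Rmult_le_compat_r; [exact Pd|apply Rmin_l]). lra. }
  assert (E1 : e1 * Cmod (f w - f z) <= eps / 2 * D).
  { replace (eps / 2 * D) with (e1 * ((Cmod l + 1) * D)) by (unfold e1; field; lra).
    apply Rmult_le_compat_l; lra. }
  assert (E2 : Cmod m * Cmod (f w - f z - l * (w - z)) <= eps / 2 * D).
  { replace (eps / 2 * D) with ((Cmod m + 1) * (eps / (2 * (Cmod m + 1)) * D))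
      by (field; lra).
    apply Rmult_le_compat; try apply Cmod_ge_0; [lra|].
    eapply Rle_trans; [exact A2|]. apply Rmult_le_compat_r; [exact Pd|apply Rmin_r]. }
  lra.
Qed.

Lemma Cdiff_inv (z : C) : z <> 0 -> Cdiff (fun w => / w)%C z (- / (z * z)).
Proof.
  intros Hz eps Heps.
  assert (Pz : 0 < Cmod z) by now apply Cmod_gt_0.
  set (k := eps * (Cmod z * Cmod z * Cmod z) / 2).
  assert (Hk : 0 < k).
  { unfold k. apply Rdiv_lt_0_compat; [|lra]. repeat apply Rmult_lt_0_compat; assumption. }
  exists (Rmin (Cmod z / 2) k). split; [apply Rmin_glb_lt; [lra|exact Hk]|]. intros w Hw.
  assert (Hw1 := Rlt_le_trans _ _ _ Hw (Rmin_l _ _)).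
  assert (Hw2 := Rlt_le_trans _ _ _ Hw (Rmin_r _ _)).
  assert (Pw : Cmod z / 2 <= Cmod w).
  { assert (A := Cmod_minus_ge z w). rewrite Cmod_minus_sym in A. lra. }
  assert (Hw0 : w <> 0) by (apply Cmod_gt_0; lra).
  replace (/ w - / z - - / (z * z) * (w - z))%C with ((w - z) * / (w * z * z) * (w - z))%C
    by (field; auto).
  rewrite !Cmod_mult, Cmod_inv by (repeat apply Cmult_neq_0; assumption).
  rewrite !Cmod_mult.
  apply Rmult_le_compat_r; [apply Cmod_ge_0|].
  apply Rmult_le_reg_r with (Cmod w * Cmod z * Cmod z);
    [repeat apply Rmult_lt_0_compat; lra|].
  rewrite Rmult_assoc, Rinv_l, Rmult_1_r
    by (apply Rgt_not_eq; repeat apply Rmult_lt_0_compat; lra).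
  apply Rle_trans with k; [lra|].
  unfold k. replace (eps * (Cmod z * Cmod z * Cmod z) / 2)
    with (eps * ((Cmod z / 2) * Cmod z * Cmod z)) by field.
  apply Rmult_le_compat_l; [lra|]. apply Rmult_le_compat_r; [lra|].
  apply Rmult_le_compat_r; lra.
Qed.

Lemma Ccont_comp (f g : C -> C) (z : C) :
  Ccont f z -> Ccont g (f z) -> Ccont (fun w => g (f w)) z.
Proof.
  intros Hf Hg eps Heps. destruct (Hg eps Heps) as [d [Hd H]].
  destruct (Hf d Hd) as [d' [Hd' H']]. exists d'. split; [exact Hd'|].
  intros w Hw. apply H, H', Hw.
Qed.

Lemma Cdiffable_const (c z : C) : Cdiffable (fun _ => c) z.
Proof. exists (RtoC 0). apply Cdiff_const. Qed.
Lemma Cdiffable_id (z : C) : Cdiffable (fun w => w) z.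
Proof. exists (RtoC 1). apply Cdiff_id. Qed.
Lemma Cdiffable_plus (f g : C -> C) (z : C) :
  Cdiffable f z -> Cdiffable g z -> Cdiffable (fun w => f w + g w)%C z.
Proof. intros [l Hl] [m Hm]. eexists. apply Cdiff_plus; eassumption. Qed.
Lemma Cdiffable_mult (f g : C -> C) (z : C) :
  Cdiffable f z -> Cdiffable g z -> Cdiffable (fun w => f w * g w)%C z.
Proof. intros [l Hl] [m Hm]. eexists. apply Cdiff_mult; eassumption. Qed.
Lemma Cdiffable_comp (f g : C -> C) (z : C) :
  Cdiffable f z -> Cdiffable g (f z) -> Cdiffable (fun w => g (f w)) z.
Proof. intros [l Hl] [m Hm]. eexists. apply Cdiff_comp; eassumption. Qed.
Lemma Cdiffable_inv (f : C -> C) (z : C) :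
  Cdiffable f z -> f z <> 0 -> Cdiffable (fun w => / f w)%C z.
Proof.
  intros [l Hl] H0. eexists. apply (Cdiff_comp f (fun w => / w)%C); [exact Hl|].
  now apply Cdiff_inv.
Qed.
Lemma Cdiffable_minus_const (f : C -> C) (z c : C) :
  Cdiffable f z -> Cdiffable (fun w => f w - c)%C z.
Proof. intros H. apply (Cdiffable_plus f (fun _ => - c)%C); [exact H|apply Cdiffable_const]. Qed.
Lemma Cdiffable_pow (n : nat) (z : C) : Cdiffable (fun w => w ^ n)%C z.
Proof.
  induction n as [|n IH]; [exact (Cdiffable_const 1 z)|].
  apply (Cdiffable_mult (fun w => w) (fun w => w ^ n)%C); [apply Cdiffable_id|exact IH].
Qed.

Lemma Ccont_const (c z : C) : Ccont (fun _ => c) z.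
Proof. apply Cdiffable_Ccont, Cdiffable_const. Qed.
Lemma Ccont_id (z : C) : Ccont (fun w => w) z.
Proof. apply Cdiffable_Ccont, Cdiffable_id. Qed.
Lemma Ccont_inv (f : C -> C) (z : C) :
  Ccont f z -> f z <> 0 -> Ccont (fun w => / f w)%C z.
Proof.
  intros H H0. apply (Ccont_comp f (fun w => / w)%C); [exact H|].
  apply Cdiffable_Ccont. eexists. now apply Cdiff_inv.
Qed.
Lemma Ccont_minus_const (f : C -> C) (z c : C) :
  Ccont f z -> Ccont (fun w => f w - c)%C z.
Proof. intros H. apply (Ccont_plus f (fun _ => - c)%C); [exact H|apply Ccont_const]. Qed.

(** * Integrals of complex-valued functions *)

(** [RInt] is a total function, so integrability is carried separately by [CexI]. *)
Definition CI (f : R -> C) (a b : R) : C :=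
  (RInt (fun t => Re (f t)) a b, RInt (fun t => Im (f t)) a b).

Definition CexI (f : R -> C) (a b : R) : Prop :=
  ex_RInt (fun t => Re (f t)) a b /\ ex_RInt (fun t => Im (f t)) a b.

Definition RCcont (f : R -> C) (t : R) : Prop :=
  forall eps, 0 < eps -> exists d, 0 < d /\
    forall s, Rabs (s - t) < d -> Cmod (f s - f t) < eps.

Lemma RCcont_components (f : R -> C) (t : R) :
  RCcont f t -> continuous (fun s => Re (f s)) t /\ continuous (fun s => Im (f s)) t.
Proof.
  intros H. split; apply continuity_pt_filterlim; intros eps Heps;
    destruct (H eps Heps) as [d [Hd Hf]]; exists d; split; try exact Hd;
    intros s [_ Hs]; simpl; unfold R_dist in *;
    (eapply Rle_lt_trans; [|apply (Hf s Hs)]).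
  - apply (Rabs_Re_le (f s - f t)).
  - apply (Rabs_Im_le (f s - f t)).
Qed.

Lemma CexI_cont (f : R -> C) (a b : R) :
  a <= b -> (forall t, a <= t <= b -> RCcont f t) -> CexI f a b.
Proof.
  intros Hab H.
  split; apply (ex_RInt_continuous (V := R_CompleteNormedModule)); intros t Ht;
    rewrite Rmin_left, Rmax_right in Ht by exact Hab; now apply RCcont_components, H.
Qed.

Lemma CI_ext (f g : R -> C) (a b : R) :
  a <= b -> (forall t, a <= t <= b -> f t = g t) -> CI f a b = CI g a b.
Proof.
  intros Hab H. unfold CI.
  f_equal; apply RInt_ext; intros t Ht; rewrite Rmin_left, Rmax_right in Ht by exact Hab;
    rewrite H; auto; lra.
Qed.

Lemma CI_plus (f g : R -> C) (a b : R) :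
  CexI f a b -> CexI g a b -> CI (fun t => f t + g t)%C a b = (CI f a b + CI g a b)%C.
Proof.
  intros [F1 F2] [G1 G2]. unfold CI, Cplus. simpl.
  f_equal.
  - exact (RInt_plus (V := R_CompleteNormedModule) _ _ a b F1 G1).
  - exact (RInt_plus (V := R_CompleteNormedModule) _ _ a b F2 G2).
Qed.

Lemma CexI_plus (f g : R -> C) (a b : R) :
  CexI f a b -> CexI g a b -> CexI (fun t => f t + g t)%C a b.
Proof.
  intros [F1 F2] [G1 G2].
  split; [exact (ex_RInt_plus (V := R_NormedModule) _ _ a b F1 G1)
         |exact (ex_RInt_plus (V := R_NormedModule) _ _ a b F2 G2)].
Qed.

Lemma CexI_scal (c : C) (f : R -> C) (a b : R) :
  CexI f a b -> CexI (fun t => c * f t)%C a b.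
Proof.
  intros [F1 F2]. split.
  - apply (ex_RInt_minus (V := R_NormedModule) (fun t => Re c * Re (f t)) (fun t => Im c * Im (f t))).
    + now apply (ex_RInt_scal (V := R_NormedModule) (fun t => Re (f t)) a b (Re c)).
    + now apply (ex_RInt_scal (V := R_NormedModule) (fun t => Im (f t)) a b (Im c)).
  - apply (ex_RInt_plus (V := R_NormedModule) (fun t => Re c * Im (f t)) (fun t => Im c * Re (f t))).
    + now apply (ex_RInt_scal (V := R_NormedModule) (fun t => Im (f t)) a b (Re c)).
    + now apply (ex_RInt_scal (V := R_NormedModule) (fun t => Re (f t)) a b (Im c)).
Qed.

Lemma CI_scal (c : C) (f : R -> C) (a b : R) :
  CexI f a b -> CI (fun t => c * f t)%C a b = (c * CI f a b)%C.
Proof.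
  intros [F1 F2]. unfold CI, Cmult. simpl.
  assert (S : forall k (u : R -> R), ex_RInt u a b -> RInt (fun t => k * u t) a b = k * RInt u a b)
    by (intros k u Hu; exact (RInt_scal (V := R_CompleteNormedModule) u a b k Hu)).
  assert (X : forall k (u : R -> R), ex_RInt u a b -> ex_RInt (fun t => k * u t) a b)
    by (intros k u Hu; exact (ex_RInt_scal (V := R_NormedModule) u a b k Hu)).
  f_equal.
  - etransitivity; [apply (RInt_minus (V := R_CompleteNormedModule)
      (fun t => Re c * Re (f t)) (fun t => Im c * Im (f t))); now apply X|].
    rewrite !S by assumption. reflexivity.
  - etransitivity; [apply (RInt_plus (V := R_CompleteNormedModule)
      (fun t => Re c * Im (f t)) (fun t => Im c * Re (f t))); now apply X|].
    rewrite !S by assumption. reflexivity.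
Qed.

Lemma CexI_minus (f g : R -> C) (a b : R) :
  CexI f a b -> CexI g a b -> CexI (fun t => f t - g t)%C a b.
Proof.
  intros [F1 F2] [G1 G2].
  split; [exact (ex_RInt_minus (V := R_NormedModule) _ _ a b F1 G1)
         |exact (ex_RInt_minus (V := R_NormedModule) _ _ a b F2 G2)].
Qed.

Lemma CI_minus (f g : R -> C) (a b : R) :
  CexI f a b -> CexI g a b -> CI (fun t => f t - g t)%C a b = (CI f a b - CI g a b)%C.
Proof.
  intros [F1 F2] [G1 G2]. unfold CI, Cminus, Cplus, Copp. simpl.
  f_equal.
  - exact (RInt_minus (V := R_CompleteNormedModule) _ _ a b F1 G1).
  - exact (RInt_minus (V := R_CompleteNormedModule) _ _ a b F2 G2).
Qed.

Lemma CI_const (c : C) (a b : R) : CI (fun _ => c) a b = (RtoC (b - a) * c)%C.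
Proof.
  unfold CI. rewrite !(RInt_const (V := R_CompleteNormedModule)).
  destruct c as [x y]. unfold Cmult, RtoC. simpl. unfold scal; simpl; unfold mult; simpl.
  f_equal; ring.
Qed.

Lemma CexI_const (c : C) (a b : R) : CexI (fun _ => c) a b.
Proof. split; apply (ex_RInt_const (V := R_NormedModule)). Qed.

Lemma CI_Chasles (f : R -> C) (a b c : R) :
  CexI f a b -> CexI f b c -> CI f a c = (CI f a b + CI f b c)%C.
Proof.
  intros [F1 F2] [G1 G2]. unfold CI, Cplus. simpl. f_equal; symmetry.
  - exact (RInt_Chasles (V := R_CompleteNormedModule) _ a b c F1 G1).
  - exact (RInt_Chasles (V := R_CompleteNormedModule) _ a b c F2 G2).
Qed.

(** The factor 2 comes from bounding the real and imaginary parts separately; it is harmless, since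
    every later estimate tolerates a constant. *)
Lemma CI_bound (f : R -> C) (a b M : R) :
  a <= b -> CexI f a b -> (forall t, a <= t <= b -> Cmod (f t) <= M) ->
  Cmod (CI f a b) <= 2 * (b - a) * M.
Proof.
  intros Hab [F1 F2] H.
  eapply Rle_trans; [apply Cmod_le_abs|]. simpl.
  assert (A1 := abs_RInt_le_const _ a b M Hab F1
    (fun t Ht => Rle_trans _ _ _ (Rabs_Re_le (f t)) (H t Ht))).
  assert (A2 := abs_RInt_le_const _ a b M Hab F2
    (fun t Ht => Rle_trans _ _ _ (Rabs_Im_le (f t)) (H t Ht))).
  lra.
Qed.

(** * Goursat's theorem on rectangles *)

(** Complex differentiability in the variable x + i t. The pair of increments is itself the complex
    increment, and the error is measured by the sum of their absolute values. The curried form suits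
    integration along horizontal and vertical sides. *)
Definition Gdiff (g : R -> R -> C) (x t : R) : Prop :=
  exists l : C, forall eps, 0 < eps -> exists d, 0 < d /\
    forall x' t', Rabs (x' - x) < d -> Rabs (t' - t) < d ->
      Cmod (g x' t' - g x t - l * ((x' - x)%R, (t' - t)%R)) <= eps * (Rabs (x' - x) + Rabs (t' - t)).

(* The integral of [g (x + i t)] along the boundary of a rectangle of width [h] and height [k]. *)
Definition rect_integral (g : R -> R -> C) (x t h k : R) : C :=
  (CI (fun u => g u t - g u (t + k)%R) x (x + h)
   + Ci * CI (fun v => g (x + h)%R v - g x v) t (t + k))%C.

(** [t] is unrestricted because it will be an angle, while [x] will be the logarithm of a radius. *)
Definition strip_diff (a b : R) (g : R -> R -> C) : Prop :=
  forall x t, a < x < b -> Gdiff g x t.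

Lemma Gdiff_RCcont (g : R -> R -> C) (x t : R) :
  Gdiff g x t -> RCcont (fun u => g u t) x /\ RCcont (fun v => g x v) t.
Proof.
  intros [l H].
  assert (Pl := Cmod_ge_0 l).
  assert (K : forall eps, 0 < eps -> exists d, 0 < d /\
    forall x' t', Rabs (x' - x) < d -> Rabs (t' - t) < d -> Cmod (g x' t' - g x t) < eps).
  { intros eps Heps. destruct (H 1) as [d [Hd Hg]]; [lra|].
    set (e := eps / (4 * (Cmod l + 1))).
    assert (He : 0 < e) by (apply Rdiv_lt_0_compat; lra).
    exists (Rmin d e). split; [now apply Rmin_glb_lt|]. intros x' t' Hx Ht.
    assert (A := Hg x' t' (Rlt_le_trans _ _ _ Hx (Rmin_l _ _)) (Rlt_le_trans _ _ _ Ht (Rmin_l _ _))).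
    assert (Hx2 := Rlt_le_trans _ _ _ Hx (Rmin_r _ _)).
    assert (Ht2 := Rlt_le_trans _ _ _ Ht (Rmin_r _ _)).
    replace (g x' t' - g x t)%C with
      ((g x' t' - g x t - l * ((x' - x)%R, (t' - t)%R)) + l * ((x' - x)%R, (t' - t)%R))%C by ring.
    eapply Rle_lt_trans; [apply Cmod_triangle|]. rewrite Cmod_mult.
    assert (B := Cmod_le_abs ((x' - x)%R, (t' - t)%R)). simpl in B.
    assert (D : Cmod l * Cmod ((x' - x)%R, (t' - t)%R) <= Cmod l * (Rabs (x' - x) + Rabs (t' - t)))
      by (apply Rmult_le_compat_l; lra).
    assert (E : (Cmod l + 1) * (Rabs (x' - x) + Rabs (t' - t)) <= (Cmod l + 1) * (2 * e))
      by (apply Rmult_le_compat_l; lra).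
    replace ((Cmod l + 1) * (2 * e)) with (eps / 2) in E by (unfold e; field; lra). lra. }
  split; intros eps Heps; destruct (K eps Heps) as [d [Hd Hg]]; exists d;
    (split; [exact Hd|]); intros s Hs; apply Hg; try exact Hs;
    rewrite Rminus_diag, Rabs_R0; exact Hd.
Qed.

Section Goursat.

Variables (a b : R) (g : R -> R -> C).
Hypothesis Hg : strip_diff a b g.

Lemma strip_CexI_horizontal (x h t : R) : 0 <= h -> a < x -> x + h < b -> CexI (fun u => g u t) x (x + h).
Proof. intros Hh Hx Hxh. apply CexI_cont; [lra|]. intros u Hu. apply Gdiff_RCcont, Hg. lra. Qed.

Lemma strip_CexI_vertical (x t k : R) : 0 <= k -> a < x < b -> CexI (fun v => g x v) t (t + k).
Proof. intros Hk Hx. apply CexI_cont; [lra|]. intros u Hu. apply Gdiff_RCcont, Hg. lra. Qed.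

Lemma rect_integral_split (x t h k : R) :
  0 <= h -> 0 <= k -> a < x -> x + 2 * h < b ->
  rect_integral g x t (2 * h) (2 * k) =
  (rect_integral g x t h k + rect_integral g (x + h) t h k
   + rect_integral g x (t + k) h k + rect_integral g (x + h) (t + k) h k)%C.
Proof.
  intros Hh Hk Hx Hxh. unfold rect_integral.
  replace (x + h + h) with (x + 2 * h) by ring.
  replace (t + k + k) with (t + 2 * k) by ring.
  assert (A1 : forall s, CexI (fun u => g u s) x (x + h)) by (intros; apply strip_CexI_horizontal; lra).
  assert (A2 : forall s, CexI (fun u => g u s) (x + h) (x + 2 * h))
    by (intros; replace (x + 2 * h) with (x + h + h) by ring; apply strip_CexI_horizontal; lra).
  assert (B1 : forall y, a < y < b -> CexI (fun v => g y v) t (t + k))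
    by (intros; apply strip_CexI_vertical; lra).
  assert (B2 : forall y, a < y < b -> CexI (fun v => g y v) (t + k) (t + 2 * k))
    by (intros; replace (t + 2 * k) with (t + k + k) by ring; apply strip_CexI_vertical; lra).
  rewrite (CI_Chasles _ x (x + h) (x + 2 * h)) by (apply CexI_minus; auto).
  rewrite (CI_Chasles _ t (t + k) (t + 2 * k)) by (apply CexI_minus; auto with real; (apply B1 || apply B2); lra).
  rewrite !CI_minus by (auto; (apply B1 || apply B2); lra).
  ring.
Qed.

Lemma rect_integral_quarter (x t h k : R) :
  0 <= h -> 0 <= k -> a < x -> x + 2 * h < b ->
  exists x' t', (x' = x \/ x' = x + h) /\ (t' = t \/ t' = t + k) /\
    Cmod (rect_integral g x t (2 * h) (2 * k)) / 4 <= Cmod (rect_integral g x' t' h k).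
Proof.
  intros Hh Hk Hx Hxh.
  assert (E := rect_integral_split x t h k Hh Hk Hx Hxh).
  set (J1 := rect_integral g x t h k) in *.
  set (J2 := rect_integral g (x + h) t h k) in *.
  set (J3 := rect_integral g x (t + k) h k) in *.
  set (J4 := rect_integral g (x + h) (t + k) h k) in *.
  set (m := Cmod (rect_integral g x t (2 * h) (2 * k)) / 4).
  assert (Hm : 4 * m <= Cmod J1 + Cmod J2 + Cmod J3 + Cmod J4).
  { unfold m. rewrite E.
    assert (T1 := Cmod_triangle (J1 + J2 + J3) J4).
    assert (T2 := Cmod_triangle (J1 + J2) J3).
    assert (T3 := Cmod_triangle J1 J2). lra. }
  destruct (Rle_dec m (Cmod J1)) as [H1|H1]; [exists x, t; auto|].
  destruct (Rle_dec m (Cmod J2)) as [H2|H2]; [exists (x + h), t; auto|].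
  destruct (Rle_dec m (Cmod J3)) as [H3|H3]; [exists x, (t + k); auto|].
  exists (x + h), (t + k). fold J4. repeat split; auto. lra.
Qed.

(** The affine part of [g] contributes nothing to the boundary integral. The remainder is at most
    [eps * (h + k)] on each side; pairing opposite sides and applying [CI_bound] produces the factor
    4. *)
Lemma rect_integral_small (x t h k cx ct eps : R) (l : C) :
  0 <= h -> 0 <= k -> 0 <= eps -> a < x -> x + h < b ->
  x <= cx <= x + h -> t <= ct <= t + k ->
  (forall x' t', x <= x' <= x + h -> t <= t' <= t + k ->
     Cmod (g x' t' - g cx ct - l * ((x' - cx)%R, (t' - ct)%R)) <= eps * (Rabs (x' - cx) + Rabs (t' - ct))) ->
  Cmod (rect_integral g x t h k) <= 4 * eps * (h + k) * (h + k).
Proof.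
  intros Hh Hk He Hx Hxh Hcx Hct H.
  set (A := fun x' t' => (g cx ct + l * ((x' - cx)%R, (t' - ct)%R))%C).
  set (e := fun x' t' => (g x' t' - A x' t')%C).
  assert (He' : forall x' t', x <= x' <= x + h -> t <= t' <= t + k ->
     Cmod (e x' t') <= eps * (h + k)).
  { intros x' t' Hx' Ht'. unfold e, A.
    replace (g x' t' - (g cx ct + l * ((x' - cx)%R, (t' - ct)%R)))%C with
      (g x' t' - g cx ct - l * ((x' - cx)%R, (t' - ct)%R))%C by ring.
    eapply Rle_trans; [now apply H|]. apply Rmult_le_compat_l; [exact He|].
    apply Rplus_le_compat; apply Rabs_le; lra. }
  (* The affine part changes by [- c1] from the top side to the bottom one and by [c2] from the left
     side to the right one. Its total contribution [- h * c1 + Ci * (k * c2)] is zero. *)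
  set (c1 := (l * (0, k))%C). set (c2 := (l * (h, 0))%C).
  assert (X1 : CexI (fun u => g u t - g u (t + k)%R)%C x (x + h))
    by (apply CexI_minus; apply strip_CexI_horizontal; lra).
  assert (X2 : CexI (fun v => g (x + h)%R v - g x v)%C t (t + k))
    by (apply CexI_minus; apply strip_CexI_vertical; lra).
  assert (E1 : (CI (fun u => g u t - g u (t + k)%R)%C x (x + h)
     = CI (fun u => (g u t - g u (t + k)%R) + c1)%C x (x + h) - RtoC h * c1)%C).
  { rewrite CI_plus; [|exact X1|apply CexI_const]. rewrite CI_const.
    replace (x + h - x) with h by ring. ring. }
  assert (E2 : (CI (fun v => g (x + h)%R v - g x v)%C t (t + k)
     = CI (fun v => (g (x + h)%R v - g x v) - c2)%C t (t + k) + RtoC k * c2)%C).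
  { rewrite (CI_minus (fun v => g (x + h)%R v - g x v)%C (fun _ => c2)); [|exact X2|apply CexI_const]. rewrite CI_const.
    replace (t + k - t) with k by ring. ring. }
  unfold rect_integral. rewrite E1, E2.
  set (I1 := CI (fun u => (g u t - g u (t + k)%R) + c1)%C x (x + h)).
  set (I2 := CI (fun v => (g (x + h)%R v - g x v) - c2)%C t (t + k)).
  replace (I1 - h * c1 + Ci * (I2 + k * c2))%C with (I1 + Ci * I2)%C.
  2:{ assert (Ec : (Ci * (k * c2) = h * c1)%C).
      { unfold c1, c2, Ci, RtoC, Cmult. simpl. f_equal; ring. }
      replace (I1 - h * c1 + Ci * (I2 + k * c2))%C with (I1 + Ci * I2 + (Ci * (k * c2) - h * c1))%C by ring.
      rewrite Ec. ring. }
  eapply Rle_trans; [apply Cmod_triangle|]. rewrite Cmod_mult, Cmod_Ci, Rmult_1_l.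
  assert (B1 : Cmod I1 <= 2 * (x + h - x) * (2 * (eps * (h + k)))).
  { apply CI_bound; [lra|apply CexI_plus; [exact X1|apply CexI_const]|].
    intros u Hu.
    replace (g u t - g u (t + k)%R + c1)%C with (e u t - e u (t + k)%R)%C.
    - eapply Rle_trans; [apply Cmod_triangle|]. rewrite Cmod_opp.
      assert (P1 := He' u t Hu). assert (P2 := He' u (t + k) Hu).
      assert (Cmod (e u t) <= eps * (h + k)) by (apply P1; lra).
      assert (Cmod (e u (t + k)%R) <= eps * (h + k)) by (apply P2; lra). lra.
    - unfold e, A, c1.
      replace (0, k)%R with (((u - cx)%R, (t + k - ct)%R) - ((u - cx)%R, (t - ct)%R))%C
        by (unfold Cminus, Cplus, Copp; simpl; f_equal; ring).
      ring. }
  assert (B2 : Cmod I2 <= 2 * (t + k - t) * (2 * (eps * (h + k)))).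
  { apply CI_bound; [lra|apply CexI_minus; [exact X2|apply CexI_const]|].
    intros v Hv.
    replace (g (x + h)%R v - g x v - c2)%C with (e (x + h)%R v - e x v)%C.
    - eapply Rle_trans; [apply Cmod_triangle|]. rewrite Cmod_opp.
      assert (P1 := He' (x + h) v). assert (P2 := He' x v).
      assert (Cmod (e (x + h)%R v) <= eps * (h + k)) by (apply P1; lra).
      assert (Cmod (e x v) <= eps * (h + k)) by (apply P2; lra). lra.
    - unfold e, A, c2.
      replace (h, 0)%R with (((x + h - cx)%R, (v - ct)%R) - ((x - cx)%R, (v - ct)%R))%C
        by (unfold Cminus, Cplus, Copp; simpl; f_equal; ring).
      ring. }
  lra.
Qed.

(** Repeated quartering yields nested rectangles whose integrals are at least [eta / 4 ^ n], while
    differentiability at their common point [(cx, ct)] makes these integrals small compared with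
    [4 ^ - n]. *)
Lemma Goursat (x t h k : R) :
  0 < h -> 0 < k -> a < x -> x + h < b -> rect_integral g x t h k = 0.
Proof.
  intros Hh Hk Hx Hxh.
  destruct (classic (rect_integral g x t h k = 0)) as [H0|H0]; [exact H0|exfalso].
  set (eta := Cmod (rect_integral g x t h k)).
  assert (Heta : 0 < eta) by now apply Cmod_gt_0.
  set (P := fun (n : nat) (p : R * R) =>
    x <= fst p /\ fst p + h / 2 ^ n <= x + h /\ t <= snd p /\ snd p + k / 2 ^ n <= t + k /\
    eta / 4 ^ n <= Cmod (rect_integral g (fst p) (snd p) (h / 2 ^ n) (k / 2 ^ n))).
  assert (P2 : forall n, 0 < 2 ^ n) by (intros; apply pow_lt; lra).
  assert (P4 : forall n, 0 < 4 ^ n) by (intros; apply pow_lt; lra).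
  assert (Hstep : forall n p, P n p -> exists p', P (S n) p' /\
     fst p <= fst p' <= fst p + h / 2 ^ S n /\ snd p <= snd p' <= snd p + k / 2 ^ S n).
  { intros n [px pt] [Q1 [Q2 [Q3 [Q4 Q5]]]]. simpl fst in *. simpl snd in *.
    assert (Hn := P2 n).
    assert (Eh : h / 2 ^ n = 2 * (h / 2 ^ S n)) by (simpl; field; lra).
    assert (Ek : k / 2 ^ n = 2 * (k / 2 ^ S n)) by (simpl; field; lra).
    assert (Ph : 0 < h / 2 ^ S n) by (apply Rdiv_lt_0_compat; auto).
    assert (Pk : 0 < k / 2 ^ S n) by (apply Rdiv_lt_0_compat; auto).
    rewrite Eh, Ek in Q5. rewrite Eh in Q2. rewrite Ek in Q4.
    destruct (rect_integral_quarter px pt (h / 2 ^ S n) (k / 2 ^ S n)) as [x' [t' [Hx' [Ht' HJ]]]];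
      try lra.
    assert (E4 : eta / 4 ^ S n = eta / 4 ^ n / 4)
      by (simpl; field; apply Rgt_not_eq, P4).
    exists (x', t'). unfold P. simpl fst. simpl snd.
    destruct Hx', Ht'; subst x' t'; repeat split; lra. }
  destruct (constructive_indefinite_description (fun s : nat -> R * R =>
     s 0%nat = (x, t) /\ forall n, P n (s n) /\
       fst (s n) <= fst (s (S n)) <= fst (s n) + h / 2 ^ S n /\
       snd (s n) <= snd (s (S n)) <= snd (s n) + k / 2 ^ S n)) as [s [Hs0 Hs]].
  (* [Hstep] gives mere existence, so the sequence of corners is built with the choice operator. *)
  { set (next := fun n p => epsilon (inhabits (0, 0)) (fun p' => P (S n) p' /\
       fst p <= fst p' <= fst p + h / 2 ^ S n /\ snd p <= snd p' <= snd p + k / 2 ^ S n)).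
    set (s := fix s n := match n with O => (x, t) | S m => next m (s m) end).
    assert (HP : forall n, P n (s n)).
    { induction n as [|n IH].
      - unfold P. simpl. unfold Rdiv. rewrite Rinv_1, !Rmult_1_r. repeat split; try lra.
        unfold eta. lra.
      - simpl. apply (epsilon_spec (inhabits (0, 0)) _ (Hstep n (s n) IH)). }
    exists s. split; [reflexivity|]. intros n. split; [apply HP|].
    apply (epsilon_spec (inhabits (0, 0)) _ (Hstep n (s n) (HP n))). }
  assert (Hmono : forall n m, fst (s n) <= fst (s (n + m)%nat) <= fst (s n) + h / 2 ^ n /\
     snd (s n) <= snd (s (n + m)%nat) <= snd (s n) + k / 2 ^ n).
  (* Strengthened for the induction: the subtracted terms say that the whole smaller rectangle, and
     not just its corner, stays inside. *)
  { assert (K : forall n m, fst (s n) <= fst (s (n + m)%nat) <= fst (s n) + h / 2 ^ n - h / 2 ^ (n + m) /\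
     snd (s n) <= snd (s (n + m)%nat) <= snd (s n) + k / 2 ^ n - k / 2 ^ (n + m)).
    { intros n. induction m as [|m IH].
      - rewrite Nat.add_0_r. lra.
      - rewrite Nat.add_succ_r. destruct (Hs (n + m)%nat) as [_ [S1 S2]].
        assert (Q := P2 (n + m)%nat).
        assert (Eh : h / 2 ^ (n + m) = 2 * (h / 2 ^ S (n + m))) by (simpl; field; lra).
        assert (Ek : k / 2 ^ (n + m) = 2 * (k / 2 ^ S (n + m))) by (simpl; field; lra).
        lra. }
    intros n m. assert (A := K n m).
    assert (0 < h / 2 ^ (n + m)) by (apply Rdiv_lt_0_compat; auto).
    assert (0 < k / 2 ^ (n + m)) by (apply Rdiv_lt_0_compat; auto). lra. }
  assert (Hlim : forall (u : nat -> R) (w : R), (forall n m, u n <= u (n + m)%nat <= u n + w / 2 ^ n) ->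
     exists c, forall n, u n <= c <= u n + w / 2 ^ n).
  { intros u w Hu.
    destruct (completeness (fun y => exists n, y = u n)) as [c [C1 C2]].
    - exists (u 0%nat + w / 2 ^ 0). intros y [n ->]. apply (Hu 0%nat n).
    - now exists (u 0%nat), 0%nat.
    - exists c. intros n. split; [apply C1; now exists n|].
      apply C2. intros y [m ->].
      destruct (Nat.le_ge_cases n m) as [L|L].
      + replace m with (n + (m - n))%nat by lia. apply Hu.
      + assert (A := Hu m (n - m)%nat). replace (m + (n - m))%nat with n in A by lia.
        assert (B := Hu n 0%nat). rewrite Nat.add_0_r in B. lra. }
  destruct (Hlim (fun n => fst (s n)) h) as [cx Hcx]; [intros; apply Hmono|].
  destruct (Hlim (fun n => snd (s n)) k) as [ct Hct]; [intros; apply Hmono|].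
  assert (Hc0 := Hcx 0%nat). rewrite Hs0 in Hc0. simpl in Hc0. unfold Rdiv in Hc0.
  rewrite Rinv_1, Rmult_1_r in Hc0.
  destruct (Hg cx ct) as [l Hl]; [lra|].
  (* Chosen so that the bound of [rect_integral_small] at level [n] is exactly half of the lower
     bound [eta / 4 ^ n]. *)
  set (eps := eta / (8 * (h + k) * (h + k))).
  assert (Phk : 0 < (h + k) * (h + k)) by (apply Rmult_lt_0_compat; lra).
  assert (Heps : 0 < eps) by (apply Rdiv_lt_0_compat; lra).
  destruct (Hl eps Heps) as [d [Hd Hld]].
  assert (Hn : exists n, (h + k) / 2 ^ n < d).
  { destruct (pow_lt_1_zero (/ 2)) with (y := d / (h + k)) as [n Hn].
    - rewrite Rabs_right; lra.
    - apply Rdiv_lt_0_compat; lra.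
    - exists n. assert (A := Hn n (le_n n)).
      rewrite Rabs_right in A by (apply Rle_ge, pow_le; lra).
      rewrite pow_inv in A.
      unfold Rdiv. apply Rmult_lt_compat_l with (r := h + k) in A; [|lra].
      replace ((h + k) * (d / (h + k))) with d in A by (field; lra). exact A. }
  destruct Hn as [n Hn]. destruct (Hs n) as [[Q1 [Q2 [Q3 [Q4 Q5]]]] _].
  assert (Hcn := Hcx n). assert (Htn := Hct n). simpl in Hcn, Htn.
  assert (Ph : 0 < h / 2 ^ n) by (apply Rdiv_lt_0_compat; auto).
  assert (Pk : 0 < k / 2 ^ n) by (apply Rdiv_lt_0_compat; auto).
  assert (Ehk : (h + k) / 2 ^ n = h / 2 ^ n + k / 2 ^ n) by (field; apply Rgt_not_eq, P2).
  assert (B := rect_integral_small (fst (s n)) (snd (s n)) (h / 2 ^ n) (k / 2 ^ n) cx ct eps l).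
  assert (B' : Cmod (rect_integral g (fst (s n)) (snd (s n)) (h / 2 ^ n) (k / 2 ^ n))
     <= 4 * eps * (h / 2 ^ n + k / 2 ^ n) * (h / 2 ^ n + k / 2 ^ n)).
  { apply B; try lra. intros x' t' Hx' Ht'. apply Hld; apply Rabs_def1; lra. }
  assert (E : 4 * eps * (h / 2 ^ n + k / 2 ^ n) * (h / 2 ^ n + k / 2 ^ n) = eta / 4 ^ n / 2).
  { replace 4 with (2 * 2) at 2 by ring. rewrite Rpow_mult_distr. unfold eps. field.
    split; [apply Rgt_not_eq, P2|lra]. }
  assert (0 < eta / 4 ^ n) by (apply Rdiv_lt_0_compat; auto). lra.
Qed.

End Goursat.

(** * Means over circles *)

Definition circ (s t : R) : C := (s * cos t, s * sin t).

Lemma Cmod_circ (s t : R) : 0 <= s -> Cmod (circ s t) = s.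
Proof.
  intros Hs. unfold Cmod, circ. simpl fst. simpl snd.
  replace ((s * cos t) ^ 2 + (s * sin t) ^ 2) with (s ^ 2 * (Rsqr (sin t) + Rsqr (cos t)))
    by (unfold Rsqr; ring).
  rewrite sin2_cos2, Rmult_1_r. now apply sqrt_pow2.
Qed.

Lemma Rabs_cos_minus (x y : R) : Rabs (cos x - cos y) <= Rabs (x - y).
Proof.
  destruct (MVT_gen cos y x (fun t => - sin t)) as [c [_ Hc]].
  - intros t _. apply is_derive_Reals, derivable_pt_lim_cos.
  - intros t _. apply continuity_cos.
  - rewrite Hc, Rabs_mult, Rabs_Ropp.
    rewrite <- (Rmult_1_l (Rabs (x - y))) at 2. apply Rmult_le_compat_r; [apply Rabs_pos|].
    apply Rabs_le. destruct (SIN_bound c). lra.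
Qed.

Lemma Rabs_sin_minus (x y : R) : Rabs (sin x - sin y) <= Rabs (x - y).
Proof.
  rewrite !sin_cos.
  replace (- cos (PI / 2 + x) - - cos (PI / 2 + y)) with (- (cos (PI / 2 + x) - cos (PI / 2 + y))) by ring.
  rewrite Rabs_Ropp. eapply Rle_trans; [apply Rabs_cos_minus|]. right. f_equal. ring.
Qed.

Lemma circ_dist (s s' t t' : R) :
  0 <= s -> Cmod (circ s' t' - circ s t) <= 2 * Rabs (s' - s) + 2 * s * Rabs (t' - t).
Proof.
  intros Hs. eapply Rle_trans; [apply Cmod_le_abs|]. unfold circ. simpl.
  replace (s' * cos t' + - (s * cos t)) with ((s' - s) * cos t' + s * (cos t' - cos t)) by ring.
  replace (s' * sin t' + - (s * sin t)) with ((s' - s) * sin t' + s * (sin t' - sin t)) by ring.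
  assert (A1 := Rabs_triang ((s' - s) * cos t') (s * (cos t' - cos t))).
  assert (A2 := Rabs_triang ((s' - s) * sin t') (s * (sin t' - sin t))).
  rewrite !Rabs_mult, (Rabs_right s) in A1, A2 by lra.
  assert (B1 : s * Rabs (cos t' - cos t) <= s * Rabs (t' - t))
    by (apply Rmult_le_compat_l; [exact Hs|apply Rabs_cos_minus]).
  assert (B2 : s * Rabs (sin t' - sin t) <= s * Rabs (t' - t))
    by (apply Rmult_le_compat_l; [exact Hs|apply Rabs_sin_minus]).
  assert (C1 : Rabs (s' - s) * Rabs (cos t') <= Rabs (s' - s) * 1)
    by (apply Rmult_le_compat_l; [apply Rabs_pos|apply Rabs_le; destruct (COS_bound t'); lra]).
  assert (C2 : Rabs (s' - s) * Rabs (sin t') <= Rabs (s' - s) * 1)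
    by (apply Rmult_le_compat_l; [apply Rabs_pos|apply Rabs_le; destruct (SIN_bound t'); lra]).
  lra.
Qed.

Lemma derivable_pt_lim_bound (f : R -> R) (x l eps : R) :
  derivable_pt_lim f x l -> 0 < eps ->
  exists d, 0 < d /\ forall h, Rabs h < d -> Rabs (f (x + h) - f x - l * h) <= eps * Rabs h.
Proof.
  intros H Heps. destruct (H eps Heps) as [d Hd]. exists d. split; [apply cond_pos|].
  intros h Hh. destruct (Req_dec h 0) as [->|H0].
  - rewrite Rplus_0_r. replace (f x - f x - l * 0) with 0 by ring. rewrite Rabs_R0. lra.
  - replace (f (x + h) - f x - l * h) with (((f (x + h) - f x) / h - l) * h) by (now field).
    rewrite Rabs_mult. apply Rmult_le_compat_r; [apply Rabs_pos|]. now apply Rlt_le, Hd.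
Qed.

(** [circ (exp u) v] is e^(u+iv), and this is its differentiability at 0, assembled from that of
    [exp], [sin] and [cos]. The 5 in the choice of [e] collects the errors 2 + 2 + 1 that multiply
    [e * Rabs v]. *)
Lemma circ_exp_diff (eps : R) : 0 < eps ->
  exists d, 0 < d /\ forall u v, Rabs u < d -> Rabs v < d ->
    Cmod (circ (exp u) v - 1 - (u, v)) <= eps * (Rabs u + Rabs v).
Proof.
  intros Heps. set (e := Rmin 1 (eps / 5)).
  assert (He : 0 < e) by (apply Rmin_glb_lt; lra).
  assert (He1 : e <= 1) by apply Rmin_l.
  assert (He5 : 5 * e <= eps) by (assert (e <= eps / 5) by apply Rmin_r; lra).
  destruct (derivable_pt_lim_bound exp 0 1 e) as [d1 [Hd1 H1]]; [|exact He|].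
  { rewrite <- exp_0. apply derivable_pt_lim_exp. }
  destruct (derivable_pt_lim_bound sin 0 1 e) as [d2 [Hd2 H2]]; [|exact He|].
  { rewrite <- cos_0. apply derivable_pt_lim_sin. }
  destruct (derivable_pt_lim_bound cos 0 0 e) as [d3 [Hd3 H3]]; [|exact He|].
  { replace 0 with (- sin 0) at 2 by (rewrite sin_0; ring). apply derivable_pt_lim_cos. }
  exists (Rmin (Rmin d1 d2) (Rmin d3 (e / 2))). split; [repeat apply Rmin_glb_lt; lra|].
  intros u v Hu Hv.
  assert (Hul := Rlt_le_trans _ _ _ Hu (Rmin_l _ _)).
  assert (Hur := Rlt_le_trans _ _ _ Hu (Rmin_r _ _)).
  assert (Hvl := Rlt_le_trans _ _ _ Hv (Rmin_l _ _)).
  assert (Hvr := Rlt_le_trans _ _ _ Hv (Rmin_r _ _)).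
  assert (A1 := H1 u (Rlt_le_trans _ _ _ Hul (Rmin_l _ _))).
  assert (Hu3 := Rlt_le_trans _ _ _ Hur (Rmin_r _ _)).
  assert (A2 := H2 v (Rlt_le_trans _ _ _ Hvl (Rmin_r _ _))).
  assert (A3 := H3 v (Rlt_le_trans _ _ _ Hvr (Rmin_l _ _))).
  rewrite Rplus_0_l, exp_0 in A1. rewrite Rplus_0_l, sin_0 in A2. rewrite Rplus_0_l, cos_0 in A3.
  assert (Pu := Rabs_pos u). assert (Pv := Rabs_pos v).
  assert (Eu : Rabs (exp u - 1) <= 2 * Rabs u).
  { replace (exp u - 1) with ((exp u - 1 - 1 * u) + u) by ring.
    eapply Rle_trans; [apply Rabs_triang|].
    assert (e * Rabs u <= 1 * Rabs u) by (apply Rmult_le_compat_r; lra). lra. }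
  assert (Ex : 0 < exp u <= 2).
  { split; [apply exp_pos|]. apply Rabs_le_between in Eu. lra. }
  eapply Rle_trans; [apply Cmod_le_abs|]. unfold circ. simpl.
  replace (exp u * cos v + - (1) + - u) with (exp u * (cos v - 1 - 0 * v) + (exp u - 1 - 1 * u)) by ring.
  replace (exp u * sin v + - 0 + - v) with (exp u * (sin v - 0 - 1 * v) + (exp u - 1) * v) by ring.
  assert (T1 := Rabs_triang (exp u * (cos v - 1 - 0 * v)) (exp u - 1 - 1 * u)).
  assert (T2 := Rabs_triang (exp u * (sin v - 0 - 1 * v)) ((exp u - 1) * v)).
  rewrite !Rabs_mult, (Rabs_right (exp u)) in T1, T2 by lra.
  assert (B1 : exp u * Rabs (cos v - 1 - 0 * v) <= 2 * (e * Rabs v))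
    by (apply Rmult_le_compat; try apply Rabs_pos; lra).
  assert (B2 : exp u * Rabs (sin v - 0 - 1 * v) <= 2 * (e * Rabs v))
    by (apply Rmult_le_compat; try apply Rabs_pos; lra).
  rewrite (Rabs_mult (exp u - 1) v) in T2.
  assert (B3 : Rabs (exp u - 1) * Rabs v <= e * Rabs v)
    by (apply Rmult_le_compat_r; lra).
  assert (B4 : 5 * e * (Rabs u + Rabs v) <= eps * (Rabs u + Rabs v))
    by (apply Rmult_le_compat_r; lra).
  assert (0 <= e * Rabs u) by (apply Rmult_le_pos; lra). lra.
Qed.

Lemma circ_exp_add (x u t v : R) :
  circ (exp (x + u)) (t + v) = (circ (exp x) t * circ (exp u) v)%C.
Proof.
  unfold circ, Cmult. simpl. rewrite exp_plus, cos_plus, sin_plus. f_equal; ring.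
Qed.

(** Chain rule for [F] after the exponential, whose derivative at x + i t is its value [z]. The
    functional equation [circ_exp_add] moves the estimate to the point 0. *)
Lemma Gdiff_polar (F : C -> C) (x t : R) :
  Cdiffable F (circ (exp x) t) -> Gdiff (fun x t => F (circ (exp x) t)) x t.
Proof.
  intros [l Hl]. set (z := circ (exp x) t) in *.
  exists (l * z)%C. intros eps Heps.
  assert (Pz : 0 < Cmod z) by (unfold z; rewrite Cmod_circ; [apply exp_pos|apply Rlt_le, exp_pos]).
  assert (Pl := Cmod_ge_0 l).
  set (e1 := eps / (4 * Cmod z)).
  assert (He1 : 0 < e1) by (apply Rdiv_lt_0_compat; lra).
  destruct (Hl e1 He1) as [d1 [Hd1 H1]].
  set (e2 := Rmin 1 (eps / (2 * (Cmod l + 1) * Cmod z))).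
  assert (He2 : 0 < e2).
  { apply Rmin_glb_lt; [lra|]. apply Rdiv_lt_0_compat; [lra|]. apply Rmult_lt_0_compat; lra. }
  destruct (circ_exp_diff e2 He2) as [d2 [Hd2 H2]].
  set (d3 := d1 / (4 * Cmod z)).
  assert (Hd3 : 0 < d3) by (apply Rdiv_lt_0_compat; lra).
  exists (Rmin d2 d3). split; [now apply Rmin_glb_lt|]. intros x' t' Hx Ht.
  set (u := x' - x) in *. set (v := t' - t) in *.
  assert (A2 := H2 u v (Rlt_le_trans _ _ _ Hx (Rmin_l _ _)) (Rlt_le_trans _ _ _ Ht (Rmin_l _ _))).
  assert (Hu3 := Rlt_le_trans _ _ _ Hx (Rmin_r _ _)).
  assert (Hv3 := Rlt_le_trans _ _ _ Ht (Rmin_r _ _)).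
  set (D := Rabs u + Rabs v) in *.
  assert (PD : 0 <= D) by (assert (P1 := Rabs_pos u); assert (P2 := Rabs_pos v); unfold D; lra).
  replace x' with (x + u) by (unfold u; ring). replace t' with (t + v) by (unfold v; ring).
  rewrite circ_exp_add. fold z. set (E := circ (exp u) v) in *.
  assert (AE : Cmod (z * E - z) <= 2 * Cmod z * D).
  { replace (z * E - z)%C with (z * ((E - 1 - (u, v)) + (u, v)))%C by ring.
    rewrite Cmod_mult. replace (2 * Cmod z * D) with (Cmod z * (2 * D)) by ring.
    apply Rmult_le_compat_l; [lra|]. eapply Rle_trans; [apply Cmod_triangle|].
    assert (B := Cmod_le_abs (u, v)). simpl in B. fold D in B.
    assert (e2 * D <= 1 * D) by (apply Rmult_le_compat_r; [exact PD|apply Rmin_l]). lra. }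
  assert (Hd : Cmod (z * E - z) < d1).
  { eapply Rle_lt_trans; [exact AE|]. assert (D < 2 * d3) by (unfold D; lra).
    apply Rlt_le_trans with (2 * Cmod z * (2 * d3)).
    - apply Rmult_lt_compat_l; lra.
    - right. unfold d3. field. lra. }
  assert (A1 := H1 _ Hd).
  replace (F (z * E) - F z - l * z * (u, v))%C with
    ((F (z * E) - F z - l * (z * E - z)) + l * z * (E - 1 - (u, v)))%C by ring.
  eapply Rle_trans; [apply Cmod_triangle|]. rewrite !Cmod_mult.
  assert (B1 : e1 * Cmod (z * E - z) <= eps / 2 * D).
  { replace (eps / 2 * D) with (e1 * (2 * Cmod z * D)) by (unfold e1; field; lra).
    apply Rmult_le_compat_l; lra. }
  assert (B2 : Cmod l * Cmod z * Cmod (E - 1 - (u, v)) <= eps / 2 * D).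
  { replace (eps / 2 * D) with
      ((Cmod l + 1) * Cmod z * (eps / (2 * (Cmod l + 1) * Cmod z) * D)) by (field; lra).
    apply Rmult_le_compat.
    - apply Rmult_le_pos; lra.
    - apply Cmod_ge_0.
    - apply Rmult_le_compat_r; lra.
    - eapply Rle_trans; [exact A2|]. apply Rmult_le_compat_r; [exact PD|apply Rmin_r]. }
  lra.
Qed.

(** Not normalised: this is 2π times the mean over the circle of radius [s]. *)
Definition cmean (F : C -> C) (s : R) : C := CI (fun t => F (circ s t)) 0 (2 * PI).

Lemma two_PI_pos : 0 < 2 * PI.
Proof. assert (H := PI_RGT_0). lra. Qed.

Lemma Ceq_eps (z w : C) : (forall eps, 0 < eps -> Cmod (z - w) <= eps) -> z = w.
Proof.
  intros H. apply NNPP. intros Hn. assert (P := Cmod_minus_pos z w Hn).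
  assert (A := H (Cmod (z - w) / 2)). lra.
Qed.

Lemma RCcont_circ (F : C -> C) (s t : R) :
  0 <= s -> Ccont F (circ s t) -> RCcont (fun t => F (circ s t)) t.
Proof.
  intros Hs H eps Heps. destruct (H eps Heps) as [d [Hd HF]].
  exists (d / (2 * s + 1)). split; [apply Rdiv_lt_0_compat; lra|].
  intros t' Ht. apply HF. eapply Rle_lt_trans; [now apply circ_dist|].
  rewrite Rminus_diag, Rabs_R0.
  apply Rle_lt_trans with ((2 * s + 1) * Rabs (t' - t)).
  - assert (P := Rabs_pos (t' - t)). lra.
  - apply Rmult_lt_compat_l with (r := 2 * s + 1) in Ht; [|lra].
    replace ((2 * s + 1) * (d / (2 * s + 1))) with d in Ht by (field; lra). exact Ht.
Qed.

Lemma CexI_circ (F : C -> C) (s : R) :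
  0 <= s -> (forall z, Cmod z = s -> Ccont F z) -> CexI (fun t => F (circ s t)) 0 (2 * PI).
Proof.
  intros Hs H. apply CexI_cont; [apply Rlt_le, two_PI_pos|].
  intros t _. apply RCcont_circ; [exact Hs|]. apply H. now apply Cmod_circ.
Qed.

(** Goursat's theorem on the rectangle over [[ln s1, ln s2]] of height 2π: the horizontal sides
    cancel by periodicity, and the vertical ones contribute i times the difference of the two
    means. *)
Lemma cmean_annulus (F : C -> C) (a b s1 s2 : R) :
  0 <= a -> (forall z, a < Cmod z < b -> Cdiffable F z) ->
  a < s1 -> s1 < s2 -> s2 < b -> cmean F s1 = cmean F s2.
Proof.
  intros Ha HF Has H12 Hsb.
  set (g := fun x t => F (circ (exp x) t)).
  assert (HP := two_PI_pos).
  (* Midpoints replace [a] and [b] as ends of the strip, since [a] may be 0, where the logarithm is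
     meaningless. *)
  assert (G := Goursat (ln ((a + s1) / 2)) (ln ((s2 + b) / 2)) g).
  assert (Hg : strip_diff (ln ((a + s1) / 2)) (ln ((s2 + b) / 2)) g).
  { intros x t [Hx1 Hx2]. apply Gdiff_polar, HF.
    rewrite Cmod_circ by apply Rlt_le, exp_pos.
    apply exp_increasing in Hx1, Hx2. rewrite exp_ln in Hx1, Hx2 by lra. lra. }
  specialize (G Hg (ln s1) 0 (ln s2 - ln s1) (2 * PI)).
  replace (ln s1 + (ln s2 - ln s1)) with (ln s2) in G by ring.
  assert (L12 : ln s1 < ln s2) by (apply ln_increasing; lra).
  assert (L1 : ln ((a + s1) / 2) < ln s1) by (apply ln_increasing; lra).
  assert (L2 : ln s2 < ln ((s2 + b) / 2)) by (apply ln_increasing; lra).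
  assert (G0 := G ltac:(lra) HP L1 L2). clear G.
  unfold rect_integral in G0.
  replace (ln s1 + (ln s2 - ln s1)) with (ln s2) in G0 by ring.
  rewrite (CI_ext _ (fun _ => RtoC 0) (ln s1) (ln s2)) in G0.
  2: lra.
  2:{ intros u _. unfold g, circ. rewrite cos_plus, sin_plus, cos_2PI, sin_2PI.
      replace (cos 0 * 1 - sin 0 * 0) with (cos 0) by ring.
      replace (sin 0 * 1 + cos 0 * 0) with (sin 0) by ring. ring. }
  rewrite CI_const, Rplus_0_l in G0.
  assert (X : forall s, a < s < b -> CexI (fun t => F (circ s t)) 0 (2 * PI)).
  { intros s Hs. apply CexI_circ; [lra|]. intros z Hz. apply Cdiffable_Ccont, HF. lra. }
  unfold g in G0. rewrite !exp_ln in G0 by lra.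
  rewrite CI_minus in G0 by (apply X; lra).
  fold (cmean F s1) (cmean F s2) in G0.
  assert (E : (Ci * (cmean F s2 - cmean F s1) = 0)%C) by (rewrite <- G0; ring).
  apply Ceq_eps. intros eps Heps. rewrite Cmod_minus_sym.
  assert (M : Cmod (Ci * (cmean F s2 - cmean F s1)) = 0) by (rewrite E; apply Cmod_0).
  rewrite Cmod_mult, Cmod_Ci, Rmult_1_l in M. lra.
Qed.

Lemma cmean_cont (F : C -> C) (Rd s : R) :
  (forall z, Cmod z < Rd -> Ccont F z) -> 0 <= s < Rd ->
  forall eps, 0 < eps -> exists d, 0 < d /\ forall s', 0 <= s' < Rd -> Rabs (s' - s) < d ->
    Cmod (cmean F s' - cmean F s) <= eps.
Proof.
  intros HF Hs eps Heps. set (r := (s + Rd) / 2). assert (HP := two_PI_pos).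
  destruct (disc_uniformly_continuous r F) with (eps := eps / (4 * PI)) as [d [Hd H]].
  - unfold r; lra.
  - intros z Hz e He. destruct (HF z) with (eps := e) as [d [Hd H]]; [unfold r in Hz; lra|exact He|].
    exists d. split; [exact Hd|]. intros w _. apply H.
  - apply Rdiv_lt_0_compat; lra.
  - exists (Rmin (r - s) (d / 2)). split; [apply Rmin_glb_lt; unfold r; lra|].
    intros s' Hs' Hd'.
    assert (D1 := Rlt_le_trans _ _ _ Hd' (Rmin_l _ _)).
    assert (D2 := Rlt_le_trans _ _ _ Hd' (Rmin_r _ _)).
    assert (Hr : s' <= r) by (apply Rabs_def2 in D1; lra).
    assert (X : forall s, 0 <= s < Rd -> CexI (fun t => F (circ s t)) 0 (2 * PI)).
    { intros s1 Hs1. apply CexI_circ; [lra|]. intros z Hz. apply HF. lra. }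
    unfold cmean. rewrite <- CI_minus by (apply X; lra).
    replace eps with (2 * (2 * PI - 0) * (eps / (4 * PI))) by (field; lra).
    apply CI_bound; [lra|apply CexI_minus; apply X; lra|].
    intros t _. apply Rlt_le, H; rewrite ?Cmod_circ by lra; [unfold r; lra|exact Hr|].
    eapply Rle_lt_trans; [apply circ_dist; lra|]. rewrite Rminus_diag, Rabs_R0. lra.
Qed.

(* The circle of radius [s0] may carry any set of exceptional points: [cmean F] is
   continuous in the radius and locally constant on both sides of [s0]. *)
Lemma mean_value (F : C -> C) (Rd s0 s : R) :
  0 < s0 -> (forall z, Cmod z < Rd -> Ccont F z) ->
  (forall z, 0 < Cmod z < Rd -> Cmod z <> s0 -> Cdiffable F z) ->
  0 <= s < Rd -> cmean F s = (2 * PI * F 0)%C.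
Proof.
  intros Hs0 Hc Hd Hs.
  assert (E0 : cmean F 0 = (2 * PI * F 0)%C).
  { unfold cmean. rewrite (CI_ext _ (fun _ => F 0)).
    - rewrite CI_const, Rminus_0_r, RtoC_mult. reflexivity.
    - apply Rlt_le, two_PI_pos.
    - intros t _. f_equal. unfold circ, RtoC. f_equal; ring. }
  rewrite <- E0.
  (* Below [s0] the means agree at all positive radii, and letting the radius shrink to 0 identifies
     their common value. *)
  assert (Hlow : forall s, 0 <= s < Rd -> s < s0 -> cmean F s = cmean F 0).
  { intros r [Hr0 Hr] Hrs. destruct (Req_dec r 0) as [->|Hr1]; [reflexivity|].
    apply Ceq_eps. intros eps Heps.
    destruct (cmean_cont F Rd 0 Hc ltac:(lra) eps Heps) as [d [Pd H]].
    set (r' := Rmin (r / 2) (d / 2)).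
    assert (Pr' : 0 < r') by (apply Rmin_glb_lt; lra).
    assert (r' <= r / 2) by apply Rmin_l. assert (r' <= d / 2) by apply Rmin_r.
    rewrite <- (cmean_annulus F 0 (Rmin Rd s0) r' r); try lra.
    - apply H; [lra|]. rewrite Rabs_right; lra.
    - intros z [Hz1 Hz2].
      assert (A := Rlt_le_trans _ _ _ Hz2 (Rmin_l _ _)).
      assert (B := Rlt_le_trans _ _ _ Hz2 (Rmin_r _ _)). apply Hd; lra.
    - apply Rmin_glb_lt; lra. }
  destruct (Rlt_le_dec s s0) as [H1|H1]; [now apply Hlow|].
  assert (Hmid : cmean F s0 = cmean F 0).
  { apply Ceq_eps. intros eps Heps.
    destruct (cmean_cont F Rd s0 Hc ltac:(lra) eps Heps) as [d [Pd H]].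
    set (r' := Rmax (s0 / 2) (s0 - d / 2)).
    assert (r' < s0) by (apply Rmax_lub_lt; lra).
    assert (s0 / 2 <= r') by apply Rmax_l. assert (s0 - d / 2 <= r') by apply Rmax_r.
    rewrite <- (Hlow r'), Cmod_minus_sym by lra. apply H; [lra|]. apply Rabs_def1; lra. }
  destruct (Rle_lt_or_eq_dec _ _ H1) as [H2| <-]; [|exact Hmid].
  rewrite <- Hmid. apply Ceq_eps. intros eps Heps.
  destruct (cmean_cont F Rd s0 Hc ltac:(lra) eps Heps) as [d [Pd H]].
  set (r' := Rmin ((s + s0) / 2) (s0 + d / 2)).
  assert (s0 < r') by (apply Rmin_glb_lt; lra).
  assert (r' <= (s + s0) / 2) by apply Rmin_l. assert (r' <= s0 + d / 2) by apply Rmin_r.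
  rewrite <- (cmean_annulus F s0 Rd r' s); try lra.
  - apply H; [lra|]. apply Rabs_def1; lra.
  - intros z Hz. apply Hd; lra.
Qed.

(** * Cauchy's integral formula *)

Definition slope (f : C -> C) (z l w : C) : C :=
  if excluded_middle_informative (w = z) then l else ((f w - f z) / (w - z))%C.

Lemma slope_neq (f : C -> C) (z l w : C) : w <> z -> slope f z l w = ((f w - f z) / (w - z))%C.
Proof. intros H. unfold slope. now destruct excluded_middle_informative. Qed.

Lemma slope_eq (f : C -> C) (z l : C) : slope f z l z = l.
Proof. unfold slope. now destruct excluded_middle_informative. Qed.

Lemma slope_mult (f : C -> C) (z l w : C) : (f w = f z + (w - z) * slope f z l w)%C.
Proof.
  unfold slope. destruct excluded_middle_informative as [->|H]; [ring|].
  field. now apply Cminus_eq_contra.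
Qed.

Lemma slope_Ccont_self (f : C -> C) (z l : C) : Cdiff f z l -> Ccont (slope f z l) z.
Proof.
  intros H eps Heps. apply Cdiff_Cderiv_at in H.
  destruct (H eps Heps) as [d [Hd Hf]]. exists d. split; [exact Hd|]. intros w Hw.
  rewrite slope_eq. destruct (classic (w = z)) as [->|Hn].
  - rewrite slope_eq, Cmod_minus_refl. exact Heps.
  - rewrite slope_neq by exact Hn. apply Hf. split; [now apply Cmod_minus_pos|exact Hw].
Qed.

Lemma neq_of_near (w z v : C) : Cmod (v - w) < Cmod (w - z) -> v <> z.
Proof. intros H ->. rewrite Cmod_minus_sym in H. lra. Qed.

Lemma slope_Ccont (f : C -> C) (z l w : C) : w <> z -> Ccont f w -> Ccont (slope f z l) w.
Proof.
  intros Hn Hf.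
  apply Ccont_ext_loc with (fun v => (f v - f z) * / (v - z))%C (Cmod (w - z)).
  - now apply Cmod_minus_pos.
  - intros v Hv. rewrite slope_neq; [reflexivity|]. now apply neq_of_near with w.
  - apply Ccont_mult; [now apply Ccont_minus_const|].
    apply Ccont_inv; [apply Ccont_minus_const, Ccont_id|now apply Cminus_eq_contra].
Qed.

Lemma slope_Cdiffable (f : C -> C) (z l w : C) :
  w <> z -> Cdiffable f w -> Cdiffable (slope f z l) w.
Proof.
  intros Hn Hf.
  apply Cdiffable_ext_loc with (fun v => (f v - f z) * / (v - z))%C (Cmod (w - z)).
  - now apply Cmod_minus_pos.
  - intros v Hv. rewrite slope_neq; [reflexivity|]. now apply neq_of_near with w.
  - apply Cdiffable_mult; [now apply Cdiffable_minus_const|].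
    apply Cdiffable_inv; [apply Cdiffable_minus_const, Cdiffable_id|now apply Cminus_eq_contra].
Qed.

(** The integrand is differentiable wherever |u| > |z|, so the radius may be enlarged at will, and u
    / (u - z) tends to 1 at infinity. *)
Lemma kernel_mean (z : C) (rho : R) :
  Cmod z < rho -> cmean (fun u => u * / (u - z))%C rho = (2 * PI)%C.
Proof.
  intros Hz. assert (Pz := Cmod_ge_0 z). assert (HP := two_PI_pos).
  assert (Hne : forall u, Cmod z < Cmod u -> (u - z)%C <> 0).
  { intros u Hu. apply Cmod_gt_0. assert (A := Cmod_minus_ge u z). lra. }
  assert (Hd : forall u, Cmod z < Cmod u -> Cdiffable (fun u => u * / (u - z))%C u).
  { intros u Hu. apply Cdiffable_mult; [apply Cdiffable_id|].
    apply Cdiffable_inv; [apply Cdiffable_minus_const, Cdiffable_id|now apply Hne]. }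
  apply Ceq_eps. intros eps Heps.
  (* On this circle |z / (u - z)| is at most [eps / (4 * PI)], which [CI_bound] turns into [eps].
     Using [Cmod z + 1] keeps the quotient positive when [z = 0]. *)
  set (s := rho + 1 + 4 * PI * (Cmod z + 1) / eps).
  assert (Hq : 0 < 4 * PI * (Cmod z + 1) / eps)
    by (apply Rdiv_lt_0_compat; [apply Rmult_lt_0_compat|]; lra).
  assert (Hs : rho < s) by (unfold s; lra).
  rewrite (cmean_annulus _ (Cmod z) (s + 1) rho s); try lra.
  2:{ intros u Hu. apply Hd. lra. }
  assert (X : CexI (fun t => circ s t * / (circ s t - z))%C 0 (2 * PI)).
  { apply (CexI_circ (fun u => u * / (u - z))%C); [lra|].
    intros u Hu. apply Cdiffable_Ccont, Hd. lra. }
  assert (E : (2 * PI)%C = CI (fun _ => RtoC 1) 0 (2 * PI)).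
  { rewrite CI_const, Rminus_0_r, RtoC_mult. ring. }
  rewrite E. unfold cmean. rewrite <- CI_minus; [|exact X|apply CexI_const].
  replace eps with (2 * (2 * PI - 0) * (eps / (4 * PI))) by (field; lra).
  apply CI_bound; [lra|apply CexI_minus; [exact X|apply CexI_const]|].
  intros t _.
  assert (Hu : Cmod (circ s t) = s) by (apply Cmod_circ; lra).
  assert (Hn := Hne (circ s t) ltac:(lra)).
  set (u := circ s t) in *.
  replace (u * / (u - z) - 1)%C with (z * / (u - z))%C by (field; exact Hn).
  rewrite Cmod_mult, Cmod_inv by exact Hn.
  assert (Pu : 4 * PI * (Cmod z + 1) / eps <= Cmod (u - z))
    by (assert (A := Cmod_minus_ge u z); unfold s in *; lra).
  apply Rmult_le_reg_r with (Cmod (u - z)); [lra|].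
  rewrite Rmult_assoc, Rinv_l, Rmult_1_r by lra.
  apply Rle_trans with (eps / (4 * PI) * (4 * PI * (Cmod z + 1) / eps)).
  - replace (eps / (4 * PI) * (4 * PI * (Cmod z + 1) / eps)) with (Cmod z + 1) by (field; lra). lra.
  - apply Rmult_le_compat_l; [apply Rlt_le, Rdiv_lt_0_compat; lra|exact Pu].
Qed.

(** Cauchy's formula in the angular variable: for u = rho e^(it) one has du = i u dt, so f(u) du /
    (u - z) is i f(u) u / (u - z) dt. *)
Definition cauchy_rep (f : C -> C) (rho : R) : Prop :=
  forall z, Cmod z < rho -> cmean (fun u => f u * (u * / (u - z)))%C rho = (2 * PI * f z)%C.

Lemma kernel_Ccont (z u : C) : u <> z -> Ccont (fun u => u * / (u - z))%C u.
Proof.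
  intros H. apply Ccont_mult; [apply Ccont_id|].
  apply Ccont_inv; [apply Ccont_minus_const, Ccont_id|now apply Cminus_eq_contra].
Qed.

(** For [z = 0] this is the mean value property itself. Otherwise the mean value property is applied
    to u times the slope of [f] at [z]: this function vanishes at 0, so its mean is zero, and
    [kernel_mean] evaluates the part carrying [f z]. *)
Lemma cauchy_formula (f : C -> C) (Rd rho : R) :
  (forall z, Cmod z < Rd -> Ccont f z) -> (forall z, 0 < Cmod z < Rd -> Cdiffable f z) ->
  0 < rho < Rd -> cauchy_rep f rho.
Proof.
  intros Hc Hd Hr z Hz. assert (Pz := Cmod_ge_0 z). assert (HP := two_PI_pos).
  destruct (classic (z = 0)) as [Hz0|Hz0].
  - rewrite Hz0. rewrite <- (mean_value f Rd Rd rho); try lra; try assumption.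
    + apply CI_ext; [lra|]. intros t _.
      assert (circ rho t <> 0) by (apply Cmod_gt_0; rewrite Cmod_circ; lra).
      field. replace (circ rho t - 0)%C with (circ rho t) by ring. auto.
    + intros w Hw _. now apply Hd.
  - apply Cmod_gt_0 in Hz0.
    destruct (Hd z) as [l Hl]; [lra|].
    set (F := fun u => (u * slope f z l u)%C).
    assert (M : cmean F rho = (2 * PI * F 0)%C).
    (* The slope is known to be continuous, but not yet differentiable, at [u = z]; hence the circle
       through [z] is taken as the exceptional one. *)
    { apply mean_value with Rd (Cmod z); try lra.
      - intros u Hu. apply Ccont_mult; [apply Ccont_id|].
        destruct (classic (u = z)) as [->|Hn]; [now apply slope_Ccont_self|].
        apply slope_Ccont; [exact Hn|now apply Hc].
      - intros u Hu Hn. apply Cdiffable_mult; [apply Cdiffable_id|].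
        apply slope_Cdiffable; [intros ->; now apply Hn|now apply Hd]. }
    unfold F in M at 2. rewrite Cmult_0_l, Cmult_0_r in M.
    assert (Hne : forall u, Cmod u = rho -> u <> z) by (intros u Hu ->; lra).
    assert (X1 : CexI (fun t => f (circ rho t) * (circ rho t * / (circ rho t - z)))%C 0 (2 * PI)).
    { apply (CexI_circ (fun u => f u * (u * / (u - z)))%C); [lra|]. intros u Hu.
      apply Ccont_mult; [apply Hc; lra|]. now apply kernel_Ccont, Hne. }
    assert (X2 : CexI (fun t => circ rho t * / (circ rho t - z))%C 0 (2 * PI)).
    { apply (CexI_circ (fun u => u * / (u - z))%C); [lra|]. intros u Hu.
      now apply kernel_Ccont, Hne. }
    assert (E : cmean F rho = (cmean (fun u => f u * (u * / (u - z))) rho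
        - f z * cmean (fun u => u * / (u - z)) rho)%C).
    { unfold cmean. rewrite <- CI_scal by exact X2.
      rewrite <- CI_minus; [|exact X1|apply CexI_scal; exact X2].
      apply CI_ext; [lra|]. intros t _. unfold F.
      assert (Hn : circ rho t <> z) by (apply Hne, Cmod_circ; lra).
      rewrite slope_neq by exact Hn. field. now apply Cminus_eq_contra. }
    rewrite M, kernel_mean in E by exact Hz.
    transitivity (0 + f z * (2 * PI))%C; [rewrite E; ring|ring].
Qed.

(** [interval_uniform] delivers a small number, so the bound is sought in the form [/ d]. *)
Lemma circle_bounded (f : C -> C) (rho : R) :
  0 <= rho -> (forall z, Cmod z = rho -> Ccont f z) ->
  exists M, 0 < M /\ forall t, 0 <= t <= 2 * PI -> Cmod (f (circ rho t)) <= M.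
Proof.
  intros Hr Hc.
  destruct (interval_uniform 0 (2 * PI) (fun d t => Cmod (f (circ rho t)) <= / d)) as [d [Hd H]].
  - apply Rlt_le, two_PI_pos.
  - intros d d' t Hd' Hdd H. eapply Rle_trans; [exact H|]. now apply Rinv_le_contravar.
  - intros t _.
    destruct (RCcont_circ f rho t Hr (Hc _ (Cmod_circ rho t Hr)) 1) as [d [Hd H]]; [lra|].
    assert (P := Cmod_ge_0 (f (circ rho t))).
    exists (Rmin d (/ (Cmod (f (circ rho t)) + 1))). split.
    { apply Rmin_glb_lt; [exact Hd|]. apply Rinv_0_lt_compat. lra. }
    intros t' _ Ht'.
    apply Rle_trans with (Cmod (f (circ rho t)) + 1).
    + assert (A := H t' (Rlt_le_trans _ _ _ Ht' (Rmin_l _ _))).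
      assert (B := Cmod_minus_ge (f (circ rho t')) (f (circ rho t))). lra.
    + rewrite <- (Rinv_inv (Cmod (f (circ rho t)) + 1)) at 1.
      apply Rinv_le_contravar; [|apply Rmin_r].
      apply Rmin_glb_lt; [exact Hd|]. apply Rinv_0_lt_compat. lra.
  - exists (/ d). split; [now apply Rinv_0_lt_compat|exact H].
Qed.

Lemma Cmod_2PI_mult (z : C) : Cmod (2 * PI * z) = 2 * PI * Cmod z.
Proof.
  rewrite <- RtoC_mult, Cmod_mult, Cmod_R, Rabs_right; [reflexivity|].
  apply Rle_ge, Rlt_le, two_PI_pos.
Qed.

Lemma weighted_cmean_bound (f G : C -> C) (rho M B : R) :
  0 <= rho -> (forall z, Cmod z = rho -> Ccont f z) -> (forall z, Cmod z = rho -> Ccont G z) ->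
  (forall t, 0 <= t <= 2 * PI -> Cmod (f (circ rho t)) <= M) ->
  (forall z, Cmod z = rho -> Cmod (G z) <= B) ->
  Cmod (cmean (fun u => f u * G u)%C rho) <= 2 * PI * (2 * M * B).
Proof.
  intros Hr Hf HG HM HB. assert (HP := two_PI_pos).
  replace (2 * PI * (2 * M * B)) with (2 * (2 * PI - 0) * (M * B)) by ring.
  apply CI_bound; [lra| |].
  - apply (CexI_circ (fun u => f u * G u)%C); [exact Hr|].
    intros z Hz. apply Ccont_mult; auto.
  - intros t Ht. rewrite Cmod_mult.
    apply Rmult_le_compat; try apply Cmod_ge_0; [now apply HM|]. apply HB. now apply Cmod_circ.
Qed.

Lemma Cmod_inv_le (u z : C) (d : R) : 0 < d -> d <= Cmod (u - z) -> Cmod (/ (u - z)) <= / d.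
Proof.
  intros Hd H. rewrite Cmod_inv by (apply Cmod_gt_0; lra). now apply Rinv_le_contravar.
Qed.

Lemma cauchy_rep_bound (f : C -> C) (rho r M : R) :
  0 <= r < rho -> (forall z, Cmod z = rho -> Ccont f z) -> cauchy_rep f rho ->
  (forall t, 0 <= t <= 2 * PI -> Cmod (f (circ rho t)) <= M) ->
  forall z, Cmod z <= r -> Cmod (f z) <= 2 * M * (rho * / (rho - r)).
Proof.
  intros Hr Hc Hrep HM z Hz. assert (HP := two_PI_pos).
  apply Rmult_le_reg_l with (2 * PI); [exact HP|].
  rewrite <- Cmod_2PI_mult, <- Hrep by lra.
  apply weighted_cmean_bound; try assumption; try lra.
  - intros u Hu. apply kernel_Ccont. intros ->. lra.
  - intros u Hu. rewrite Cmod_mult, Hu. apply Rmult_le_compat_l; [lra|].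
    apply Cmod_inv_le; [lra|]. assert (A := Cmod_minus_ge u z). lra.
Qed.

(** Integrate against [f] the identity expressing u/(u-z) - u/(u-w) - (z-w) u/(u-w)^2 as (z-w)^2
    u/((u-w)^2 (u-z)). For |z|, |w| at most r the kernels are bounded on the circle, so one [K]
    controls both the derivative [D] and the quadratic remainder. *)
Lemma cauchy_rep_taylor (f : C -> C) (rho r : R) :
  0 <= r < rho -> (forall z, Cmod z = rho -> Ccont f z) -> cauchy_rep f rho ->
  exists (D : C -> C) (K : R), forall z w, Cmod z <= r -> Cmod w <= r ->
    Cmod (D w) <= K /\
    Cmod (f z - f w - D w * (z - w)) <= K * (Cmod (z - w) * Cmod (z - w)).
Proof.
  intros Hr Hc Hrep. assert (HP := two_PI_pos).
  destruct (circle_bounded f rho) as [M [PM HM]]; [lra|exact Hc|].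
  set (k1 := fun w u => (u * / (u - w) * / (u - w))%C).
  set (k2 := fun z w u => (u * / (u - w) * / (u - w) * / (u - z))%C).
  set (d := rho - r). assert (Hd : 0 < d) by (unfold d; lra).
  assert (Hne : forall u w, Cmod u = rho -> Cmod w <= r -> u <> w) by (intros u w Hu Hw ->; lra).
  assert (Hi : forall u w, Cmod u = rho -> Cmod w <= r -> Cmod (/ (u - w)) <= / d).
  { intros u w Hu Hw. apply Cmod_inv_le; [exact Hd|].
    assert (A := Cmod_minus_ge u w). unfold d. lra. }
  assert (Ci : forall u w, Cmod u = rho -> Cmod w <= r -> Ccont (fun u => / (u - w))%C u).
  { intros u w Hu Hw. apply Ccont_inv; [apply Ccont_minus_const, Ccont_id|].
    now apply Cminus_eq_contra, Hne. }
  assert (Pd : 0 < / d) by now apply Rinv_0_lt_compat.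
  assert (C1 : forall u w, Cmod u = rho -> Cmod w <= r -> Ccont (k1 w) u).
  { intros u w Hu Hw. apply Ccont_mult; [|now apply Ci]. now apply kernel_Ccont, Hne. }
  assert (C2 : forall u z w, Cmod u = rho -> Cmod z <= r -> Cmod w <= r -> Ccont (k2 z w) u).
  { intros u z w Hu Hz Hw. apply Ccont_mult; [|now apply Ci]. now apply C1. }
  assert (B1 : forall u w, Cmod u = rho -> Cmod w <= r -> Cmod (k1 w u) <= rho * / d * / d).
  { intros u w Hu Hw. unfold k1. rewrite !Cmod_mult, Hu.
    apply Rmult_le_compat; auto using Cmod_ge_0.
    - apply Rmult_le_pos; [lra|apply Cmod_ge_0].
    - apply Rmult_le_compat_l; [lra|auto]. }
  assert (B2 : forall u z w, Cmod u = rho -> Cmod z <= r -> Cmod w <= r ->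
    Cmod (k2 z w u) <= rho * / d * / d * / d).
  { intros u z w Hu Hz Hw. change (k2 z w u) with (k1 w u * / (u - z))%C.
    rewrite Cmod_mult. apply Rmult_le_compat; auto using Cmod_ge_0. }
  exists (fun w => / (2 * PI) * cmean (fun u => f u * k1 w u) rho)%C.
  set (K1 := 2 * M * (rho * / d * / d)). set (K2 := 2 * M * (rho * / d * / d * / d)).
  assert (PK1 : 0 <= K1).
  { unfold K1. repeat apply Rmult_le_pos; lra. }
  assert (PK2 : 0 <= K2).
  { unfold K2. repeat apply Rmult_le_pos; lra. }
  exists (K1 + K2). intros z w Hz Hw.
  assert (N2 : (2 * PI)%C <> 0).
  { rewrite <- RtoC_mult. apply Cmod_gt_0. rewrite Cmod_R, Rabs_right; lra. }
  split.
  - apply Rle_trans with K1; [|lra].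
    apply Rmult_le_reg_l with (2 * PI); [exact HP|]. rewrite <- Cmod_2PI_mult.
    replace (2 * PI * (/ (2 * PI) * cmean (fun u => f u * k1 w u) rho))%C
      with (cmean (fun u => f u * k1 w u) rho)%C by (rewrite Cmult_assoc, Cinv_r by exact N2; ring).
    apply weighted_cmean_bound; auto; lra.
  - apply Rle_trans with (K2 * (Cmod (z - w) * Cmod (z - w))).
    2:{ apply Rmult_le_compat_r; [apply Rmult_le_pos; apply Cmod_ge_0|lra]. }
    apply Rmult_le_reg_l with (2 * PI); [exact HP|]. rewrite <- Cmod_2PI_mult.
    assert (Z : forall v G, Cmod v <= r -> (forall u, Cmod u = rho -> Ccont G u) ->
      CexI (fun t => f (circ rho t) * G (circ rho t))%C 0 (2 * PI)).
    { intros v G Hv HG. apply (CexI_circ (fun u => f u * G u)%C); [lra|].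
      intros u Hu. apply Ccont_mult; auto. }
    assert (Xz := Z z (fun u => u * / (u - z))%C Hz (fun u Hu => kernel_Ccont z u (Hne u z Hu Hz))).
    assert (Xw := Z w (fun u => u * / (u - w))%C Hw (fun u Hu => kernel_Ccont w u (Hne u w Hu Hw))).
    assert (X1 := Z w (k1 w) Hw (fun u Hu => C1 u w Hu Hw)).
    assert (X2 := Z w (k2 z w) Hw (fun u Hu => C2 u z w Hu Hz Hw)).
    assert (E : (2 * PI * (f z - f w - / (2 * PI) * cmean (fun u => f u * k1 w u) rho * (z - w))
      = (z - w) * (z - w) * cmean (fun u => f u * k2 z w u) rho)%C).
    { transitivity (2 * PI * f z - 2 * PI * f w - (z - w) * cmean (fun u => f u * k1 w u) rho)%C.
      - field. intros Hf. apply N2. rewrite Hf. ring.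
      - rewrite <- !Hrep by lra. unfold cmean.
        rewrite <- (CI_scal (z - w)) by exact X1.
        rewrite <- (CI_scal ((z - w) * (z - w))) by exact X2.
        rewrite <- CI_minus; [|exact Xz|exact Xw].
        rewrite <- CI_minus; [|apply CexI_minus; [exact Xz|exact Xw]|apply CexI_scal; exact X1].
        apply CI_ext; [lra|]. intros t _. unfold k1, k2.
        assert (Hu : Cmod (circ rho t) = rho) by (apply Cmod_circ; lra).
        assert (Hz1 := Cminus_eq_contra _ _ (Hne _ z Hu Hz)).
        assert (Hw1 := Cminus_eq_contra _ _ (Hne _ w Hu Hw)).
        field. split; assumption. }
    rewrite E, !Cmod_mult.
    replace (2 * PI * (K2 * (Cmod (z - w) * Cmod (z - w))))
      with (Cmod (z - w) * Cmod (z - w) * (2 * PI * K2)) by ring.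
    apply Rmult_le_compat_l; [apply Rmult_le_pos; apply Cmod_ge_0|].
    apply weighted_cmean_bound; auto; lra.
Qed.

Lemma taylor_Cdiff (f D : C -> C) (K r : R) (w : C) :
  (forall z, Cmod z <= r ->
    Cmod (f z - f w - D w * (z - w)) <= K * (Cmod (z - w) * Cmod (z - w))) ->
  Cmod w < r -> Cdiff f w (D w).
Proof.
  intros H Hw eps Heps.
  assert (PK := Rabs_pos K).
  exists (Rmin (r - Cmod w) (eps / (Rabs K + 1))). split.
  { apply Rmin_glb_lt; [lra|]. apply Rdiv_lt_0_compat; lra. }
  intros z Hz.
  assert (Hz1 := Rlt_le_trans _ _ _ Hz (Rmin_l _ _)).
  assert (Hz2 := Rlt_le_trans _ _ _ Hz (Rmin_r _ _)).
  eapply Rle_trans; [apply H|].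
  - assert (A := Cmod_minus_ge z w). lra.
  - rewrite <- Rmult_assoc. apply Rmult_le_compat_r; [apply Cmod_ge_0|].
    apply Rle_trans with ((Rabs K + 1) * Cmod (z - w)).
    + apply Rmult_le_compat_r; [apply Cmod_ge_0|]. assert (A := Rle_abs K). lra.
    + apply Rmult_lt_compat_l with (r := Rabs K + 1) in Hz2; [|lra].
      replace ((Rabs K + 1) * (eps / (Rabs K + 1))) with eps in Hz2 by (field; lra). lra.
Qed.

Lemma removable_singularity (f : C -> C) (Rd : R) :
  0 < Rd -> (forall z, Cmod z < Rd -> Ccont f z) ->
  (forall z, 0 < Cmod z < Rd -> Cdiffable f z) -> Cdiffable f 0.
Proof.
  intros HR Hc Hd.
  assert (Hrep := cauchy_formula f Rd (Rd / 2) Hc Hd ltac:(lra)).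
  destruct (cauchy_rep_taylor f (Rd / 2) (Rd / 4)) as [D [K H]]; [lra| |exact Hrep|].
  - intros z Hz. apply Hc. lra.
  - exists (D 0). apply taylor_Cdiff with K (Rd / 4); rewrite ?Cmod_0; [|lra].
    intros z Hz. apply H; [exact Hz|]. rewrite Cmod_0. lra.
Qed.

Lemma Ccont_uniform_limit (fN : nat -> C -> C) (f : C -> C) (Rd : R) :
  (forall n z, Cmod z < Rd -> Ccont (fN n) z) ->
  (forall eps, 0 < eps -> exists n, forall z, Cmod z < Rd -> Cmod (fN n z - f z) <= eps) ->
  forall z, Cmod z < Rd -> Ccont f z.
Proof.
  intros Hc Hu z Hz eps Heps.
  destruct (Hu (eps / 4)) as [n Hn]; [lra|].
  destruct (Hc n z Hz (eps / 4)) as [d [Hd H]]; [lra|].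
  exists (Rmin d (Rd - Cmod z)). split; [apply Rmin_glb_lt; lra|]. intros w Hw.
  assert (A := H w (Rlt_le_trans _ _ _ Hw (Rmin_l _ _))).
  assert (Hw2 := Rlt_le_trans _ _ _ Hw (Rmin_r _ _)).
  assert (B := Hn z Hz).
  assert (B' := Hn w ltac:(assert (E := Cmod_minus_ge w z); lra)).
  assert (T1 := Cmod_minus_triangle (f w) (fN n w) (f z)).
  assert (T2 := Cmod_minus_triangle (fN n w) (fN n z) (f z)).
  rewrite (Cmod_minus_sym (f w) (fN n w)) in T1. lra.
Qed.

(** Weierstrass's theorem: for fixed [z] the Cauchy kernel is bounded on the circle, so Cauchy's
    formula survives a uniform limit, and it implies differentiability. *)
Lemma Cdiffable_uniform_limit (fN : nat -> C -> C) (f : C -> C) (Rd : R) :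
  (forall n z, Cmod z < Rd -> Cdiffable (fN n) z) ->
  (forall eps, 0 < eps -> exists n, forall z, Cmod z < Rd -> Cmod (fN n z - f z) <= eps) ->
  forall z, Cmod z < Rd -> Cdiffable f z.
Proof.
  intros Hd Hu z0 Hz0. assert (HP := two_PI_pos). assert (P0 := Cmod_ge_0 z0).
  assert (HcN : forall n z, Cmod z < Rd -> Ccont (fN n) z)
    by (intros; now apply Cdiffable_Ccont, Hd).
  assert (Hc := Ccont_uniform_limit fN f Rd HcN Hu).
  set (rho := (Cmod z0 + Rd) / 2).
  assert (Hrho : Cmod z0 < rho < Rd) by (unfold rho; lra).
  assert (Hrep : cauchy_rep f rho).
  { intros z Hz. assert (Pz := Cmod_ge_0 z). apply Ceq_eps. intros eps Heps.
    set (B := rho * / (rho - Cmod z)).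
    assert (PB : 0 < B) by (apply Rmult_lt_0_compat; [lra|apply Rinv_0_lt_compat; lra]).
    (* [B] bounds the kernel on the circle. The integral contributes an error [2 * PI * (2 * e * B)]
       and the value at [z] an error [2 * PI * e]; together they are [eps]. *)
    set (e := eps / (2 * PI * (1 + 2 * B))).
    assert (PQ : 0 < 2 * PI * (1 + 2 * B)) by (apply Rmult_lt_0_compat; lra).
    destruct (Hu e) as [n Hn]; [now apply Rdiv_lt_0_compat|].
    assert (Rn := cauchy_formula (fN n) Rd rho (HcN n)
      (fun z Hz => Hd n z (proj2 Hz)) ltac:(lra) z Hz).
    assert (Hne : forall u, Cmod u = rho -> u <> z) by (intros u Hu' ->; lra).
    assert (Z : forall G, (forall u, Cmod u < Rd -> Ccont G u) ->
      CexI (fun t => G (circ rho t) * (circ rho t * / (circ rho t - z)))%C 0 (2 * PI)).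
    { intros G HG. apply (CexI_circ (fun u => G u * (u * / (u - z)))%C); [lra|].
      intros u Hu'. apply Ccont_mult; [apply HG; lra|now apply kernel_Ccont, Hne]. }
    assert (E : (cmean (fun u => f u * (u * / (u - z))) rho - 2 * PI * f z
       = cmean (fun u => (f u - fN n u) * (u * / (u - z))) rho + 2 * PI * (fN n z - f z))%C).
    { replace (2 * PI * (fN n z - f z))%C with (2 * PI * fN n z - 2 * PI * f z)%C by ring.
      rewrite <- Rn. unfold cmean.
      rewrite (CI_ext (fun t => (f (circ rho t) - fN n (circ rho t)) * (circ rho t * / (circ rho t - z)))%C
        (fun t => f (circ rho t) * (circ rho t * / (circ rho t - z))
          - fN n (circ rho t) * (circ rho t * / (circ rho t - z)))%C);
        [|lra|intros t _; ring].
      rewrite CI_minus by (apply Z; auto). ring. }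
    rewrite E. eapply Rle_trans; [apply Cmod_triangle|]. rewrite Cmod_2PI_mult.
    assert (B1 := Hn z ltac:(lra)).
    assert (B2 : Cmod (cmean (fun u => (f u - fN n u) * (u * / (u - z)))%C rho) <= 2 * PI * (2 * e * B)).
    { apply weighted_cmean_bound.
      - lra.
      - intros u Hu'. apply (Ccont_plus f (fun u => - fN n u)%C); [apply Hc; lra|].
        intros e' He'. destruct (HcN n u ltac:(lra) e' He') as [d [Hdd H]].
        exists d. split; [exact Hdd|]. intros w Hw.
        replace (- fN n w - - fN n u)%C with (- (fN n w - fN n u))%C by ring.
        rewrite Cmod_opp. now apply H.
      - intros u Hu'. now apply kernel_Ccont, Hne.
      - intros t _. rewrite Cmod_minus_sym. apply Hn. rewrite Cmod_circ; lra.
      - intros u Hu'. rewrite Cmod_mult, Hu'. apply Rmult_le_compat_l; [lra|].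
        apply Cmod_inv_le; [lra|]. assert (A := Cmod_minus_ge u z). lra. }
    assert (B3 : 2 * PI * Cmod (fN n z - f z) <= 2 * PI * e) by (apply Rmult_le_compat_l; lra).
    replace eps with (2 * PI * (2 * e * B) + 2 * PI * e); [lra|].
    unfold e. field. lra. }
  destruct (cauchy_rep_taylor f rho ((Cmod z0 + rho) / 2)) as [D [K H]]; [lra| |exact Hrep|].
  - intros z Hz. apply Hc. lra.
  - exists (D z0). apply taylor_Cdiff with K ((Cmod z0 + rho) / 2); [|lra].
    intros z Hz. apply H; lra.
Qed.

(** * Zeros of the derivative and inverse functions *)

(** The cofactor is the slope of [f] at 0, whose differentiability at 0 is an instance of the
    removable singularity theorem. *)
Lemma Cdiffable_factor (f : C -> C) (Rd : R) :
  0 < Rd -> (forall z, Cmod z < Rd -> Cdiffable f z) ->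
  exists h, (forall z, Cmod z < Rd -> Cdiffable h z) /\ forall z, f z = (f 0 + z * h z)%C.
Proof.
  intros HR Hf. destruct (Hf 0) as [l Hl]; [rewrite Cmod_0; exact HR|].
  exists (slope f 0 l).
  assert (Hoff : forall z, 0 < Cmod z < Rd -> Cdiffable (slope f 0 l) z).
  { intros z Hz. apply slope_Cdiffable; [apply Cmod_gt_0; lra|apply Hf; lra]. }
  assert (Hc : forall z, Cmod z < Rd -> Ccont (slope f 0 l) z).
  { intros z Hz. destruct (classic (z = 0)) as [->|Hn]; [now apply slope_Ccont_self|].
    apply Cdiffable_Ccont, Hoff. split; [now apply Cmod_gt_0|exact Hz]. }
  split.
  - intros z Hz. destruct (classic (z = 0)) as [->|Hn].
    + now apply removable_singularity with Rd.
    + apply Hoff. split; [now apply Cmod_gt_0|exact Hz].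
  - intros z. rewrite (slope_mult f 0 l z) at 1. ring.
Qed.

(** A further factor z is divided out as long as the cofactor vanishes at 0. The exponent is [S k]
    because the constant term [f 0] has been split off. *)
Lemma finite_or_infinite_order (f : C -> C) (Rd : R) :
  0 < Rd -> (forall z, Cmod z < Rd -> Cdiffable f z) ->
  (exists k h, (forall z, Cmod z < Rd -> Cdiffable h z) /\ h 0 <> 0 /\
     forall z, f z = (f 0 + z ^ S k * h z)%C) \/
  (forall k, exists h, (forall z, Cmod z < Rd -> Cdiffable h z) /\
     forall z, f z = (f 0 + z ^ S k * h z)%C).
Proof.
  intros HR Hf.
  match goal with |- ?A \/ _ => destruct (classic A) as [H|H]; [now left|right] end.
  induction k as [|k [h [Hh E]]].
  - destruct (Cdiffable_factor f Rd HR Hf) as [h [Hh E]]. exists h. split; [exact Hh|].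
    intros z. rewrite Cpow_1_r. apply E.
  - destruct (classic (h 0 = 0)) as [H0|H0].
    + destruct (Cdiffable_factor h Rd HR Hh) as [h' [Hh' E']]. exists h'. split; [exact Hh'|].
      intros z. rewrite E, E', H0. rewrite (Cpow_S z (S k)). ring.
    + exfalso. apply H. now exists k, h.
Qed.

(** On the circle of radius [rho] the cofactor is at most [M / rho ^ S k]. By Cauchy's formula it is
    at most four times that on the disc of radius [rho / 2], where f - f(0) is therefore at most
    [4 * M * (/ 2) ^ S k], for every [k]. *)
Lemma infinite_order_constant (f : C -> C) (Rd : R) :
  0 < Rd -> (forall z, Cmod z < Rd -> Cdiffable f z) ->
  (forall k, exists h, (forall z, Cmod z < Rd -> Cdiffable h z) /\
     forall z, f z = (f 0 + z ^ S k * h z)%C) ->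
  forall z, Cmod z <= Rd / 4 -> f z = f 0.
Proof.
  intros HR Hf Hord z Hz. set (rho := Rd / 2). assert (Pz := Cmod_ge_0 z).
  assert (Prho : 0 < rho) by (unfold rho; lra).
  destruct (circle_bounded (fun u => f u - f 0)%C rho) as [M [PM HM]]; [lra| |].
  { intros u Hu. apply Ccont_minus_const, Cdiffable_Ccont, Hf. unfold rho in Hu. lra. }
  apply Ceq_eps. intros eps Heps.
  destruct (pow_lt_1_zero (/ 2)) with (y := eps / (4 * M)) as [k Hk].
  { rewrite Rabs_right; lra. }
  { apply Rdiv_lt_0_compat; lra. }
  specialize (Hk (S k) ltac:(lia)). rewrite Rabs_right in Hk by (apply Rle_ge, pow_le; lra).
  destruct (Hord k) as [h [Hh E]].
  assert (Hrep : cauchy_rep h rho).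
  { apply cauchy_formula with Rd; [|intros u Hu; apply Hh; lra|unfold rho; lra].
    intros u Hu. now apply Cdiffable_Ccont, Hh. }
  assert (Pk : 0 < rho ^ S k) by (apply pow_lt; exact Prho).
  assert (B := cauchy_rep_bound h rho (rho / 2) (M / rho ^ S k) ltac:(lra)).
  assert (B' : Cmod (h z) <= 2 * (M / rho ^ S k) * (rho * / (rho - rho / 2))).
  { apply B; [|exact Hrep| |unfold rho; lra].
    - intros u Hu. apply Cdiffable_Ccont, Hh. unfold rho in Hu; lra.
    - intros t Ht. apply Rmult_le_reg_r with (rho ^ S k); [exact Pk|].
      replace (M / rho ^ S k * rho ^ S k) with M by (field; lra).
      eapply Rle_trans; [|apply (HM t Ht)]. rewrite (E (circ rho t)).
      replace (f 0 + circ rho t ^ S k * h (circ rho t) - f 0)%C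
        with (h (circ rho t) * circ rho t ^ S k)%C by ring.
      rewrite Cmod_mult, Cmod_pow, Cmod_circ by lra. lra. }
  rewrite (E z). replace (f 0 + z ^ S k * h z - f 0)%C with (z ^ S k * h z)%C by ring.
  rewrite Cmod_mult, Cmod_pow.
  apply Rle_trans with ((rho / 2) ^ S k * (4 * M / rho ^ S k)).
  - apply Rmult_le_compat; [now apply pow_le|apply Cmod_ge_0| |].
    + apply pow_incr. unfold rho. lra.
    + eapply Rle_trans; [exact B'|]. right. field. split; lra.
  - unfold Rdiv at 1. rewrite Rpow_mult_distr.
    apply Rmult_lt_compat_l with (r := 4 * M) in Hk; [|lra].
    replace (4 * M * (eps / (4 * M))) with eps in Hk by (field; lra).
    replace (rho ^ S k * (/ 2) ^ S k * (4 * M / rho ^ S k)) with (4 * M * (/ 2) ^ S k)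
      by (field; lra).
    lra.
Qed.

Lemma Cdiff_pow (k : nat) (z : C) : Cdiff (fun w => w ^ S k)%C z (INR (S k) * z ^ k)%C.
Proof.
  induction k as [|k IH].
  - replace (INR 1 * z ^ 0)%C with (RtoC 1) by (simpl; ring).
    apply Cdiff_ext_loc with (fun w => w) 1; [lra| |apply Cdiff_id].
    intros w _. now rewrite Cpow_1_r.
  - replace (INR (S (S k)) * z ^ S k)%C with (1 * z ^ S k + z * (INR (S k) * z ^ k))%C.
    + apply (Cdiff_mult (fun w => w) (fun w => w ^ S k)%C); [apply Cdiff_id|exact IH].
    + rewrite (S_INR (S k)), RtoC_plus, (Cpow_S z k). ring.
Qed.

(** The derivative is z^k ((k+1) h(z) + z h'(z)). The bracket does not vanish near 0, because [h 0]
    is nonzero and h' is bounded there. *)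
Lemma finite_order_deriv_nonzero (f h : C -> C) (Rd : R) (k : nat) :
  0 < Rd -> (forall z, Cmod z < Rd -> Cdiffable h z) -> h 0 <> 0 ->
  (forall z, f z = (f 0 + z ^ S k * h z)%C) ->
  exists d, 0 < d /\ forall z, 0 < Cmod z < d -> exists l : C, l <> 0 /\ Cdiff f z l.
Proof.
  intros HR Hh H0 E. apply Cmod_gt_0 in H0.
  assert (Hc : forall z, Cmod z < Rd -> Ccont h z) by (intros; now apply Cdiffable_Ccont, Hh).
  destruct (cauchy_rep_taylor h (Rd / 2) (Rd / 4)) as [D [K HD]]; [lra| | |].
  { intros z Hz. apply Hc. lra. }
  { apply cauchy_formula with Rd; [exact Hc|intros u Hu; apply Hh; lra|lra]. }
  assert (PK : 0 <= K).
  { destruct (HD 0 0) as [A _]; rewrite ?Cmod_0; try lra. assert (B := Cmod_ge_0 (D 0)). lra. }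
  destruct (Hc 0 ltac:(rewrite Cmod_0; exact HR) (Cmod (h 0) / 2)) as [d1 [Hd1 H1]]; [lra|].
  (* For |z| < e the term z h'(z) stays below half of |h(0)|, while (k+1) h(z) stays above it. *)
  set (e := Cmod (h 0) / (2 * (K + 1))).
  assert (He : 0 < e) by (apply Rdiv_lt_0_compat; lra).
  exists (Rmin (Rd / 4) (Rmin d1 e)). split; [repeat apply Rmin_glb_lt; lra|].
  intros z [Hz0 Hz].
  assert (Hz1 := Rlt_le_trans _ _ _ Hz (Rmin_l _ _)).
  assert (Hzr := Rlt_le_trans _ _ _ Hz (Rmin_r _ _)).
  assert (Hz2 := Rlt_le_trans _ _ _ Hzr (Rmin_l _ _)).
  assert (Hz3 := Rlt_le_trans _ _ _ Hzr (Rmin_r _ _)).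
  exists (z ^ k * (INR (S k) * h z + z * D z))%C. split.
  - apply Cmult_neq_0; [apply Cpow_nz; now apply Cmod_gt_0|].
    apply Cmod_gt_0.
    assert (A1 : Cmod (h 0) / 2 <= Cmod (h z)).
    { assert (A := H1 z). replace (z - 0)%C with z in A by ring. specialize (A Hz2).
      assert (B := Cmod_minus_ge (h 0) (h z)). rewrite Cmod_minus_sym in B. lra. }
    assert (A2 : Cmod (h z) <= Cmod (INR (S k) * h z)).
    { rewrite Cmod_mult, Cmod_R, Rabs_right by (apply Rle_ge, pos_INR).
      rewrite <- (Rmult_1_l (Cmod (h z))) at 1. apply Rmult_le_compat_r; [apply Cmod_ge_0|].
      rewrite S_INR. assert (P := pos_INR k). lra. }
    assert (A3 : Cmod (z * D z) < Cmod (h 0) / 2).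
    { rewrite Cmod_mult. destruct (HD 0 z) as [BD _]; [rewrite Cmod_0; lra|lra|].
      apply Rle_lt_trans with (Cmod z * (K + 1)).
      - apply Rmult_le_compat_l; lra.
      - apply Rmult_lt_compat_r with (r := K + 1) in Hz3; [|lra].
        replace (e * (K + 1)) with (Cmod (h 0) / 2) in Hz3 by (unfold e; field; lra). exact Hz3. }
    assert (A4 := Cmod_minus_ge (INR (S k) * h z)%C (- (z * D z))%C).
    replace (INR (S k) * h z - - (z * D z))%C with (INR (S k) * h z + z * D z)%C in A4 by ring.
    rewrite Cmod_opp in A4. lra.
  - apply Cdiff_ext_loc with (fun w => f 0 + w ^ S k * h w)%C 1; [lra|intros; symmetry; apply E|].
    replace (z ^ k * (INR (S k) * h z + z * D z))%C
      with (0 + (INR (S k) * z ^ k * h z + z ^ S k * D z))%C by (rewrite Cpow_S; ring).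
    apply (Cdiff_plus (fun _ => f 0) (fun w => w ^ S k * h w)%C); [apply Cdiff_const|].
    apply (Cdiff_mult (fun w => w ^ S k)%C h); [apply Cdiff_pow|].
    apply taylor_Cdiff with K (Rd / 4); [|lra]. intros w Hw. apply HD; lra.
Qed.

Lemma inverse_Cdiff (f psi : C -> C) (w l : C) (d0 : R) :
  0 < d0 -> Ccont psi w -> (forall w', Cmod (w' - w) < d0 -> f (psi w') = w') ->
  Cdiff f (psi w) l -> l <> 0 -> Cdiff psi w (/ l).
Proof.
  intros Hd0 Hpsi Hinv Hf Hl eps Heps.
  assert (Pl : 0 < Cmod l) by now apply Cmod_gt_0.
  (* The first bound makes the increment of [psi] at most 2 |w' - w| / |l|; given this, the second
     turns the remainder of [f] into the required [eps]. *)
  set (e := Rmin (Cmod l / 2) (eps * (Cmod l * Cmod l) / 2)).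
  assert (He : 0 < e).
  { apply Rmin_glb_lt; [lra|]. apply Rdiv_lt_0_compat; [|lra].
    repeat apply Rmult_lt_0_compat; lra. }
  destruct (Hf e He) as [d1 [Hd1 H1]].
  destruct (Hpsi d1 Hd1) as [d2 [Hd2 H2]].
  exists (Rmin d0 d2). split; [now apply Rmin_glb_lt|]. intros w' Hw.
  assert (E' := Hinv w' (Rlt_le_trans _ _ _ Hw (Rmin_l _ _))).
  assert (E := Hinv w ltac:(rewrite Cmod_minus_refl; exact Hd0)).
  assert (A := H1 _ (H2 w' (Rlt_le_trans _ _ _ Hw (Rmin_r _ _)))).
  rewrite E, E' in A. set (De := (psi w' - psi w)%C) in *.
  assert (PD := Cmod_ge_0 De). assert (Pw := Cmod_ge_0 (w' - w)).
  assert (B : Cmod De * Cmod l <= 2 * Cmod (w' - w)).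
  { assert (T := Cmod_minus_ge (l * De) (w' - w)).
    rewrite (Cmod_minus_sym (l * De) (w' - w)), Cmod_mult in T.
    assert (e * Cmod De <= Cmod l / 2 * Cmod De)
      by (apply Rmult_le_compat_r; [exact PD|apply Rmin_l]). lra. }
  replace (De - / l * (w' - w))%C with (- (/ l * (w' - w - l * De)))%C by (field; exact Hl).
  rewrite Cmod_opp, Cmod_mult, Cmod_inv by exact Hl.
  apply Rmult_le_reg_l with (Cmod l * Cmod l); [apply Rmult_lt_0_compat; lra|].
  replace (Cmod l * Cmod l * (/ Cmod l * Cmod (w' - w - l * De)))
    with (Cmod l * Cmod (w' - w - l * De)) by (field; lra).
  apply Rle_trans with (Cmod l * (e * Cmod De)); [apply Rmult_le_compat_l; lra|].
  apply Rle_trans with (e * (2 * Cmod (w' - w))).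
  - replace (Cmod l * (e * Cmod De)) with (e * (Cmod De * Cmod l)) by ring.
    apply Rmult_le_compat_l; lra.
  - replace (Cmod l * Cmod l * (eps * Cmod (w' - w)))
      with (eps * (Cmod l * Cmod l) / 2 * (2 * Cmod (w' - w))) by field.
    apply Rmult_le_compat_r; [lra|apply Rmin_r].
Qed.

(* A continuous right inverse of a holomorphic map is differentiable off the (isolated)
   critical values, hence everywhere by the removable singularity theorem. *)
Lemma continuous_right_inverse_at_0 (f psi : C -> C) (r rho : R) :
  0 < r -> 0 < rho -> (forall z, Cmod z < r -> Cdiffable f z) ->
  (forall w, Cmod w < rho -> Ccont psi w /\ f (psi w) = w /\ Cmod (psi w) < r) ->
  psi 0 = 0 -> Cdiffable psi 0.
Proof.
  intros Hr Hrho Hf Hpsi H0.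
  destruct (Hpsi 0) as [Hc0 [Hf0 _]]; [rewrite Cmod_0; exact Hrho|]. rewrite H0 in Hf0.
  destruct (finite_or_infinite_order f r Hr Hf) as [[k [h [Hh [Hh0 E]]]]|Hinf].
  - destruct (finite_order_deriv_nonzero f h r k Hr Hh Hh0 E) as [d [Hd H]].
    destruct (Hc0 d Hd) as [d1 [Hd1 H1]].
    apply removable_singularity with (Rmin rho d1).
    + now apply Rmin_glb_lt.
    + intros w Hw. apply Hpsi. exact (Rlt_le_trans _ _ _ Hw (Rmin_l _ _)).
    + intros w [Hw0 Hw].
      assert (Hw1 := Rlt_le_trans _ _ _ Hw (Rmin_l _ _)).
      assert (Hw2 := Rlt_le_trans _ _ _ Hw (Rmin_r _ _)).
      destruct (Hpsi w Hw1) as [Hcw [Hfw _]].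
      assert (A := H1 w). rewrite H0 in A. replace (w - 0)%C with w in A by ring.
      replace (psi w - 0)%C with (psi w) in A by ring.
      destruct (H (psi w)) as [l [Hl Hdl]].
      { split; [|now apply A]. apply Cmod_gt_0. intros Hpw. rewrite Hpw, Hf0 in Hfw.
        rewrite <- Hfw, Cmod_0 in Hw0. lra. }
      exists (/ l)%C. apply inverse_Cdiff with f (rho - Cmod w); try assumption; [lra|].
      intros w' Hw'. apply Hpsi. assert (T := Cmod_minus_ge w' w). lra.
  (* If [f] were constant near 0, then [f (psi x) = x] for a small positive [x] would force x = f(0)
     = 0. *)
  - exfalso. assert (Hcst := infinite_order_constant f r Hr Hf Hinf).
    destruct (Hc0 (r / 4)) as [d [Hd H]]; [lra|].
    set (x := Rmin (rho / 2) (d / 2)).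
    assert (Px : 0 < x) by (apply Rmin_glb_lt; lra).
    assert (x <= rho / 2) by apply Rmin_l. assert (x <= d / 2) by apply Rmin_r.
    assert (Mx : Cmod x = x) by (rewrite Cmod_R, Rabs_right; lra).
    destruct (Hpsi x) as [_ [Hfx _]]; [lra|].
    assert (A := H x). rewrite H0 in A. replace (x - 0)%C with (RtoC x) in A by ring.
    replace (psi x - 0)%C with (psi x) in A by ring.
    rewrite Hcst, Hf0 in Hfx by (apply Rlt_le, A; lra).
    rewrite <- Hfx, Cmod_0 in Mx. lra.
Qed.

Lemma continuous_right_inverse (f psi : C -> C) (z0 w0 : C) (r rho : R) :
  0 < r -> 0 < rho -> (forall z, Cmod (z - z0) < r -> Cdiffable f z) ->
  (forall w, Cmod (w - w0) < rho -> Ccont psi w /\ f (psi w) = w /\ Cmod (psi w - z0) < r) ->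
  psi w0 = z0 -> Cdiffable psi w0.
Proof.
  intros Hr Hrho Hf Hpsi H0.
  assert (K : Cdiffable (fun w => psi (w + w0) - z0)%C 0).
  { apply continuous_right_inverse_at_0 with (fun z => f (z + z0) - w0)%C r rho; try assumption.
    - intros z Hz. apply Cdiffable_minus_const. apply (Cdiffable_comp (fun z => z + z0)%C f).
      + apply (Cdiffable_plus (fun z => z) (fun _ => z0)); [apply Cdiffable_id|apply Cdiffable_const].
      + apply Hf. replace (z + z0 - z0)%C with z by ring. exact Hz.
    - intros w Hw. destruct (Hpsi (w + w0)%C) as [A [B D]].
      { replace (w + w0 - w0)%C with w by ring. exact Hw. }
      repeat split.
      + apply Ccont_minus_const. apply (Ccont_comp (fun w => w + w0)%C psi); [|exact A].
        apply Ccont_plus; [apply Ccont_id|apply Ccont_const].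
      + replace (psi (w + w0) - z0 + z0)%C with (psi (w + w0)%C) by ring. rewrite B. ring.
      + exact D.
    - rewrite Cplus_0_l, H0. ring. }
  assert (K' : Cdiffable (fun w => (psi (w - w0 + w0) - z0) + z0)%C w0).
  { apply (Cdiffable_plus _ (fun _ => z0)); [|apply Cdiffable_const].
    apply (Cdiffable_comp (fun w => w - w0)%C (fun w => psi (w + w0) - z0)%C).
    - apply Cdiffable_minus_const, Cdiffable_id.
    - replace (w0 - w0)%C with (RtoC 0) by ring. exact K. }
  apply Cdiffable_ext_loc with (fun w => (psi (w - w0 + w0) - z0) + z0)%C 1; [lra| |exact K'].
  intros w _. replace (w - w0 + w0)%C with w by ring. ring.
Qed.

(** * A lacunary series in the disc algebra *)

Lemma ex_series_dominated (a : nat -> R) (c : R) :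
  (forall n, Rabs (a n) <= c * (/ 16) ^ n) -> ex_series a.
Proof.
  intros H. apply (ex_series_le (V := R_CompleteNormedModule)) with (fun n => c * (/ 16) ^ n).
  - exact H.
  - apply (ex_series_scal (V := R_NormedModule) c), ex_series_geom. rewrite Rabs_right; lra.
Qed.

Lemma Series_dominated (a : nat -> R) (c : R) :
  (forall n, Rabs (a n) <= c * (/ 16) ^ n) -> Rabs (Series a) <= c * (16 / 15).
Proof.
  intros H.
  assert (G : Rabs (/ 16) < 1) by (rewrite Rabs_right; lra).
  assert (X : ex_series (fun n => c * (/ 16) ^ n))
    by (apply (ex_series_scal (V := R_NormedModule) c), ex_series_geom, G).
  eapply Rle_trans; [apply Series_Rabs|].
  - apply ex_series_dominated with c. intros n. now rewrite Rabs_Rabsolu.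
  - eapply Rle_trans; [apply Series_le with (b := fun n => c * (/ 16) ^ n); [|exact X]|].
    + intros n. split; [apply Rabs_pos|apply H].
    + rewrite Series_scal_l, Series_geom by exact G. right. field.
Qed.

(** A Weierstrass function with a phase. On the unit circle the phase 0 gives the real part of W,
    and -π/2 the imaginary part, since cos(x - π/2) = sin x. *)
Definition weier (beta theta : R) : R :=
  Series (fun n => (/ 16) ^ n * cos (1024 ^ n * theta + beta)).

Lemma pow_inv16_pos (n : nat) : 0 < (/ 16) ^ n.
Proof. apply pow_lt. lra. Qed.

(** Half a period reverses the sign of the cosine, which suffices when |cos x| >= 1/4. Otherwise
    |sin x| is close to 1, and a quarter period replaces cos x by -sin x. The 4 is a bound for π. *)
Lemma cos_jump (x : R) : exists s, 0 < s <= 4 /\ / 2 <= Rabs (cos (x + s) - cos x).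
Proof.
  assert (HP := PI_RGT_0). assert (H4 := PI_4).
  assert (T := sin2_cos2 x). unfold Rsqr in T.
  destruct (Rle_dec (/ 4) (Rabs (cos x))) as [H|H].
  - exists PI. split; [lra|]. rewrite neg_cos.
    replace (- cos x - cos x) with (- 2 * cos x) by ring.
    rewrite Rabs_mult, Rabs_left by lra. lra.
  - exists (PI / 2). split; [lra|].
    rewrite cos_plus, cos_PI2, sin_PI2.
    apply Rnot_le_lt, Rabs_def2 in H.
    unfold Rabs. destruct Rcase_abs; nra.
Qed.

Lemma sum_f_R0_geometric (d : nat -> R) (D : R) (n : nat) :
  (forall k, Rabs (d k) <= 64 ^ k * D) ->
  Rabs (sum_f_R0 d n - d n) <= 64 ^ n / 63 * D.
Proof.
  intros H. induction n as [|n IH].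
  - simpl. rewrite Rminus_diag, Rabs_R0. assert (A := H 0%nat). simpl in A.
    assert (B := Rabs_pos (d 0%nat)). lra.
  - simpl sum_f_R0.
    replace (sum_f_R0 d n + d (S n) - d (S n)) with ((sum_f_R0 d n - d n) + d n) by ring.
    eapply Rle_trans; [apply Rabs_triang|]. assert (A := H n). simpl pow. lra.
Qed.

(** With [y = theta + s / 1024 ^ n] and [s] from [cos_jump], the n-th term jumps by at least 16^-n /
    2. The lower terms have Lipschitz constants 64^k, with sum below 64^n / 63, so they move by at
    most (4/63) 16^-n; the tail moves by at most (2/15) 16^-n. What remains exceeds 16^-n / 4, which
    is at least [64 ^ n / 16 * (y - theta)]. *)
Lemma weier_rough (beta theta : R) (n : nat) :
  exists y, theta < y <= theta + 4 / 1024 ^ n /\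
    64 ^ n / 16 * (y - theta) <= Rabs (weier beta y - weier beta theta).
Proof.
  assert (Pb : 0 < 1024 ^ n) by (apply pow_lt; lra).
  assert (Pa := pow_inv16_pos n).
  assert (P64 : 0 < 64 ^ n) by (apply pow_lt; lra).
  assert (E64 : forall k, (/ 16) ^ k * 1024 ^ k = 64 ^ k)
    by (intros k; rewrite <- Rpow_mult_distr; f_equal; lra).
  destruct (cos_jump (1024 ^ n * theta + beta)) as [s [Hs Hj]].
  set (y := theta + s / 1024 ^ n).
  assert (Hy : y - theta = s / 1024 ^ n) by (unfold y; ring).
  assert (Py : 0 < s / 1024 ^ n) by (apply Rdiv_lt_0_compat; lra).
  set (d := fun k => (/ 16) ^ k * cos (1024 ^ k * y + beta) - (/ 16) ^ k * cos (1024 ^ k * theta + beta)).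
  assert (X : forall x, ex_series (fun k => (/ 16) ^ k * cos (1024 ^ k * x + beta))).
  { intros x. apply ex_series_dominated with 1. intros k. assert (A := pow_inv16_pos k).
    rewrite Rabs_mult, (Rabs_right ((/ 16) ^ k)), Rmult_comm by lra.
    apply Rmult_le_compat_r; [lra|]. apply Rabs_le. apply COS_bound. }
  assert (Xd : ex_series d) by (apply (ex_series_minus (V := R_NormedModule)); apply X).
  assert (E : weier beta y - weier beta theta = Series d)
    by (unfold weier; now rewrite <- Series_minus by apply X).
  assert (E2 := Series_incr_n d (S n) ltac:(lia) Xd). simpl Init.Nat.pred in E2.
  assert (Hlow : Rabs (sum_f_R0 d n - d n) <= 64 ^ n / 63 * (y - theta)).
  { apply sum_f_R0_geometric. intros k. unfold d. assert (A := pow_inv16_pos k).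
    rewrite <- Rmult_minus_distr_l, Rabs_mult, (Rabs_right ((/ 16) ^ k)) by lra.
    rewrite <- E64, Rmult_assoc. apply Rmult_le_compat_l; [lra|].
    eapply Rle_trans; [apply Rabs_cos_minus|].
    replace (1024 ^ k * y + beta - (1024 ^ k * theta + beta)) with (1024 ^ k * (y - theta)) by ring.
    rewrite Rabs_right; [lra|]. apply Rle_ge, Rmult_le_pos; [apply pow_le|]; lra. }
  assert (Htail : Rabs (Series (fun k => d (S n + k)%nat)) <= 2 * (/ 16) ^ S n * (16 / 15)).
  { apply Series_dominated. intros k. rewrite Rmult_assoc, <- pow_add. unfold d.
    assert (A := pow_inv16_pos (S n + k)).
    rewrite <- Rmult_minus_distr_l, Rabs_mult, (Rabs_right ((/ 16) ^ (S n + k))), Rmult_comm by lra.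
    apply Rmult_le_compat_r; [lra|].
    apply Rabs_le. destruct (COS_bound (1024 ^ (S n + k) * y + beta)).
    destruct (COS_bound (1024 ^ (S n + k) * theta + beta)). lra. }
  assert (Hmid : (/ 16) ^ n / 2 <= Rabs (d n)).
  { unfold d. rewrite <- Rmult_minus_distr_l, Rabs_mult, (Rabs_right ((/ 16) ^ n)) by lra.
    apply Rmult_le_compat_l; [lra|].
    replace (1024 ^ n * y + beta) with (1024 ^ n * theta + beta + s)
      by (unfold y; field; lra). exact Hj. }
  assert (Ey : 64 ^ n * (y - theta) <= 4 * (/ 16) ^ n).
  { rewrite Hy, <- E64. replace ((/ 16) ^ n * 1024 ^ n * (s / 1024 ^ n)) with (s * (/ 16) ^ n)
      by (field; lra). apply Rmult_le_compat_r; lra. }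
  exists y. split.
  - split; [lra|]. assert (s / 1024 ^ n <= 4 / 1024 ^ n); [|lra].
    apply Rmult_le_compat_r; [apply Rlt_le, Rinv_0_lt_compat|]; lra.
  - rewrite E, E2.
    assert (T1 := Rabs_triang_inv (d n) (- ((sum_f_R0 d n - d n) + Series (fun k => d (S n + k)%nat)))).
    replace (d n - - (sum_f_R0 d n - d n + Series (fun k => d (S n + k)%nat)))
      with (sum_f_R0 d n + Series (fun k => d (S n + k)%nat)) in T1 by ring.
    rewrite Rabs_Ropp in T1.
    assert (T2 := Rabs_triang (sum_f_R0 d n - d n) (Series (fun k => d (S n + k)%nat))).
    simpl pow in Htail. lra.
Qed.

Definition lacunary (z : C) : C :=
  (Series (fun n => (/ 16) ^ n * Re (z ^ (1024 ^ n))), Series (fun n => (/ 16) ^ n * Im (z ^ (1024 ^ n)))).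

Fixpoint lacunary_sum (N : nat) (z : C) : C :=
  match N with
  | O => 0
  | S N => lacunary_sum N z + RtoC ((/ 16) ^ N) * z ^ (1024 ^ N)
  end%C.

Lemma Cmod_pow_le_1 (z : C) (m : nat) : Cmod z <= 1 -> Cmod (z ^ m) <= 1.
Proof.
  intros H. rewrite Cmod_pow, <- (pow1 m). apply pow_incr. split; [apply Cmod_ge_0|exact H].
Qed.

Lemma lacunary_sum_close (N : nat) (z : C) :
  Cmod z <= 1 -> Cmod (lacunary_sum N z - lacunary z) <= 4 * (/ 16) ^ N.
Proof.
  intros Hz.
  assert (K : forall (p : C -> R), (forall u, Rabs (p u) <= Cmod u) ->
    forall M, Rabs (Series (fun k => (/ 16) ^ (M + k) * p (z ^ (1024 ^ (M + k)))%C)) <= (/ 16) ^ M * (16 / 15)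
      /\ ex_series (fun k => (/ 16) ^ (M + k) * p (z ^ (1024 ^ (M + k)))%C)).
  { intros p Hp M.
    assert (A : forall k, Rabs ((/ 16) ^ (M + k) * p (z ^ (1024 ^ (M + k)))%C) <= (/ 16) ^ M * (/ 16) ^ k).
    { intros k. assert (B := pow_inv16_pos (M + k)).
      rewrite Rabs_mult, (Rabs_right ((/ 16) ^ (M + k))), <- pow_add by lra.
      rewrite <- (Rmult_1_r ((/ 16) ^ (M + k))) at 2. apply Rmult_le_compat_l; [lra|].
      eapply Rle_trans; [apply Hp|]. now apply Cmod_pow_le_1. }
    split; [now apply Series_dominated|now apply ex_series_dominated with ((/ 16) ^ M)]. }
  (* Real and imaginary parts are handled at once, as real-linear functionals [p] dominated by the
     modulus. *)
  assert (E : forall (p : C -> R), (forall u, Rabs (p u) <= Cmod u) -> p 0%C = 0 ->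
    (forall u v, p (u + v)%C = p u + p v) -> (forall (r : R) u, p (r * u)%C = r * p u) ->
    Series (fun k => (/ 16) ^ k * p (z ^ (1024 ^ k))%C) - p (lacunary_sum N z)
     = Series (fun k => (/ 16) ^ (N + k) * p (z ^ (1024 ^ (N + k)))%C)).
  { intros p Hp H0 Hadd Hsc. clear Hz. induction N as [|N IH].
    - cbn [lacunary_sum]. rewrite H0. rewrite Rminus_0_r. reflexivity.
    - cbn [lacunary_sum]. rewrite Hadd, Hsc.
      replace (Series (fun k => (/ 16) ^ k * p (z ^ (1024 ^ k))%C) -
        (p (lacunary_sum N z) + (/ 16) ^ N * p (z ^ (1024 ^ N))%C)) with
        (Series (fun k => (/ 16) ^ k * p (z ^ (1024 ^ k))%C) - p (lacunary_sum N z)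
         - (/ 16) ^ N * p (z ^ (1024 ^ N))%C) by ring.
      rewrite IH, (Series_incr_1 _ (proj2 (K p Hp N))), Nat.add_0_r.
      unfold Rminus. rewrite Rplus_comm, <- Rplus_assoc, Rplus_opp_l, Rplus_0_l.
      apply Series_ext. intros k. now rewrite Nat.add_succ_r. }
  assert (PN := pow_inv16_pos N).
  rewrite Cmod_minus_sym. eapply Rle_trans; [apply Cmod_le_abs|].
  assert (A1 := E Re Rabs_Re_le eq_refl (fun u v => eq_refl) re_scal_l).
  assert (A2 := E Im Rabs_Im_le eq_refl (fun u v => eq_refl) im_scal_l).
  assert (B1 := proj1 (K Re Rabs_Re_le N)). assert (B2 := proj1 (K Im Rabs_Im_le N)).
  rewrite <- A1 in B1. rewrite <- A2 in B2.
  change (Re (lacunary z - lacunary_sum N z)) with (Re (lacunary z) - Re (lacunary_sum N z)).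
  change (Im (lacunary z - lacunary_sum N z)) with (Im (lacunary z) - Im (lacunary_sum N z)).
  unfold lacunary. cbn [Re Im fst snd]. unfold Re, Im in *. cbn [fst snd] in *. lra.
Qed.

Lemma lacunary_sum_Cdiffable (N : nat) (z : C) : Cdiffable (lacunary_sum N) z.
Proof.
  induction N as [|N IH]; [exact (Cdiffable_const 0 z)|].
  apply (Cdiffable_plus (lacunary_sum N) (fun z => RtoC ((/ 16) ^ N) * z ^ (1024 ^ N))%C); [exact IH|].
  apply (Cdiffable_mult (fun _ => RtoC ((/ 16) ^ N)) (fun z => z ^ (1024 ^ N))%C);
    [apply Cdiffable_const|apply Cdiffable_pow].
Qed.

Lemma lacunary_uniform (eps : R) : 0 < eps ->
  exists N, forall z, Cmod z <= 1 -> Cmod (lacunary_sum N z - lacunary z) <= eps.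
Proof.
  intros Heps. destruct (pow_lt_1_zero (/ 16)) with (y := eps / 4) as [N HN].
  - rewrite Rabs_right; lra.
  - lra.
  - exists N. intros z Hz. assert (A := HN N (le_n N)). assert (P := pow_inv16_pos N).
    rewrite Rabs_right in A by lra. assert (B := lacunary_sum_close N z Hz). lra.
Qed.

Lemma lacunary_Cdiffable (z : C) : Cmod z < 1 -> Cdiffable lacunary z.
Proof.
  apply (Cdiffable_uniform_limit lacunary_sum).
  - intros n w _. apply lacunary_sum_Cdiffable.
  - intros eps Heps. destruct (lacunary_uniform eps Heps) as [N HN]. exists N.
    intros w Hw. apply HN. lra.
Qed.

Lemma lacunary_cont (z : C) : Cmod z <= 1 -> forall eps, 0 < eps ->
  exists d, 0 < d /\ forall w, Cmod w <= 1 -> Cmod (w - z) < d -> Cmod (lacunary w - lacunary z) < eps.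
Proof.
  intros Hz eps Heps. destruct (lacunary_uniform (eps / 4)) as [N HN]; [lra|].
  destruct (Cdiffable_Ccont _ _ (lacunary_sum_Cdiffable N z) (eps / 4)) as [d [Hd H]]; [lra|].
  exists d. split; [exact Hd|]. intros w Hw Hwz.
  assert (A := H w Hwz). assert (B := HN z Hz). assert (B' := HN w Hw).
  assert (T1 := Cmod_minus_triangle (lacunary w) (lacunary_sum N w) (lacunary z)).
  assert (T2 := Cmod_minus_triangle (lacunary_sum N w) (lacunary_sum N z) (lacunary z)).
  rewrite (Cmod_minus_sym (lacunary w) (lacunary_sum N w)) in T1. lra.
Qed.

Lemma lacunary_bound (z : C) : Cmod z <= 1 -> Cmod (lacunary z) <= 4.
Proof.
  intros Hz. assert (A := lacunary_sum_close 0 z Hz). cbn [lacunary_sum] in A.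
  replace (0 - lacunary z)%C with (- lacunary z)%C in A by ring. rewrite Cmod_opp in A.
  simpl in A. lra.
Qed.

Lemma expi_pow (y : R) (m : nat) : (expi y ^ m)%C = expi (INR m * y).
Proof.
  induction m as [|m IH].
  - unfold expi. rewrite Rmult_0_l, cos_0, sin_0. reflexivity.
  - rewrite Cpow_S, IH, S_INR, Rmult_plus_distr_r, Rmult_1_l. unfold expi, Cmult.
    cbn [fst snd]. rewrite cos_plus, sin_plus. f_equal; ring.
Qed.

Lemma lacunary_expi (y : R) : lacunary (expi y) = (weier 0 y, weier (- (PI / 2)) y).
Proof.
  assert (E : forall n, INR (1024 ^ n) = 1024 ^ n).
  { intros n. rewrite pow_INR. f_equal. rewrite INR_IZR_INZ. reflexivity. }
  unfold lacunary, weier. f_equal; apply Series_ext; intros n; rewrite expi_pow, E; unfold expi;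
    cbn [Re Im fst snd]; f_equal.
  - now rewrite Rplus_0_r.
  - rewrite cos_plus, cos_neg, sin_neg, cos_PI2, sin_PI2. unfold Im. cbn [snd]. ring.
Qed.

(** * The unbounded component *)

Definition segment (z w : C) (t : R) : C := (z + t * (w - z))%C.

Lemma segment_dist (z w : C) (t t' : R) :
  Cmod (segment z w t' - segment z w t) = Rabs (t' - t) * Cmod (w - z).
Proof.
  unfold segment.
  replace (z + t' * (w - z) - (z + t * (w - z)))%C with (RtoC (t' - t) * (w - z))%C
    by (rewrite RtoC_minus; ring).
  now rewrite Cmod_mult, Cmod_R.
Qed.

Lemma Copen_segment_pullback (U : C -> Prop) (z w : C) (t : R) :
  Copen U -> U (segment z w t) ->
  exists d, 0 < d /\ forall t', Rabs (t' - t) < d -> U (segment z w t').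
Proof.
  intros HU Ht. destruct (HU _ Ht) as [r [Hr H]]. assert (P := Cmod_ge_0 (w - z)).
  exists (r / (Cmod (w - z) + 1)). split; [apply Rdiv_lt_0_compat; lra|].
  intros t' Ht'. apply H. rewrite segment_dist.
  apply Rle_lt_trans with (Rabs (t' - t) * (Cmod (w - z) + 1)).
  - apply Rmult_le_compat_l; [apply Rabs_pos|lra].
  - apply Rmult_lt_compat_r with (r := Cmod (w - z) + 1) in Ht'; [|lra].
    replace (r / (Cmod (w - z) + 1) * (Cmod (w - z) + 1)) with r in Ht' by (field; lra). exact Ht'.
Qed.

(** By compactness there is a [d] such that membership in [U] persists under parameter steps shorter
    than [d]. Finitely many such steps lead from a point in [U] to a point in [V], against
    disjointness. *)
Lemma segment_connected (z w : C) : Cconnected (fun u => exists t, 0 <= t <= 1 /\ u = segment z w t).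
Proof.
  intros [U [V [HU [HV [Hcov [[u [[a [Ha ->]] Hu]] [[v [[b [Hb ->]] Hv]] Hdis]]]]]]].
  destruct (interval_uniform 0 1 (fun d t => forall t', 0 <= t' <= 1 -> Rabs (t' - t) < d ->
    U (segment z w t) -> U (segment z w t'))) as [d [Hd H]].
  - lra.
  - intros d d' t Hd' Hdd H t' Ht' Htt. apply H; [exact Ht'|lra].
  - intros t Ht. destruct (Hcov (segment z w t)) as [HUt|HVt]; [now exists t| |].
    + destruct (Copen_segment_pullback U z w t HU HUt) as [d [Hd H]].
      exists (d / 2). split; [lra|]. intros t1 Ht1 Htt t2 Ht2 Htt2 _. apply H.
      apply Rabs_def2 in Htt, Htt2. apply Rabs_def1; lra.
    + destruct (Copen_segment_pullback V z w t HV HVt) as [d [Hd H]].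
      exists d. split; [exact Hd|]. intros t1 Ht1 Htt t2 _ _ HU1. exfalso.
      apply (Hdis (segment z w t1)); [now exists t1|exact HU1|now apply H].
  - assert (K : forall n t t', 0 <= t <= 1 -> 0 <= t' <= 1 -> Rabs (t' - t) < INR n * d ->
      U (segment z w t) -> U (segment z w t')).
    { induction n as [|n IH]; intros t t' Ht Ht' Htt HUt.
      - simpl in Htt. rewrite Rmult_0_l in Htt. assert (P := Rabs_pos (t' - t)). lra.
      - rewrite S_INR in Htt. assert (Pn := pos_INR n).
        (* The way is cut into n + 1 equal steps: the induction hypothesis covers the fraction [q],
           and [H] the last step. *)
        set (q := INR n / (INR n + 1)).
        assert (Hq : 0 <= q <= 1).
        { split; [apply Rdiv_le_0_compat; lra|].
          apply Rmult_le_reg_r with (INR n + 1); [lra|]. unfold q.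
          replace (INR n / (INR n + 1) * (INR n + 1)) with (INR n) by (field; lra). lra. }
        set (t2 := t + q * (t' - t)).
        assert (Ht2 : 0 <= t2 <= 1) by (unfold t2; nra).
        assert (HU2 : U (segment z w t2)).
        (* For [n = 0] the point [t2] is [t] itself; the induction hypothesis would demand a
           distance less than 0. *)
        { destruct n as [|n].
          - replace t2 with t; [exact HUt|]. unfold t2, q. simpl. field.
          - apply IH with t; try assumption. unfold t2.
            replace (t + q * (t' - t) - t) with (q * (t' - t)) by ring.
            rewrite Rabs_mult, (Rabs_right q) by lra.
            apply Rmult_lt_compat_l with (r := q) in Htt.
            + replace (q * ((INR (S n) + 1) * d)) with (INR (S n) * d) in Htt
                by (unfold q; field; lra). exact Htt.
            + apply Rdiv_lt_0_compat; [apply lt_0_INR; lia|lra]. }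
        apply (H t2 Ht2 t' Ht'); [|exact HU2]. unfold t2.
        replace (t' - (t + q * (t' - t))) with (/ (INR n + 1) * (t' - t)) by (unfold q; field; lra).
        rewrite Rabs_mult, (Rabs_right (/ (INR n + 1)))
          by (apply Rle_ge, Rlt_le, Rinv_0_lt_compat; lra).
        apply Rmult_lt_reg_l with (INR n + 1); [lra|].
        rewrite <- Rmult_assoc, Rinv_r, Rmult_1_l by lra. exact Htt. }
    destruct (INR_unbounded (2 / d)) as [n Hn].
    apply (Hdis (segment z w b)); [now exists b| |exact Hv].
    apply (K n a b); try assumption.
    apply Rlt_le_trans with 2; [apply Rabs_def1; lra|].
    apply Rmult_gt_compat_r with (r := d) in Hn; [|exact Hd].
    replace (2 / d * d) with 2 in Hn by (field; lra). lra.
Qed.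

Lemma in_component_sym (X : C -> Prop) (z w : C) : in_component X z w -> in_component X w z.
Proof. intros [S [H1 [H2 [H3 H4]]]]. now exists S. Qed.

Lemma Cconnected_union (S T : C -> Prop) (b : C) :
  Cconnected S -> Cconnected T -> S b -> T b -> Cconnected (fun u => S u \/ T u).
Proof.
  assert (K : forall (A U V : C -> Prop), Cconnected A -> A b -> Copen U -> Copen V ->
    (forall z, A z -> U z \/ V z) -> (forall z, A z -> U z -> V z -> False) -> U b ->
    forall z, A z -> V z -> False).
  { intros A U V HA Hb HU HV Hc Hd HUb z Hz HVz. apply HA. exists U, V.
    split; [exact HU|]. split; [exact HV|]. split; [exact Hc|].
    split; [now exists b|]. split; [now exists z|exact Hd]. }
  intros HS HT Sb Tb [U [V [HU [HV [Hcov [[u [Hu HUu]] [[v [Hv HVv]] Hdis]]]]]]].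
  assert (Hcov' : forall z, S z \/ T z -> V z \/ U z) by (intros z Hz; destruct (Hcov z Hz); auto).
  assert (Hdis' : forall z, S z \/ T z -> V z -> U z -> False) by (intros z Hz A B; exact (Hdis z Hz B A)).
  destruct (Hcov b (or_introl Sb)) as [HUb|HVb].
  - destruct Hv as [Hv|Hv].
    + exact (K S U V HS Sb HU HV (fun z Hz => Hcov z (or_introl Hz))
        (fun z Hz => Hdis z (or_introl Hz)) HUb v Hv HVv).
    + exact (K T U V HT Tb HU HV (fun z Hz => Hcov z (or_intror Hz))
        (fun z Hz => Hdis z (or_intror Hz)) HUb v Hv HVv).
  - destruct Hu as [Hu|Hu].
    + exact (K S V U HS Sb HV HU (fun z Hz => Hcov' z (or_introl Hz))
        (fun z Hz => Hdis' z (or_introl Hz)) HVb u Hu HUu).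
    + exact (K T V U HT Tb HV HU (fun z Hz => Hcov' z (or_intror Hz))
        (fun z Hz => Hdis' z (or_intror Hz)) HVb u Hu HUu).
Qed.

Lemma in_component_trans (X : C -> Prop) (a b c : C) :
  in_component X a b -> in_component X b c -> in_component X a c.
Proof.
  intros [S [S1 [S2 [S3 S4]]]] [T [T1 [T2 [T3 T4]]]].
  exists (fun u => S u \/ T u). repeat split; auto.
  - now apply Cconnected_union with b.
  - intros u [H|H]; auto.
Qed.

Lemma in_component_segment (X : C -> Prop) (z w : C) :
  (forall t, 0 <= t <= 1 -> X (segment z w t)) -> in_component X z w.
Proof.
  intros H. exists (fun u => exists t, 0 <= t <= 1 /\ u = segment z w t). repeat split.
  - apply segment_connected.
  - intros u [t [Ht ->]]. now apply H.
  - exists 0. split; [lra|]. unfold segment. ring.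
  - exists 1. split; [lra|]. unfold segment. ring.
Qed.

(** A point off the curve has positive distance from it, by compactness of the parameter
    interval. *)
Lemma curve_complement_open (g : R -> C) : jordan_curve g -> Copen (fun z => ~ curve_image g z).
Proof.
  intros [Hg _] v Hv.
  destruct (interval_uniform 0 1 (fun d t => d <= Cmod (g t - v))) as [d [Hd H]].
  - lra.
  - intros d d' t Hd' Hdd H. lra.
  - intros t Ht.
    assert (P : 0 < Cmod (g t - v)) by (apply Cmod_minus_pos; intros E; apply Hv; now exists t).
    destruct (Hg t Ht (Cmod (g t - v) / 2)) as [d [Hd H]]; [lra|].
    exists (Rmin d (Cmod (g t - v) / 2)). split; [apply Rmin_glb_lt; lra|].
    intros t' Ht' Htt. assert (A := H t' Ht' (Rlt_le_trans _ _ _ Htt (Rmin_l _ _))).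
    assert (B := Cmod_minus_triangle (g t) (g t') v). rewrite (Cmod_minus_sym (g t) (g t')) in B.
    assert (D := Rmin_r d (Cmod (g t - v) / 2)). lra.
  - exists d. split; [exact Hd|]. intros w Hw [t [Ht E]].
    assert (A := H t Ht). rewrite E in A. lra.
Qed.

Lemma curve_bounded (g : R -> C) :
  jordan_curve g -> exists B, 0 < B /\ forall z, curve_image g z -> Cmod z <= B.
Proof.
  intros [Hg _].
  destruct (interval_uniform 0 1 (fun d t => Cmod (g t) <= / d)) as [d [Hd H]].
  - lra.
  - intros d d' t Hd' Hdd H. eapply Rle_trans; [exact H|]. now apply Rinv_le_contravar.
  - intros t Ht. assert (P := Cmod_ge_0 (g t)).
    destruct (Hg t Ht 1) as [d [Hd H]]; [lra|].
    assert (Pm : 0 < Rmin d (/ (Cmod (g t) + 1)))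
      by (apply Rmin_glb_lt; [exact Hd|apply Rinv_0_lt_compat; lra]).
    exists (Rmin d (/ (Cmod (g t) + 1))). split; [exact Pm|].
    intros t' Ht' Htt. assert (A := H t' Ht' (Rlt_le_trans _ _ _ Htt (Rmin_l _ _))).
    assert (B := Cmod_minus_ge (g t') (g t)).
    apply Rle_trans with (Cmod (g t) + 1); [lra|].
    rewrite <- (Rinv_inv (Cmod (g t) + 1)) at 1.
    apply Rinv_le_contravar; [exact Pm|apply Rmin_r].
  - exists (/ d). split; [now apply Rinv_0_lt_compat|]. intros z [t [Ht <-]]. now apply H.
Qed.

Lemma component_open (X K : C -> Prop) : Copen X -> unbounded_component X K -> Copen K.
Proof.
  intros HX [z0 [Hz0 [HK _]]] v Hv. apply HK in Hv.
  assert (Xv : X v) by (destruct Hv as [S [_ [H [_ H']]]]; now apply H).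
  destruct (HX v Xv) as [r [Hr H]]. exists r. split; [exact Hr|]. intros w Hw.
  apply HK. apply in_component_trans with v; [exact Hv|].
  apply in_component_segment. intros t Ht. apply H.
  replace v with (segment v w 0) at 2 by (unfold segment; ring).
  rewrite segment_dist, Rminus_0_r, Rabs_right by lra.
  assert (P := Cmod_ge_0 (w - v)). nra.
Qed.

Lemma convex_gt (B x y t : R) : B < x -> B < y -> 0 <= t <= 1 -> B < x + t * (y - x).
Proof.
  intros Hx Hy Ht. destruct (Rle_dec x y).
  - assert (0 <= t * (y - x)) by (apply Rmult_le_pos; lra). lra.
  - assert (0 <= (1 - t) * (x - y)) by (apply Rmult_le_pos; lra). lra.
Qed.

Lemma Re_segment (z w : C) (t : R) : Re (segment z w t) = Re z + t * (Re w - Re z).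
Proof. unfold segment, Re. simpl. ring. Qed.

Lemma Im_segment (z w : C) (t : R) : Im (segment z w t) = Im z + t * (Im w - Im z).
Proof. unfold segment, Im. simpl. ring. Qed.

(* The complement of a square is the union of four half-planes, consecutive ones meeting. *)
Lemma square_exterior_connected (X : C -> Prop) (B : R) (p : C) :
  0 < B -> (forall z, B < Rabs (Re z) \/ B < Rabs (Im z) -> X z) ->
  B < Rabs (Re p) \/ B < Rabs (Im p) -> in_component X p (B + 1, B + 1).
Proof.
  intros HB HX Hp.
  assert (R1 : forall z w, B < Re z -> B < Re w -> in_component X z w).
  { intros z w H1 H2. apply in_component_segment. intros t Ht. apply HX. left.
    rewrite Re_segment. assert (A := convex_gt B (Re z) (Re w) t H1 H2 Ht).
    rewrite Rabs_right; lra. }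
  assert (R2 : forall z w, Re z < - B -> Re w < - B -> in_component X z w).
  { intros z w H1 H2. apply in_component_segment. intros t Ht. apply HX. left.
    rewrite Re_segment. assert (A := convex_gt B (- Re z) (- Re w) t ltac:(lra) ltac:(lra) Ht).
    rewrite Rabs_left; lra. }
  assert (I1 : forall z w, B < Im z -> B < Im w -> in_component X z w).
  { intros z w H1 H2. apply in_component_segment. intros t Ht. apply HX. right.
    rewrite Im_segment. assert (A := convex_gt B (Im z) (Im w) t H1 H2 Ht).
    rewrite Rabs_right; lra. }
  assert (I2 : forall z w, Im z < - B -> Im w < - B -> in_component X z w).
  { intros z w H1 H2. apply in_component_segment. intros t Ht. apply HX. right.
    rewrite Im_segment. assert (A := convex_gt B (- Im z) (- Im w) t ltac:(lra) ltac:(lra) Ht).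
    rewrite Rabs_left; lra. }
  destruct Hp as [Hp|Hp]; unfold Rabs in Hp; destruct Rcase_abs as [Hs|Hs].
  - apply in_component_trans with (- B - 1, B + 1); [apply R2|apply I1]; simpl; lra.
  - apply R1; simpl; lra.
  - apply in_component_trans with (B + 1, - B - 1); [apply I2|apply R1]; simpl; lra.
  - apply I1; simpl; lra.
Qed.

(** The curve lies in a square of half-side [B]. Being unbounded, [K] has a point outside it, and
    then contains the whole connected exterior. The radius [2 * B] suffices since |z| <= |Re z| +
    |Im z|. *)
Lemma unbounded_component_exterior (g : R -> C) (K : C -> Prop) :
  jordan_curve g -> unbounded_component (fun z => ~ curve_image g z) K ->
  exists M, 0 < M /\ forall w, M < Cmod w -> K w.
Proof.
  intros Hg [z0 [Hz0 [HK Hunb]]].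
  destruct (curve_bounded g Hg) as [B [HB H]].
  assert (HX : forall z, B < Rabs (Re z) \/ B < Rabs (Im z) -> ~ curve_image g z).
  { intros z Hz Hc. assert (A := H z Hc).
    assert (A1 := Rabs_Re_le z). assert (A2 := Rabs_Im_le z). lra. }
  assert (Hout : forall z, 2 * B < Cmod z -> B < Rabs (Re z) \/ B < Rabs (Im z)).
  { intros z Hz. assert (A := Cmod_le_abs z).
    destruct (Rlt_le_dec B (Rabs (Re z))); [now left|right; lra]. }
  assert (Hp : exists p, K p /\ 2 * B < Cmod p).
  { apply NNPP. intros Hn. apply Hunb. exists (2 * B). intros z Hz.
    apply Rnot_lt_le. intros Hlt. apply Hn. now exists z. }
  destruct Hp as [p [Kp Hp]]. exists (2 * B). split; [lra|]. intros w Hw.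
  apply HK. apply HK in Kp.
  apply in_component_trans with p; [exact Kp|].
  apply in_component_trans with (B + 1, B + 1).
  - apply square_exterior_connected; auto.
  - apply in_component_sym. apply square_exterior_connected; auto.
Qed.

(** * Transport between the disc and the exterior domain *)

(** The value 0 at ∞ is a mere default: this map is used near points where [phi] is finite. *)
Definition finite_part (p : option C) : C := match p with Some u => u | None => 0 end.
(** The chart 1/w, with its true value 0 at ∞; the default occurs at [Some 0], which the uses avoid.
    Its inverse is [of_inverse_chart]. *)
Definition inverse_chart (p : option C) : C := match p with Some u => (/ u)%C | None => 0 end.
Definition of_inverse_chart (w : C) : option C :=
  if excluded_middle_informative (w = 0) then None else Some (/ w)%C.

Lemma of_inverse_chart_0 : of_inverse_chart 0 = None.
Proof. unfold of_inverse_chart. now destruct excluded_middle_informative. Qed.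

Lemma of_inverse_chart_neq (w : C) : w <> 0 -> of_inverse_chart w = Some (/ w)%C.
Proof. intros H. unfold of_inverse_chart. now destruct excluded_middle_informative. Qed.

Lemma inverse_chartK (w : C) : inverse_chart (of_inverse_chart w) = w.
Proof.
  unfold of_inverse_chart. destruct excluded_middle_informative as [->|H]; [reflexivity|].
  simpl. field. exact H.
Qed.

Lemma of_inverse_chartK (u : C) : u <> 0 -> of_inverse_chart (/ u) = Some u.
Proof.
  intros H. rewrite of_inverse_chart_neq.
  - f_equal. field. exact H.
  - intros E. apply C1_nz. rewrite <- (Cinv_r u H), E. ring.
Qed.

Section Transport.

Variables (Om : C -> Prop) (phi : C -> option C).
Hypothesis Hphi : riemann_map Om phi.
Hypothesis HOm : Copen Om.
Hypothesis Hext : exists M, 0 < M /\ forall w, M < Cmod w -> Om w.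

(** The inverse of [phi] on the closure of the domain; at other points the value is unspecified. *)
Definition psi (p : option C) : C := epsilon (inhabits (RtoC 0)) (fun z => Cmod z <= 1 /\ phi z = p).

Lemma Om_ext_closure (p : option C) : Om_ext Om p -> closure_ext Om p.
Proof.
  destruct p as [v|]; [|trivial]. intros Hv eps Heps. exists v. split; [exact Hv|].
  now rewrite Cmod_minus_refl.
Qed.

Lemma phi_closure (z : C) : Cmod z <= 1 -> closure_ext Om (phi z).
Proof. apply Hphi. Qed.

Lemma phi_inj (z w : C) : Cmod z <= 1 -> Cmod w <= 1 -> phi z = phi w -> z = w.
Proof. apply Hphi. Qed.

Lemma phi_cont (z : C) : Cmod z <= 1 -> forall N, ext_nbhd (phi z) N ->
  exists d, 0 < d /\ forall w, Cmod w <= 1 -> Cmod (w - z) < d -> N (phi w).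
Proof. apply Hphi. Qed.

Lemma phi_holo (z : C) : Cmod z < 1 -> ext_holo_at phi z.
Proof. apply Hphi. Qed.

Lemma psi_spec (p : option C) : closure_ext Om p -> Cmod (psi p) <= 1 /\ phi (psi p) = p.
Proof.
  intros Hp. unfold psi. apply epsilon_spec.
  destruct Hphi as [_ [_ [Hsurj _]]]. now apply Hsurj.
Qed.

Lemma psi_phi (z : C) : Cmod z <= 1 -> psi (phi z) = z.
Proof.
  intros Hz. destruct (psi_spec (phi z) (phi_closure z Hz)) as [A B]. now apply phi_inj.
Qed.

Lemma psi_interior (p : option C) : Om_ext Om p -> Cmod (psi p) < 1.
Proof.
  intros Hp. destruct Hphi as [_ [_ [_ [_ [_ [_ [Hsurj _]]]]]]].
  destruct (Hsurj p Hp) as [z [Hz <-]]. rewrite psi_phi; lra.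
Qed.

Lemma psi_cont (p : option C) : closure_ext Om p -> forall eps, 0 < eps ->
  exists N, ext_nbhd p N /\ forall q, closure_ext Om q -> N q -> Cmod (psi q - psi p) < eps.
Proof.
  intros Hp eps Heps. destruct (psi_spec p Hp) as [A B].
  destruct Hphi as [_ [_ [_ [_ [Hinv _]]]]].
  destruct (Hinv (psi p) A eps Heps) as [N [HN H]]. rewrite B in HN.
  exists N. split; [exact HN|]. intros q Hq Nq. destruct (psi_spec q Hq) as [A' B'].
  apply H; [exact A'|]. now rewrite B'.
Qed.

Lemma phi_near_finite (z v : C) : Cmod z < 1 -> phi z = Some v ->
  exists d, 0 < d /\ forall w, Cmod (w - z) < d -> exists u, phi w = Some u.
Proof.
  intros Hz E. assert (H := phi_holo z Hz). unfold ext_holo_at in H. rewrite E in H.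
  destruct H as [l H]. destruct (H 1) as [d [Hd Hw]]; [lra|].
  exists d. split; [exact Hd|]. intros w Hwz.
  destruct (classic (w = z)) as [->|Hn]; [now exists v|].
  destruct (Hw w) as [u [Hu _]]; [split; [now apply Cmod_minus_pos|exact Hwz]|]. now exists u.
Qed.

(** Near [z] the value 0 is excluded by continuity, and a second occurrence of ∞ by injectivity. *)
Lemma phi_near_infinity (z : C) : Cmod z < 1 -> phi z = None ->
  exists d, 0 < d /\ forall w, Cmod (w - z) < d -> w <> z ->
    exists u, phi w = Some u /\ u <> 0.
Proof.
  intros Hz E.
  destruct (phi_cont z ltac:(lra) (fun p => p <> Some (RtoC 0))) as [d [Hd H]].
  - rewrite E. split; [discriminate|]. exists 0. intros w Hw E'. injection E' as ->.
    rewrite Cmod_0 in Hw. lra.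
  - exists (Rmin d (1 - Cmod z)). split; [apply Rmin_glb_lt; lra|]. intros w Hw Hn.
    assert (Hw1 := Rlt_le_trans _ _ _ Hw (Rmin_l _ _)).
    assert (Hw2 := Rlt_le_trans _ _ _ Hw (Rmin_r _ _)).
    assert (Hwm : Cmod w <= 1) by (assert (A := Cmod_minus_ge w z); lra).
    assert (B := H w Hwm Hw1).
    destruct (phi w) as [u|] eqn:Eu.
    + exists u. split; [reflexivity|]. intros ->. now apply B.
    + exfalso. apply Hn, phi_inj; [exact Hwm|lra|]. now rewrite Eu, E.
Qed.

Lemma finite_part_Cdiffable (z v : C) : Cmod z < 1 -> phi z = Some v ->
  Cdiffable (fun w => finite_part (phi w)) z.
Proof.
  intros Hz E. assert (H := phi_holo z Hz). unfold ext_holo_at in H. rewrite E in H.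
  destruct H as [l H]. exists l. apply Cdiff_Cderiv_at. intros eps Heps.
  destruct (H eps Heps) as [d [Hd Hw]]. exists d. split; [exact Hd|]. intros w Hwz.
  destruct (Hw w Hwz) as [u [Hu Hq]]. rewrite Hu, E. exact Hq.
Qed.

Lemma inverse_chart_Cdiffable_infinity (z : C) : Cmod z < 1 -> phi z = None ->
  Cdiffable (fun w => inverse_chart (phi w)) z.
Proof.
  intros Hz E. assert (H := phi_holo z Hz). unfold ext_holo_at in H. rewrite E in H.
  destruct H as [l H]. exists l. apply Cdiff_Cderiv_at. intros eps Heps.
  destruct (H eps Heps) as [d [Hd Hw]]. exists d. split; [exact Hd|]. intros w Hwz.
  destruct (Hw w Hwz) as [u [Hu Hq]]. rewrite Hu, E. exact Hq.
Qed.

Lemma inverse_chart_Cdiffable (z v : C) : Cmod z < 1 -> phi z = Some v -> v <> 0 ->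
  Cdiffable (fun w => inverse_chart (phi w)) z.
Proof.
  intros Hz E Hv.
  destruct (phi_near_finite z v Hz E) as [d [Hd H]].
  apply Cdiffable_ext_loc with (fun w => / finite_part (phi w))%C d; [exact Hd| |].
  - intros w Hw. destruct (H w Hw) as [u ->]. reflexivity.
  - apply Cdiffable_inv; [now apply finite_part_Cdiffable with v|]. now rewrite E.
Qed.

Lemma psi_Some_Ccont (v : C) : Om v -> Ccont (fun w => psi (Some w)) v.
Proof.
  intros Hv eps Heps.
  destruct (psi_cont (Some v) (Om_ext_closure (Some v) Hv) eps Heps) as [N [[r [Hr HN]] H]].
  destruct (HOm v Hv) as [r' [Hr' HO]].
  exists (Rmin r r'). split; [now apply Rmin_glb_lt|]. intros w Hw.
  apply H.
  - apply (Om_ext_closure (Some w)). apply HO. exact (Rlt_le_trans _ _ _ Hw (Rmin_r _ _)).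
  - apply HN. exact (Rlt_le_trans _ _ _ Hw (Rmin_l _ _)).
Qed.

Lemma psi_Some_Cdiffable (v : C) : Om v -> Cdiffable (fun w => psi (Some w)) v.
Proof.
  intros Hv.
  assert (Hz := psi_interior (Some v) Hv).
  destruct (psi_spec (Some v) (Om_ext_closure (Some v) Hv)) as [_ E].
  destruct (phi_near_finite _ v Hz E) as [d [Hd H]].
  set (r := Rmin d (1 - Cmod (psi (Some v)))).
  assert (Hr : 0 < r) by (apply Rmin_glb_lt; lra).
  destruct (psi_Some_Ccont v Hv r Hr) as [rho1 [Hrho1 H1]].
  destruct (HOm v Hv) as [rho2 [Hrho2 H2]].
  apply continuous_right_inverse with (fun z => finite_part (phi z)) (psi (Some v)) r (Rmin rho1 rho2).
  - exact Hr.
  - now apply Rmin_glb_lt.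
  - intros z Hzz. destruct (H z (Rlt_le_trans _ _ _ Hzz (Rmin_l _ _))) as [u Hu].
    apply finite_part_Cdiffable with u; [|exact Hu].
    assert (A := Rlt_le_trans _ _ _ Hzz (Rmin_r _ _)).
    assert (B := Cmod_minus_ge z (psi (Some v))). lra.
  - intros w Hw.
    assert (Ow : Om w) by exact (H2 w (Rlt_le_trans _ _ _ Hw (Rmin_r _ _))).
    repeat split.
    + now apply psi_Some_Ccont.
    + destruct (psi_spec (Some w) (Om_ext_closure (Some w) Ow)) as [_ ->]. reflexivity.
    + exact (H1 w (Rlt_le_trans _ _ _ Hw (Rmin_l _ _))).
  - reflexivity.
Qed.

Lemma near_infinity_Om : exists r, 0 < r /\ forall w, Cmod w < r -> Om_ext Om (of_inverse_chart w).
Proof.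
  destruct Hext as [M [HM H]]. exists (/ M). split; [now apply Rinv_0_lt_compat|].
  intros w Hw. destruct (classic (w = 0)) as [->|Hn]; [rewrite of_inverse_chart_0; exact I|].
  rewrite of_inverse_chart_neq by exact Hn. apply H. rewrite Cmod_inv by exact Hn.
  apply Cmod_gt_0 in Hn. rewrite <- (Rinv_inv M).
  apply Rinv_lt_contravar; [|exact Hw]. apply Rmult_lt_0_compat; [exact Hn|].
  now apply Rinv_0_lt_compat.
Qed.

Lemma psi_infinity_Ccont (w : C) : Om_ext Om (of_inverse_chart w) ->
  Ccont (fun w => psi (of_inverse_chart w)) w.
Proof.
  intros Hw. destruct (classic (w = 0)) as [->|Hn].
  - intros eps Heps. destruct near_infinity_Om as [r [Hr HO]].
    destruct (psi_cont None I eps Heps) as [N [[HN0 [M HN]] H]].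
    assert (PM := Rabs_pos M).
    exists (Rmin r (/ (Rabs M + 1))). split.
    { apply Rmin_glb_lt; [exact Hr|apply Rinv_0_lt_compat; lra]. }
    intros w Hwr. replace (w - 0)%C with w in Hwr by ring. rewrite of_inverse_chart_0. apply H.
    + apply Om_ext_closure, HO. exact (Rlt_le_trans _ _ _ Hwr (Rmin_l _ _)).
    + destruct (classic (w = 0)) as [->|Hn]; [now rewrite of_inverse_chart_0|].
      rewrite of_inverse_chart_neq by exact Hn. apply HN. rewrite Cmod_inv by exact Hn.
      apply Cmod_gt_0 in Hn. apply Rle_lt_trans with (Rabs M); [apply Rle_abs|].
      apply Rlt_trans with (Rabs M + 1); [lra|].
      rewrite <- (Rinv_inv (Rabs M + 1)). apply Rinv_lt_contravar.
      * apply Rmult_lt_0_compat; [exact Hn|apply Rinv_0_lt_compat; lra].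
      * exact (Rlt_le_trans _ _ _ Hwr (Rmin_r _ _)).
  - apply Ccont_ext_loc with (fun w => psi (Some (/ w)%C)) (Cmod w).
    + now apply Cmod_gt_0.
    + intros u Hu. rewrite of_inverse_chart_neq; [reflexivity|]. intros ->.
      replace (0 - w)%C with (- w)%C in Hu by ring. rewrite Cmod_opp in Hu. lra.
    + apply (Ccont_comp (fun w => / w)%C (fun w => psi (Some w))).
      * apply (Ccont_inv (fun w => w)); [apply Ccont_id|exact Hn].
      * apply psi_Some_Ccont. rewrite of_inverse_chart_neq in Hw by exact Hn. exact Hw.
Qed.

(** Read in the chart 1/w, [phi] is differentiable near [psi None], and [psi] is a continuous right
    inverse of it near 0. *)
Lemma psi_infinity_Cdiffable : Cdiffable (fun w => psi (of_inverse_chart w)) 0.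
Proof.
  assert (Hz := psi_interior None I). destruct (psi_spec None I) as [_ E].
  destruct (phi_near_infinity _ Hz E) as [d [Hd H]].
  set (r := Rmin d (1 - Cmod (psi None))).
  assert (Hr : 0 < r) by (apply Rmin_glb_lt; lra).
  destruct near_infinity_Om as [rho2 [Hrho2 H2]].
  assert (O0 : Om_ext Om (of_inverse_chart 0)) by (rewrite of_inverse_chart_0; exact I).
  destruct (psi_infinity_Ccont 0 O0 r Hr) as [rho1 [Hrho1 H1]].
  rewrite of_inverse_chart_0 in H1.
  apply continuous_right_inverse with (fun z => inverse_chart (phi z)) (psi None) r (Rmin rho1 rho2).
  - exact Hr.
  - now apply Rmin_glb_lt.
  - intros z Hzz.
    assert (Hz1 : Cmod z < 1).
    { assert (A := Rlt_le_trans _ _ _ Hzz (Rmin_r _ _)).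
      assert (B := Cmod_minus_ge z (psi None)). lra. }
    destruct (classic (z = psi None)) as [->|Hn]; [now apply inverse_chart_Cdiffable_infinity|].
    destruct (H z (Rlt_le_trans _ _ _ Hzz (Rmin_l _ _)) Hn) as [u [Hu Hu0]].
    now apply inverse_chart_Cdiffable with u.
  - intros w Hw.
    assert (Ow : Om_ext Om (of_inverse_chart w)).
    { apply H2. replace w with (w - 0)%C by ring. exact (Rlt_le_trans _ _ _ Hw (Rmin_r _ _)). }
    repeat split.
    + now apply psi_infinity_Ccont.
    + destruct (psi_spec _ (Om_ext_closure _ Ow)) as [_ ->]. apply inverse_chartK.
    + exact (H1 w (Rlt_le_trans _ _ _ Hw (Rmin_l _ _))).
  - now rewrite of_inverse_chart_0.
Qed.

Lemma disc_algebra_in_A (H : C -> C) :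
  (forall z, Cmod z <= 1 -> forall eps, 0 < eps -> exists d, 0 < d /\
     forall w, Cmod w <= 1 -> Cmod (w - z) < d -> Cmod (H w - H z) < eps) ->
  (forall z, Cmod z < 1 -> Cdiffable H z) ->
  in_A Om (fun p => H (psi p)).
Proof.
  intros Hc Hd. split; [|split].
  - intros p Hp eps Heps. destruct (psi_spec p Hp) as [A _].
    destruct (Hc (psi p) A eps Heps) as [d [Pd Hd']].
    destruct (psi_cont p Hp d Pd) as [N [HN K]]. exists N. split; [exact HN|].
    intros q Hq Nq. apply Hd'; [now apply psi_spec|now apply K].
  - intros v Hv.
    destruct (Cdiffable_comp (fun w => psi (Some w)) H v) as [l Hl].
    + now apply psi_Some_Cdiffable.
    + apply Hd. now apply psi_interior.
    + exists l. now apply Cdiff_Cderiv_at.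
  - destruct (Cdiffable_comp (fun w => psi (of_inverse_chart w)) H 0) as [l Hl].
    + apply psi_infinity_Cdiffable.
    + rewrite of_inverse_chart_0. apply Hd. now apply psi_interior.
    + exists l. apply Cdiff_Cderiv_at in Hl. intros eps Heps.
      destruct (Hl eps Heps) as [d [Pd K]]. exists d. split; [exact Pd|]. intros w Hw.
      assert (Hn : w <> 0) by (apply Cmod_gt_0; lra).
      assert (A := K w). rewrite of_inverse_chart_0, of_inverse_chart_neq in A by exact Hn.
      apply A. replace (w - 0)%C with w by ring. exact Hw.
Qed.

Lemma in_A_disc_cont (F : option C -> C) : in_A Om F ->
  forall z, Cmod z <= 1 -> forall eps, 0 < eps -> exists d, 0 < d /\
     forall w, Cmod w <= 1 -> Cmod (w - z) < d -> Cmod (F (phi w) - F (phi z)) < eps.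
Proof.
  intros [Hc _] z Hz eps Heps.
  destruct (Hc (phi z) (phi_closure z Hz) eps Heps) as [N [HN H]].
  destruct (phi_cont z Hz N HN) as [d [Hd K]]. exists d. split; [exact Hd|].
  intros w Hw Hwz. apply H; [now apply phi_closure|now apply K].
Qed.

(** The chain rule through the affine chart where [phi] is finite, and through the chart 1/w at the
    point that [phi] sends to ∞. *)
Lemma in_A_disc_Cdiffable (F : option C -> C) : in_A Om F ->
  forall z, Cmod z < 1 -> Cdiffable (fun w => F (phi w)) z.
Proof.
  intros [_ [Hd Hinf]] z Hz. destruct (phi z) as [v|] eqn:E.
  - assert (Ov : Om v).
    { destruct Hphi as [_ [_ [_ [_ [_ [Hint _]]]]]]. assert (A := Hint z Hz).
      rewrite E in A. exact A. }
    destruct (phi_near_finite z v Hz E) as [d [Pd H]].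
    apply Cdiffable_ext_loc with (fun w => F (Some (finite_part (phi w)))) d; [exact Pd| |].
    + intros w Hw. destruct (H w Hw) as [u ->]. reflexivity.
    + apply (Cdiffable_comp (fun w => finite_part (phi w)) (fun w => F (Some w))).
      * now apply finite_part_Cdiffable with v.
      * rewrite E. destruct (Hd v Ov) as [l Hl]. exists l. now apply Cdiff_Cderiv_at.
  - destruct (phi_near_infinity z Hz E) as [d [Pd H]].
    apply Cdiffable_ext_loc with (fun w => F (of_inverse_chart (inverse_chart (phi w)))) d; [exact Pd| |].
    + intros w Hw. destruct (classic (w = z)) as [->|Hn].
      * rewrite E. simpl. now rewrite of_inverse_chart_0.
      * destruct (H w Hw Hn) as [u [-> Hu]]. simpl. now rewrite of_inverse_chartK.
    + apply (Cdiffable_comp (fun w => inverse_chart (phi w)) (fun w => F (of_inverse_chart w))).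
      * now apply inverse_chart_Cdiffable_infinity.
      * rewrite E. simpl. destruct Hinf as [l Hl]. exists l. apply Cdiff_Cderiv_at.
        intros eps Heps. destruct (Hl eps Heps) as [d' [Pd' K]]. exists d'. split; [exact Pd'|].
        intros w Hw. replace (Cmod (w - 0)) with (Cmod w) in Hw by (f_equal; ring).
        assert (Hn : w <> 0) by (apply Cmod_gt_0; lra).
        rewrite of_inverse_chart_0, of_inverse_chart_neq by exact Hn. now apply K.
Qed.

End Transport.

(** * Boundary roughness *)

Lemma expi_circ (y : R) : expi y = circ 1 y.
Proof. unfold expi, circ. f_equal; ring. Qed.

Lemma Cmod_expi (y : R) : Cmod (expi y) = 1.
Proof. rewrite expi_circ. apply Cmod_circ. lra. Qed.

Lemma expi_dist (y t : R) : Cmod (expi y - expi t) <= 2 * Rabs (y - t).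
Proof.
  rewrite !expi_circ. eapply Rle_trans; [apply circ_dist; lra|].
  rewrite Rminus_diag, Rabs_R0. lra.
Qed.

(** [cos_period] and [sin_period] speak of natural multiples, so [theta] is first raised by [S m]
    periods to be nonnegative and then lowered by [k] periods. *)
Lemma expi_reduce (theta : R) : exists t0 a, 0 <= t0 <= 2 * PI /\ theta = t0 + a /\
  forall y, expi (y + a) = expi y.
Proof.
  assert (HP := PI_RGT_0).
  assert (P : forall y k, expi (y + 2 * INR k * PI) = expi y)
    by (intros y k; unfold expi; now rewrite cos_period, sin_period).
  destruct (nfloor_ex (Rabs theta / (2 * PI))) as [m [_ Hm]].
  { apply Rdiv_le_0_compat; [apply Rabs_pos|lra]. }
  assert (Hm' : 0 <= theta + 2 * INR (S m) * PI).
  { rewrite S_INR. apply Rmult_lt_compat_r with (r := 2 * PI) in Hm; [|lra].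
    replace (Rabs theta / (2 * PI) * (2 * PI)) with (Rabs theta) in Hm by (field; lra).
    assert (A := Rle_abs (- theta)). rewrite Rabs_Ropp in A. lra. }
  destruct (nfloor_ex ((theta + 2 * INR (S m) * PI) / (2 * PI))) as [k [Hk1 Hk2]].
  { apply Rdiv_le_0_compat; lra. }
  set (x := theta + 2 * INR (S m) * PI) in *.
  apply Rmult_le_compat_r with (r := 2 * PI) in Hk1; [|lra].
  apply Rmult_lt_compat_r with (r := 2 * PI) in Hk2; [|lra].
  replace (x / (2 * PI) * (2 * PI)) with x in Hk1, Hk2 by (field; lra).
  exists (x - 2 * INR k * PI), (2 * INR k * PI - 2 * INR (S m) * PI).
  split; [lra|]. split; [unfold x; ring|]. intros y.
  rewrite <- (P (y + (2 * INR k * PI - 2 * INR (S m) * PI)) (S m)).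
  rewrite <- (P y k). f_equal. ring.
Qed.

(** One threshold and one distance. The quotient clauses of [in_Z] ask for this at every [theta],
    for all [K] and all positive [d]. *)
Definition rough_at (a : R -> R) (K d theta : R) : Prop :=
  exists y, theta < y < theta + d /\ K < Rabs ((a y - a theta) / (y - theta)).

Lemma quotient_lt (K x h : R) : 0 < h -> (K < Rabs (x / h) <-> K * h < Rabs x).
Proof.
  intros Hh. unfold Rdiv. rewrite Rabs_mult, (Rabs_right (/ h))
    by (apply Rle_ge, Rlt_le, Rinv_0_lt_compat, Hh).
  split; intros H.
  - apply Rmult_lt_compat_r with (r := h) in H; [|exact Hh].
    rewrite Rmult_assoc, Rinv_l, Rmult_1_r in H by lra. exact H.
  - apply Rmult_lt_reg_r with h; [exact Hh|].
    rewrite Rmult_assoc, Rinv_l, Rmult_1_r by lra. exact H.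
Qed.

(** A witness [y] at [t] still works at nearby points with some margin. By compactness the margin
    can be taken to be [2 * e] throughout, and a perturbation smaller than [e] alters each increment
    by less than that. *)
Lemma rough_at_stable (a : R -> R) (K d : R) :
  0 <= K -> continuity a -> (forall theta, 0 <= theta <= 2 * PI -> rough_at a K d theta) ->
  exists e, 0 < e /\ forall b, (forall y, Rabs (a y - b y) < e) ->
    forall theta, 0 <= theta <= 2 * PI -> rough_at b K d theta.
Proof.
  intros HK Ha H.
  destruct (interval_uniform 0 (2 * PI) (fun e t => exists y, t < y < t + d /\
    K * (y - t) + 2 * e < Rabs (a y - a t))) as [e [He Hu]].
  - apply Rlt_le, two_PI_pos.
  - intros e e' t He' Hee [y [Hy Hq]]. exists y. split; [exact Hy|]. lra.
  - intros t Ht. destruct (H t Ht) as [y [Hy Hq]]. apply quotient_lt in Hq; [|lra].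
    set (m := Rabs (a y - a t) - K * (y - t)). assert (Hm : 0 < m) by (unfold m; lra).
    destruct (Ha t (m / 4)) as [d1 [Hd1 H1]]; [lra|].
    (* In order: [a t'] stays close to [a t]; [y] stays to the right of [t']; [y] stays within [d]
       of [t']; and [K * e + 2 * e] uses up at most a quarter of the excess [m]. *)
    set (e := Rmin (Rmin d1 (y - t)) (Rmin (t + d - y) (m / (8 * (K + 1))))).
    assert (He : 0 < e).
    { repeat apply Rmin_glb_lt; try lra. apply Rdiv_lt_0_compat; lra. }
    assert (E1 : e <= d1) by (eapply Rle_trans; apply Rmin_l).
    assert (E2 : e <= y - t) by (eapply Rle_trans; [apply Rmin_l|apply Rmin_r]).
    assert (E3 : e <= t + d - y) by (eapply Rle_trans; [apply Rmin_r|apply Rmin_l]).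
    assert (E4 : (K + 1) * e <= m / 8).
    { apply Rle_trans with ((K + 1) * (m / (8 * (K + 1)))).
      - apply Rmult_le_compat_l; [lra|]. eapply Rle_trans; apply Rmin_r.
      - right. field. lra. }
    exists e. split; [exact He|]. intros t' _ Htt. exists y.
    assert (Htt' := Rabs_def2 _ _ Htt). split; [lra|].
    assert (A : Rabs (a t' - a t) < m / 4).
    { destruct (Req_dec t' t) as [->|Hn]; [rewrite Rminus_diag, Rabs_R0; lra|].
      apply H1. split; [split; [exact I|auto]|]. simpl. unfold R_dist. lra. }
    assert (B : Rabs (a y - a t) <= Rabs (a y - a t') + Rabs (a t' - a t)).
    { replace (a y - a t) with ((a y - a t') + (a t' - a t)) by ring. apply Rabs_triang. }
    assert (D : K * (y - t') <= K * (y - t) + K * e).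
    { rewrite <- Rmult_plus_distr_l. apply Rmult_le_compat_l; lra. }
    assert (0 <= K * e) by (apply Rmult_le_pos; lra).
    assert (Em : m = Rabs (a y - a t) - K * (y - t)) by reflexivity. lra.
  - exists e. split; [exact He|]. intros b Hb t Ht.
    destruct (Hu t Ht) as [y [Hy Hq]]. exists y. split; [exact Hy|].
    apply quotient_lt; [lra|].
    assert (A1 := Hb y). assert (A2 := Hb t).
    assert (B : Rabs (a y - a t) <= Rabs (a y - b y) + Rabs (b y - b t) + Rabs (a t - b t)).
    { replace (a y - a t) with ((a y - b y) + (b y - b t) + - (a t - b t)) by ring.
      eapply Rle_trans; [apply Rabs_triang|]. rewrite Rabs_Ropp.
      apply Rplus_le_compat_r, Rabs_triang. }
    lra.
Qed.

(** For large [n] the quotient of [c * w] reaches [c * 64 ^ n / 16], beyond |M| + |L|, within the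
    distance 4 / 1024^n. Both this distance and the required size are governed by the single
    condition 64^-n < m. *)
Lemma rough_perturbation (u w : R -> R) (c L d0 theta : R) :
  0 < c -> 0 < d0 -> (forall y, Rabs (y - theta) < d0 -> Rabs (u y - u theta) <= L * Rabs (y - theta)) ->
  (forall n, exists y, theta < y <= theta + 4 / 1024 ^ n /\
    64 ^ n / 16 * (y - theta) <= Rabs (w y - w theta)) ->
  forall M d, 0 < d -> rough_at (fun y => u y + c * w y) M d theta.
Proof.
  intros Hc Hd0 Hu Hw M d Hd.
  set (T := Rabs M + Rabs L + 1).
  assert (PT : 0 < T) by (assert (A := Rabs_pos M); assert (B := Rabs_pos L); unfold T; lra).
  set (m := Rmin (Rmin d d0 / 8) (c / (16 * T))).
  assert (Hm : 0 < m).
  { apply Rmin_glb_lt; [|apply Rdiv_lt_0_compat; lra].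
    assert (0 < Rmin d d0) by now apply Rmin_glb_lt. lra. }
  destruct (pow_lt_1_zero (/ 64)) with (y := m) as [n Hn]; [rewrite Rabs_right; lra|exact Hm|].
  specialize (Hn n (le_n n)). rewrite Rabs_right in Hn by (apply Rle_ge, pow_le; lra).
  rewrite pow_inv in Hn.
  assert (P64 : 0 < 64 ^ n) by (apply pow_lt; lra).
  assert (P1024 : 64 ^ n <= 1024 ^ n) by (apply pow_incr; lra).
  assert (Hsmall : 4 / 1024 ^ n < Rmin d d0).
  { apply Rle_lt_trans with (4 * / 64 ^ n).
    - apply Rmult_le_compat_l; [lra|]. now apply Rinv_le_contravar.
    - assert (m <= Rmin d d0 / 8) by apply Rmin_l. lra. }
  assert (Hbig : T < c * (64 ^ n / 16)).
  { assert (A : / 64 ^ n < c / (16 * T)) by (eapply Rlt_le_trans; [exact Hn|apply Rmin_r]).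
    apply Rmult_lt_compat_r with (r := 64 ^ n * T) in A; [|now apply Rmult_lt_0_compat].
    replace (/ 64 ^ n * (64 ^ n * T)) with T in A by (field; lra).
    replace (c / (16 * T) * (64 ^ n * T)) with (c * (64 ^ n / 16)) in A by (field; lra). exact A. }
  destruct (Hw n) as [y [Hy Hq]].
  assert (Sd := Rmin_l d d0). assert (Sd0 := Rmin_r d d0).
  exists y. split; [lra|]. apply quotient_lt; [lra|].
  assert (Ay : Rabs (y - theta) = y - theta) by (apply Rabs_right; lra).
  assert (Uy := Hu y ltac:(rewrite Ay; lra)). rewrite Ay in Uy.
  assert (B := Rabs_triang_inv (c * (w y - w theta)) (- (u y - u theta))).
  replace (c * (w y - w theta) - - (u y - u theta)) with (u y + c * w y - (u theta + c * w theta)) in B by ring.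
  rewrite Rabs_Ropp, Rabs_mult, (Rabs_right c) in B by lra.
  assert (Q1 : c * (64 ^ n / 16 * (y - theta)) <= c * Rabs (w y - w theta))
    by (apply Rmult_le_compat_l; lra).
  assert (Q2 : T * (y - theta) < c * (64 ^ n / 16) * (y - theta)) by (apply Rmult_lt_compat_r; lra).
  assert (Q3 : L * (y - theta) <= Rabs L * (y - theta))
    by (apply Rmult_le_compat_r; [lra|apply Rle_abs]).
  assert (Q4 : M * (y - theta) <= Rabs M * (y - theta))
    by (apply Rmult_le_compat_r; [lra|apply Rle_abs]).
  unfold T in Q2. lra.
Qed.

(** [L] and [d] may depend on [theta]; this is enough, since roughness is tested at one point at a
    time. *)
Lemma Cdiffable_circle_Lipschitz (f : C -> C) (r theta : R) :
  0 <= r -> Cdiffable f (r * expi theta)%C ->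
  exists L d, 0 < d /\ forall y, Rabs (y - theta) < d ->
    Cmod (f (r * expi y)%C - f (r * expi theta)%C) <= L * Rabs (y - theta).
Proof.
  intros Hr [l Hl]. destruct (Hl 1) as [d [Hd H]]; [lra|].
  assert (Pl := Cmod_ge_0 l).
  assert (Hdist : forall y, Cmod (r * expi y - r * expi theta) <= 2 * r * Rabs (y - theta)).
  { intros y. replace (r * expi y - r * expi theta)%C with (r * (expi y - expi theta))%C by ring.
    rewrite Cmod_mult, Cmod_R, Rabs_right by lra.
    replace (2 * r * Rabs (y - theta)) with (r * (2 * Rabs (y - theta))) by ring.
    apply Rmult_le_compat_l; [exact Hr|apply expi_dist]. }
  exists ((Cmod l + 1) * (2 * r)), (d / (2 * r + 1)). split; [apply Rdiv_lt_0_compat; lra|].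
  intros y Hy.
  assert (Hy' : Cmod (r * expi y - r * expi theta) < d).
  { eapply Rle_lt_trans; [apply Hdist|].
    apply Rle_lt_trans with ((2 * r + 1) * Rabs (y - theta));
      [assert (A := Rabs_pos (y - theta)); lra|].
    apply Rmult_lt_compat_l with (r := 2 * r + 1) in Hy; [|lra].
    replace ((2 * r + 1) * (d / (2 * r + 1))) with d in Hy by (field; lra). exact Hy. }
  assert (A := H _ Hy'). assert (B := Hdist y).
  set (D := (r * expi y - r * expi theta)%C) in *.
  replace (f (r * expi y)%C - f (r * expi theta)%C)%C
    with ((f (r * expi y)%C - f (r * expi theta)%C - l * D) + l * D)%C by ring.
  eapply Rle_trans; [apply Cmod_triangle|]. rewrite Cmod_mult.
  rewrite Rmult_assoc. apply Rle_trans with ((Cmod l + 1) * Cmod D); [lra|].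
  apply Rmult_le_compat_l; lra.
Qed.

Lemma boundary_continuous (Om : C -> Prop) (phi : C -> option C) (F : option C -> C) :
  riemann_map Om phi -> in_A Om F ->
  forall t eps, 0 < eps -> exists d, 0 < d /\ forall s, Rabs (s - t) < d ->
    Cmod (F (phi (expi s)) - F (phi (expi t))) < eps.
Proof.
  intros Hphi HF t eps Heps.
  destruct (in_A_disc_cont Om phi Hphi F HF (expi t)) with (eps := eps) as [d [Hd H]];
    [rewrite Cmod_expi; lra|exact Heps|].
  exists (d / 2). split; [lra|]. intros s Hs. apply H; [rewrite Cmod_expi; lra|].
  eapply Rle_lt_trans; [apply expi_dist|]. lra.
Qed.

Lemma continuity_of_bound (g : R -> C) (a : R -> R) :
  (forall s t, Rabs (a s - a t) <= Cmod (g s - g t)) ->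
  (forall t eps, 0 < eps -> exists d, 0 < d /\ forall s, Rabs (s - t) < d -> Cmod (g s - g t) < eps) ->
  continuity a.
Proof.
  intros Hag Hg t eps Heps. destruct (Hg t eps Heps) as [d [Hd H]]. exists d. split; [exact Hd|].
  intros s [_ Hs]. simpl. unfold R_dist. eapply Rle_lt_trans; [apply Hag|]. apply H. exact Hs.
Qed.

(** [theta] runs over one closed period, where compactness applies. [S n] keeps the distance
    meaningful at [n = 0]. *)
Definition boundary_rough (phi : C -> option C) (n : nat) (F : option C -> C) : Prop :=
  forall theta, 0 <= theta <= 2 * PI ->
    rough_at (fun y => Re (F (phi (expi y)))) (INR n) (/ INR (S n)) theta /\
    rough_at (fun y => Im (F (phi (expi y)))) (INR n) (/ INR (S n)) theta.

Lemma boundary_rough_open (Om : C -> Prop) (phi : C -> option C) (n : nat) :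
  riemann_map Om phi -> A_open Om (boundary_rough phi n).
Proof.
  intros Hphi F HF HU.
  assert (Hc := boundary_continuous Om phi F Hphi HF).
  destruct (rough_at_stable (fun y => Re (F (phi (expi y)))) (INR n) (/ INR (S n))) as [e1 [He1 H1]].
  { apply pos_INR. }
  { apply (continuity_of_bound (fun y => F (phi (expi y)))); [|exact Hc]. intros s t.
    apply (Rabs_Re_le (F (phi (expi s)) - F (phi (expi t)))). }
  { intros theta Ht. now apply HU. }
  destruct (rough_at_stable (fun y => Im (F (phi (expi y)))) (INR n) (/ INR (S n))) as [e2 [He2 H2]].
  { apply pos_INR. }
  { apply (continuity_of_bound (fun y => F (phi (expi y)))); [|exact Hc]. intros s t.
    apply (Rabs_Im_le (F (phi (expi s)) - F (phi (expi t)))). }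
  { intros theta Ht. now apply HU. }
  exists (Rmin e1 e2). split; [now apply Rmin_glb_lt|]. intros G HG HFG.
  assert (Hclose : forall y, Cmod (F (phi (expi y)) - G (phi (expi y))) < Rmin e1 e2).
  { intros y. apply HFG, (phi_closure Om phi Hphi). rewrite Cmod_expi. lra. }
  intros theta Ht. split.
  - apply H1; [|exact Ht]. intros y. eapply Rle_lt_trans; [|eapply Rlt_le_trans; [apply (Hclose y)|apply Rmin_l]].
    apply (Rabs_Re_le (F (phi (expi y)) - G (phi (expi y)))).
  - apply H2; [|exact Ht]. intros y. eapply Rle_lt_trans; [|eapply Rlt_le_trans; [apply (Hclose y)|apply Rmin_r]].
    apply (Rabs_Im_le (F (phi (expi y)) - G (phi (expi y)))).
Qed.

(** One integer above both [M] and [/ d] takes care of threshold and distance, and a translation by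
    a period carries the witness over to [theta]. *)
Lemma rough_at_of_reduced (a : C -> R) (theta : R) :
  (forall n t, 0 <= t <= 2 * PI -> rough_at (fun y => a (expi y)) (INR n) (/ INR (S n)) t) ->
  forall M d, 0 < d -> rough_at (fun y => a (expi y)) M d theta.
Proof.
  intros H M d Hd.
  destruct (expi_reduce theta) as [t0 [s [Ht0 [-> Hs]]]].
  destruct (INR_unbounded (Rmax M (/ d))) as [n Hn].
  assert (HnM := Rmax_l M (/ d)). assert (Hnd := Rmax_r M (/ d)).
  destruct (H n t0 Ht0) as [y [Hy Hq]].
  assert (Hnd' : / INR (S n) <= d).
  { rewrite <- (Rinv_inv d). apply Rinv_le_contravar; [now apply Rinv_0_lt_compat|].
    rewrite S_INR. lra. }
  exists (y + s). split; [lra|]. rewrite !Hs.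
  replace (y + s - (t0 + s)) with (y - t0) by ring. lra.
Qed.

(** The continuity clause of [in_Z] holds for every member of A, so what remains to be matched is
    the two quotient clauses. *)
Lemma in_Z_iff_boundary_rough (Om : C -> Prop) (phi : C -> option C) (F : option C -> C) :
  riemann_map Om phi -> in_A Om F ->
  (in_Z (fun y => F (phi (expi y))) <-> forall n, boundary_rough phi n F).
Proof.
  intros Hphi HF. split.
  - intros [_ [HR HI]] n theta _.
    assert (P : 0 < / INR (S n)) by (apply Rinv_0_lt_compat, lt_0_INR; lia).
    split; [now apply HR|now apply HI].
  - intros H. split; [now apply boundary_continuous with Om|]. split.
    + intros theta. apply (rough_at_of_reduced (fun z => Re (F (phi z)))).
      intros n t Ht. now apply H.
    + intros theta. apply (rough_at_of_reduced (fun z => Im (F (phi z)))).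
      intros n t Ht. now apply H.
Qed.

(* Dilating makes the boundary values of [F o phi] differentiable at each single point, so a
   small multiple of the lacunary series decides the size of the difference quotients. *)
Lemma rough_boundary_dense (Om : C -> Prop) (phi : C -> option C) :
  riemann_map Om phi -> Copen Om -> (exists M, 0 < M /\ forall w, M < Cmod w -> Om w) ->
  A_dense Om (fun F => in_A Om F /\ in_Z (fun y => F (phi (expi y)))).
Proof.
  intros Hphi HOm Hext F HF eps Heps.
  set (f := fun z => F (phi z)).
  assert (Hc := in_A_disc_cont Om phi Hphi F HF).
  assert (Hd := in_A_disc_Cdiffable Om phi Hphi F HF).
  destruct (disc_uniformly_continuous 1 f ltac:(lra) Hc (eps / 2)) as [d [Pd Hu]]; [lra|].
  (* [q = 1 - r] is the displacement of a boundary point under the dilation: [d / 2] keeps it below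
     the modulus of continuity [d], and [/ 2] keeps [r] nonnegative. *)
  set (q := Rmin (d / 2) (/ 2)).
  assert (Pq : 0 < q) by (apply Rmin_glb_lt; lra).
  assert (Hq1 : q <= d / 2) by apply Rmin_l. assert (Hq2 : q <= / 2) by apply Rmin_r.
  (* As |W| <= 4, the lacunary term costs at most [eps / 4], and the dilation costs less than
     [eps / 2]. *)
  set (r := 1 - q). set (c := eps / 16).
  assert (Pc : 0 < c) by (unfold c; lra).
  assert (Hr : 0 <= r < 1) by (unfold r; lra).
  assert (Hrz : forall z, Cmod (r * z) = r * Cmod z)
    by (intros z; rewrite Cmod_mult, Cmod_R, Rabs_right; lra).
  assert (Hrz1 : forall z, Cmod z <= 1 -> Cmod (r * z) < 1).
  { intros z Hz. rewrite Hrz. assert (P := Cmod_ge_0 z). nra. }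
  set (H := fun z => (f (r * z)%C + c * lacunary z)%C).
  assert (HA : in_A Om (fun p => H (psi phi p))).
  { apply disc_algebra_in_A; try assumption.
    - intros z Hz e He.
      destruct (Hc (r * z)%C ltac:(assert (A := Hrz1 z Hz); lra) (e / 2)) as [d1 [Pd1 H1]]; [lra|].
      destruct (lacunary_cont z Hz (e / (2 * c))) as [d2 [Pd2 H2]]; [apply Rdiv_lt_0_compat; lra|].
      exists (Rmin d1 d2). split; [now apply Rmin_glb_lt|]. intros w Hw Hwz.
      assert (A1 : Cmod (f (r * w)%C - f (r * z)%C) < e / 2).
      { apply H1; [assert (A := Hrz1 w Hw); lra|].
        replace (r * w - r * z)%C with (r * (w - z))%C by ring. rewrite Hrz.
        assert (P := Cmod_ge_0 (w - z)). assert (Hwz1 := Rlt_le_trans _ _ _ Hwz (Rmin_l _ _)). nra. }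
      assert (A2 := H2 w Hw (Rlt_le_trans _ _ _ Hwz (Rmin_r _ _))).
      unfold H. replace (f (r * w)%C + c * lacunary w - (f (r * z)%C + c * lacunary z))%C
        with ((f (r * w)%C - f (r * z)%C) + c * (lacunary w - lacunary z))%C by ring.
      eapply Rle_lt_trans; [apply Cmod_triangle|].
      rewrite (Cmod_mult c), Cmod_R, (Rabs_right c) by lra.
      apply Rmult_lt_compat_l with (r := c) in A2; [|exact Pc].
      replace (c * (e / (2 * c))) with (e / 2) in A2 by (field; lra). lra.
    - intros z Hz. apply Cdiffable_plus.
      + apply (Cdiffable_comp (fun z => r * z)%C f).
        * apply (Cdiffable_mult (fun _ => RtoC r) (fun z => z)); [apply Cdiffable_const|apply Cdiffable_id].
        * apply Hd, Hrz1. lra.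
      + apply (Cdiffable_mult (fun _ => RtoC c) lacunary); [apply Cdiffable_const|].
        now apply lacunary_Cdiffable. }
  exists (fun p => H (psi phi p)). split; [exact HA|]. split; [split; [exact HA|]|].
  - split; [exact (boundary_continuous Om phi _ Hphi HA)|].
    (* Hence the boundary values of the approximant, read through [phi], are those of [H] on the
       unit circle. *)
    assert (Epsi : forall y, psi phi (phi (expi y)) = expi y).
    { intros y. apply (psi_phi Om phi Hphi). rewrite Cmod_expi. lra. }
    assert (HL : forall theta, exists L d0, 0 < d0 /\ forall y, Rabs (y - theta) < d0 ->
       Cmod (f (r * expi y)%C - f (r * expi theta)%C) <= L * Rabs (y - theta)).
    { intros theta. apply Cdiffable_circle_Lipschitz; [lra|]. apply Hd, Hrz1.
      rewrite Cmod_expi. lra. }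
    split; intros theta M e He; destruct (HL theta) as [L [d0 [Pd0 HL0]]].
    + destruct (rough_perturbation (fun y => Re (f (r * expi y)%C)) (weier 0) c L d0 theta Pc Pd0)
        with (M := M) (d := e) as [y [Hy Hq]]; [| |exact He|].
      * intros y Hy. eapply Rle_trans; [|now apply HL0].
        apply (Rabs_Re_le (f (r * expi y)%C - f (r * expi theta)%C)).
      * intros n. apply weier_rough.
      * exists y. split; [exact Hy|]. rewrite !Epsi. unfold H. rewrite !lacunary_expi.
        assert (E : forall (z : C) (x x' : R), Re (z + c * (x, x')) = Re z + c * x)
          by (intros z x x'; unfold Re; simpl; ring).
        rewrite !E. exact Hq.
    + destruct (rough_perturbation (fun y => Im (f (r * expi y)%C)) (weier (- (PI / 2))) c L d0 theta Pc Pd0)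
        with (M := M) (d := e) as [y [Hy Hq]]; [| |exact He|].
      * intros y Hy. eapply Rle_trans; [|now apply HL0].
        apply (Rabs_Im_le (f (r * expi y)%C - f (r * expi theta)%C)).
      * intros n. apply weier_rough.
      * exists y. split; [exact Hy|]. rewrite !Epsi. unfold H. rewrite !lacunary_expi.
        assert (E : forall (z : C) (x x' : R), Im (z + c * (x, x')) = Im z + c * x')
          by (intros z x x'; unfold Im; simpl; ring).
        rewrite !E. exact Hq.
  - intros p Hp. destruct (psi_spec Om phi Hphi p Hp) as [Hz Ep].
    unfold H. set (z := psi phi p) in *. rewrite <- Ep. fold (f z).
    replace (f z - (f (r * z)%C + c * lacunary z))%C
      with ((f z - f (r * z)%C) + - (c * lacunary z))%C by ring.
    eapply Rle_lt_trans; [apply Cmod_triangle|].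
    rewrite Cmod_opp, Cmod_mult, Cmod_R, Rabs_right by lra.
    assert (B := lacunary_bound z Hz).
    assert (A : Cmod (f z - f (r * z)%C) < eps / 2).
    { apply Hu; [assert (A := Hrz1 z Hz); lra|exact Hz|].
      replace (z - r * z)%C with (RtoC q * z)%C
        by (unfold r; rewrite RtoC_minus; ring).
      rewrite Cmod_mult, Cmod_R, Rabs_right by lra. assert (P := Cmod_ge_0 z). nra. }
    assert (D : c * Cmod (lacunary z) <= c * 4) by (apply Rmult_le_compat_l; lra).
    unfold c in *. lra.
Qed.

Theorem theorem3p2 (gamma : R -> C) (Hgamma : jordan_curve gamma)
  (Om : C -> Prop) (HOm : unbounded_component (fun z => ~ curve_image gamma z) Om)
  (phi : C -> option C) (Hphi : riemann_map Om phi) :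
  let S := fun F : option C -> C =>
    in_A Om F /\ in_Z (fun y => F (phi (expi y))) in
  A_Gdelta Om S /\ A_dense Om S.
Proof.
  intros S. split.
  - exists (boundary_rough phi). split.
    + intros n. now apply boundary_rough_open.
    (* The G-delta condition compares the sets on members of A, where the first conjunct of [S] is
       given by [HF]. *)
    + intros F HF. unfold S. rewrite <- (in_Z_iff_boundary_rough Om phi F Hphi HF). tauto.
  - apply rough_boundary_dense; [exact Hphi| |now apply unbounded_component_exterior with gamma].
    apply component_open with (2 := HOm). now apply curve_complement_open.
Qed.
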